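(* For every partition $\lambda$, $g^{(\alpha,\beta)}_\lambda(x_1,x_2,\ldots)=\sum_{T\in RBT(\lambda)}w_T(\alpha,\beta)\,x^T$.
   Context: Let $\alpha,\beta$ be indeterminates, $\Lambda$ the ring of symmetric functions over $\mathbb{Z}[\alpha,\beta]$ in $x=(x_1,x_2,\ldots)$, $\hat\Lambda$ its completion, and $\langle\cdot,\cdot\rangle:\Lambda\times\hat\Lambda\to\mathbb{Z}[\alpha,\beta]$ the Hall inner product, $\langle s_\lambda,s_\mu\rangle=\delta_{\lambda\mu}$. For a partition $\lambda$ and $n\ge1$, $G^{(\alpha,\beta)}_\lambda(x_1,\ldots,x_n)=\det\Big[\frac{x_i^{\lambda_j+n-j}(1+\beta x_i)^{j-1}}{(1-\alpha x_i)^{\lambda_j}}\Big]_{1\le i,j\le n}\Big/\prod_{i<j}(x_i-x_j)$, stable under $x_{n+1}=0$, defining $G^{(\alpha,\beta)}_\lambda\in\hat\Lambda$; $G^{(\alpha,\beta)}_\lambda=s_\lambda+$(higher degree terms). The dual canonical stable Grothendieck polynomials $g^{(\alpha,\beta)}_\lambda\in\Lambda$ are defined by $\langle g^{(\alpha,\beta)}_\lambda,G^{(-\alpha,-\beta)}_\mu\rangle=\delta_{\lambda\mu}$. Rim border tableaux: a reverse plane partition (RPP) of shape $\lambda$ is a filling of the boxes of $\lambda$ (English notation) by positive integers weakly increasing along rows and down columns. For an RPP $T$ and an integer $i$, let $T_i$ be the set of boxes containing $i$, and let the border $R_i\subseteq T_i$ be the set of boxes $b\in T_i$ such that no box of $T_i$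 lies on the same diagonal as $b$ strictly above and to the left of $b$; the inner part is $I_i=T_i\setminus R_i$. A rim hook is a connected skew shape containing no $2\times2$ square. A rim border tableau (RBT) of shape $\lambda$ is an RPP $T$ together with, for each $i$, a partition of $R_i$ into rim hooks obtained by cutting $R_i$ only by vertical cuts (i.e. vertically adjacent boxes of $R_i$ always lie in the same rim hook, and each part is a rim hook). $RBT(\lambda)$ is the set of these. For $T\in RBT(\lambda)$, $w_T(\alpha,\beta)=\alpha^{wt}\beta^{ht}(\alpha+\beta)^{in}$ where $wt$ is the sum over all rim hooks of (width $-1$), $ht$ the sum over all rim hooks of (height $-1$), and $in$ the total number of boxes in the inner parts; $x^T=\prod_i x_i^{a_i}$ with $a_i$ the number of rim hooks containing entry $i$. *)

(* Defs.v *)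
From HB Require Import structures.
From mathcomp Require Import all_boot all_order all_algebra all_fingroup.
From mathcomp Require Import finmap.
From mathcomp Require Import boolp classical_sets functions fsbigop.
From mathcomp Require Import mpoly.

Set Implicit Arguments.
Unset Strict Implicit.
Unset Printing Implicit Defensive.

Import GRing.Theory.

Local Open Scope ring_scope.

(* Formal power series in n variables: a series is the family of its
   coefficients, and the product is the Cauchy product (compare mcoeffM). *)

Record fps (n : nat) (K : Type) := Fps { fps_coef :> 'X_{1..n} -> K }.

HB.instance Definition _ n (K : Type) := gen_eqMixin (fps n K).
HB.instance Definition _ n (K : Type) := gen_choiceMixin (fps n K).

Section PowerSeries.
Context {n : nat} {K : comNzRingType}.
Implicit Types (f g h : fps n K) (p q r : {mpoly K[n]}) (m : 'X_{1..n}).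

Lemma fpsP f g : (forall m, f m = g m) -> f = g.
Proof. by case: f g => f [g] /= fg; congr Fps; apply/funext. Qed.

Definition fps_of p : fps n K := Fps (fun m => p@_m).

Definition fps_add f g : fps n K := Fps (fun m => f m + g m).

Definition fps_opp f : fps n K := Fps (fun m => - f m).

Definition fps_mul f g : fps n K :=
  Fps (fun m =>
    \sum_(k : 'X_{1..n < (mdeg m).+1, (mdeg m).+1} | m == (k.1 + k.2)%MM)
       f k.1 * g k.2).

Definition fps_trunc d f : {mpoly K[n]} :=
  \sum_(k : 'X_{1..n < d}) f k *: 'X_[k].

Lemma fps_truncE d f m : (mdeg m < d)%N -> (fps_trunc d f)@_m = f m.
Proof. by move=> md; rewrite /fps_trunc mcoeff_mpoly. Qed.

Lemma eq_mcoeffM d p p' q q' m : (mdeg m < d)%N ->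
  (forall k, (mdeg k < d)%N -> p@_k = p'@_k) ->
  (forall k, (mdeg k < d)%N -> q@_k = q'@_k) ->
  (p * q)@_m = (p' * q')@_m.
Proof.
move=> md pp qq; rewrite !mcoeffM; apply: eq_bigr => -[/= k1 k2] /eqP mE.
have [d1 d2] : (mdeg k1 < d)%N /\ (mdeg k2 < d)%N.
  by split; apply: leq_ltn_trans md;
    [have := leq_addr (mdeg k2) (mdeg k1) | have := leq_addl (mdeg k1) (mdeg k2)];
    rewrite -mdegD -mE.
by rewrite pp ?qq.
Qed.

Lemma fps_mulE d f g m : (mdeg m < d)%N ->
  fps_mul f g m = (fps_trunc d f * fps_trunc d g)@_m.
Proof.
move=> md; rewrite mcoeffM /=; apply: eq_bigr => -[/= k1 k2] /eqP mE.
have [d1 d2] : (mdeg k1 < d)%N /\ (mdeg k2 < d)%N.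
  by split; apply: leq_ltn_trans md;
    [have := leq_addr (mdeg k2) (mdeg k1) | have := leq_addl (mdeg k1) (mdeg k2)];
    rewrite -mdegD -mE.
by rewrite !fps_truncE.
Qed.

Lemma fps_addA : associative fps_add.
Proof. by move=> f g h; apply: fpsP => m /=; rewrite addrA. Qed.

Lemma fps_addC : commutative fps_add.
Proof. by move=> f g; apply: fpsP => m /=; rewrite addrC. Qed.

Lemma fps_add0 : left_id (fps_of 0) fps_add.
Proof. by move=> f; apply: fpsP => m /=; rewrite mcoeff0 add0r. Qed.

Lemma fps_addN : left_inverse (fps_of 0) fps_opp fps_add.
Proof. by move=> f; apply: fpsP => m /=; rewrite mcoeff0 addNr. Qed.

HB.instance Definition _ :=
  GRing.isZmodule.Build (fps n K) fps_addA fps_addC fps_add0 fps_addN.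

Lemma fps_mulA : associative fps_mul.
Proof.
move=> f g h; apply: fpsP => m; rewrite !(fps_mulE _ _ (ltnSn _)).
set d := (mdeg m).+1.
transitivity ((fps_trunc d f * (fps_trunc d g * fps_trunc d h))@_m).
  by apply: (@eq_mcoeffM d) => // k kd; rewrite fps_truncE// (fps_mulE _ _ kd).
rewrite mulrA; apply: (@eq_mcoeffM d) => // k kd.
by rewrite fps_truncE// (fps_mulE _ _ kd).
Qed.

Lemma fps_mulC : commutative fps_mul.
Proof.
by move=> f g; apply: fpsP => m; rewrite !(fps_mulE _ _ (ltnSn _)) mulrC.
Qed.

Lemma fps_mul1 : left_id (fps_of 1) fps_mul.
Proof.
move=> f; apply: fpsP => m; rewrite (fps_mulE _ _ (ltnSn _)).
rewrite (@eq_mcoeffM (mdeg m).+1 _ 1 _ (fps_trunc (mdeg m).+1 f)) //.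
  by rewrite mul1r fps_truncE.
by move=> k kd; rewrite fps_truncE.
Qed.

Lemma fps_mulDl : left_distributive fps_mul fps_add.
Proof.
move=> f g h; apply: fpsP => m /=; rewrite -big_split /=.
by apply: eq_bigr => k _; rewrite mulrDl.
Qed.

Lemma fps_1neq0 : fps_of 1 != fps_of 0.
Proof.
apply/eqP => /(congr1 (fun f : fps n K => f 0%MM)) /=.
by rewrite mcoeff1 mcoeff0 eqxx; apply/eqP/oner_neq0.
Qed.

HB.instance Definition _ := GRing.Zmodule_isComNzRing.Build (fps n K)
  fps_mulA fps_mulC fps_mul1 fps_mulDl fps_1neq0.

(* The quotient f / g, meant for a divisor g of f that is not a zero divisor:
   the quotient is then unique. *)
Definition fps_div f g : fps n K := xget 0 [set h | h * g = f]%classic.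

Definition vandermonde : fps n K :=
  fps_of (\prod_(i < n) \prod_(j < n | (i < j)%N) ('X_i - 'X_j)).

Definition bialternant (E : 'I_n -> 'I_n -> fps n K) : fps n K :=
  fps_div (\det (\matrix_(i < n, j < n) E i j)) vandermonde.

End PowerSeries.

Definition is_part (la : seq nat) : bool := sorted geq la && (0%N \notin la).

Definition intpart := {la : seq nat | is_part la}.

HB.instance Definition _ := Choice.on intpart.

Coercion seq_of_part (la : intpart) : seq nat := val la.

(* Series in infinitely many variables. Variables are numbered from 0: the
   index i stands for x_(i+1). *)

Definition monom := {fsfun nat -> nat with 0%N}.

HB.instance Definition _ := Choice.on monom.

Definition monom_deg (m : monom) : nat := (\sum_(i <- finsupp m) m i)%N.

Definition nvars (m : monom) : nat := (\max_(i <- finsupp m) i.+1)%N.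

Definition series (K : Type) := monom -> K.

HB.instance Definition _ (K : Type) := gen_eqMixin (series K).
HB.instance Definition _ (K : Type) := gen_choiceMixin (series K).

Section SymmetricFunctions.
Context {K : comNzRingType}.
Implicit Types (f h : series K) (la mu : intpart).

(* The series defined by power series F n in x_1, ..., x_n that are stable
   under x_(n+1) = 0 for n >= l. *)
Definition stable_limit (l : nat) (F : forall n, fps n K) : series K :=
  fun m => let n := maxn l (nvars m) in F n [multinom m i | i < n].

Definition is_symmetric f : Prop :=
  forall (s : nat -> nat) (m m' : monom), bijective s ->
    (forall i, m' i = m (s i)) -> f m' = f m.

Definition bounded_degree f : Prop :=
  exists d : nat, forall m, f m != 0 -> (monom_deg m <= d)%N.

(* The ring Lambda; its completion is given by is_symmetric alone. *)
Definition is_symfun f : Prop := is_symmetric f /\ bounded_degree f.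

Definition schur_fin la (n : nat) : fps n K :=
  bialternant (fun i j => fps_of ('X_i ^+ (nth 0%N la j + (n - j.+1)))).

(* When n < size la the determinantal formula ignores the last parts of la
   and is not stable, hence the bound. *)
Definition schur la : series K := stable_limit (size la) (schur_fin la).

(* f = \sum_mu c mu * s_mu; the sum of coefficients at m has finite support as
   s_mu is homogeneous of degree |mu|. *)
Definition schur_expansion f (c : intpart -> K) : Prop :=
  forall m : monom, f m = \sum_(mu \in [set: intpart]) c mu * schur mu m.

Definition schur_coef f : intpart -> K :=
  xget (fun=> 0) [set c | schur_expansion f c]%classic.

(* The Hall inner product on Lambda x (completion of Lambda): the first factor
   has finitely many nonzero Schur coefficients. *)
Definition hall f h : K :=
  \sum_(mu \in [set: intpart]) schur_coef f mu * schur_coef h mu.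

(* The column index j starts at 0, so it is the index j+1 of the usual
   formula. *)
Definition groth_fin (a b : K) la (n : nat) : fps n K :=
  bialternant (fun i j =>
    fps_div (fps_of ('X_i ^+ (nth 0%N la j + (n - j.+1)) * (1 + b *: 'X_i) ^+ j))
            (fps_of ((1 - a *: 'X_i) ^+ nth 0%N la j))).

Definition groth (a b : K) la : series K :=
  stable_limit (size la) (groth_fin a b la).

Definition dual_groth (a b : K) la : series K :=
  xget (fun=> 0)
    [set f | is_symfun f /\
             forall mu, hall f (groth (- a) (- b) mu) = (la == mu)%:R]%classic.

End SymmetricFunctions.

Definition box (la : seq nat) : finType :=
  {i : 'I_(size la) & 'I_(nth 0%N la i)}%type.

Section RimBorderTableaux.
Context {la : seq nat}.
Implicit Types (b c : box la) (B : {set box la}).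

Definition box_row b : nat := tag b.
Definition box_col b : nat := tagged b.

Definition is_diagram B : Prop :=
  forall b c, c \in B ->
    (box_row b <= box_row c)%N -> (box_col b <= box_col c)%N -> b \in B.

Definition is_skew_shape B : Prop :=
  exists mu nu : {set box la},
    [/\ is_diagram mu, is_diagram nu, mu \subset nu & B = nu :\: mu].

Definition below b c : bool :=
  (box_col c == box_col b) && (box_row c == (box_row b).+1).

Definition right_of b c : bool :=
  (box_row c == box_row b) && (box_col c == (box_col b).+1).

Definition adjacent b c : bool :=
  [|| below b c, below c b, right_of b c | right_of c b].

Definition is_connected B : Prop :=
  {in B &, forall b c,
    connect [rel x y | [&& x \in B, y \in B & adjacent x y]] b c}.

Definition has_cell B (r s : nat) : bool :=
  [exists b in B, (box_row b == r) && (box_col b == s)].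

Definition no_square B : Prop :=
  forall r s : nat,
    ~~ [&& has_cell B r s, has_cell B r s.+1,
           has_cell B r.+1 s & has_cell B r.+1 s.+1].

Definition is_rim_hook B : Prop :=
  [/\ B != finset.set0, is_skew_shape B, is_connected B & no_square B].

Definition width B : nat := size (undup [seq box_col b | b in B]).
Definition height B : nat := size (undup [seq box_row b | b in B]).

(* Entries start at 0, like the indices of the variables: the entry i stands
   for the positive integer i+1. *)
Implicit Types T : {ffun box la -> nat}.

Definition is_rpp T : Prop :=
  (forall b c, box_row b = box_row c ->
     (box_col b <= box_col c)%N -> (T b <= T c)%N) /\
  (forall b c, box_col b = box_col c ->
     (box_row b <= box_row c)%N -> (T b <= T c)%N).

Definition level T (i : nat) : {set box la} := [set b | T b == i].

Definition same_diagonal b c : bool :=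
  (box_row b + box_col c == box_row c + box_col b)%N.

Definition border T (i : nat) : {set box la} :=
  [set b in level T i | ~~ [exists c in level T i,
     [&& same_diagonal b c, (box_row c < box_row b)%N & (box_col c < box_col b)%N]]].

Definition inner_part T (i : nat) : {set box la} := level T i :\: border T i.

End RimBorderTableaux.

(* A filling with the set of all its rim hooks. *)
Definition hooked_filling (la : seq nat) : choiceType :=
  ({ffun box la -> nat} * {set {set box la}})%type.

Section Tableaux.
Context {la : seq nat}.
Implicit Types T : hooked_filling la.

Definition hooks_at T (i : nat) : {set {set box la}} :=
  [set B in T.2 | B \subset border T.1 i].

Definition is_rbt T : Prop :=
  [/\ is_rpp T.1,
      forall B, B \in T.2 -> exists i, B \subset border T.1 i,
      forall i, finset.partition (hooks_at T i) (border T.1 i),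
      forall B, B \in T.2 -> is_rim_hook B &
      forall i (b c : box la), b \in border T.1 i -> c \in border T.1 i ->
        below b c -> exists B, [/\ B \in hooks_at T i, b \in B & c \in B]].

Definition wt T : nat := (\sum_(B in T.2) (width B - 1))%N.
Definition ht T : nat := (\sum_(B in T.2) (height B - 1))%N.
(* Every box b lies in level T.1 (T.1 b) only. *)
Definition inn T : nat := #|[set b | b \in inner_part T.1 (T.1 b)]|.

Definition weight (K : comNzRingType) (a b : K) T : K :=
  a ^+ wt T * b ^+ ht T * (a + b) ^+ inn T.

Definition rbt_monom T : monom :=
  [fsfun i in [fset T.1 b | b : box la]%fset => #|hooks_at T i|].

End Tableaux.

Definition RBT (la : seq nat) : set (hooked_filling la) := [set T | is_rbt T].
Arguments RBT : clear implicits.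

(* \sum_(T in RBT(la)) w_T x^T; its coefficient at m is a sum with finite
   support, as T has its entries in the support of m when x^T = m. *)
Definition rbt_sum (K : comNzRingType) (a b : K) (la : seq nat) : series K :=
  fun m => \sum_(T \in RBT la) weight a b T * (rbt_monom T == m)%:R.

Definition alpha : {mpoly int[2]} := 'X_ord0.
Definition beta : {mpoly int[2]} := 'X_ord_max.

(* Main.v *)
(* Write [F_la] for the tableau sum, and use the weights of single boxes: a
   filling contributes the product over its boxes [c] of [alpha + beta] if the
   north-west neighbour of [c] has the same entry, else of [beta] if the north
   neighbour does, else of [alpha + x] if the east neighbour does (the summands
   record whether the hook goes on), else of [x]. Hence [F] satisfies a one
   variable branching rule, with an explicit weight for each skew shape.

   The determinants [D_la] defining [G_la] at parameters [-alpha, -beta] have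
   entries [phi_(j,k) = y^(n-j) (1 - beta y)^(j-1) z^k] with
   [z = y / (1 + alpha y)] and [k = la_j]. Since
   [1 / (1 - x y) = (1 - alpha z) / (1 - (alpha + x) z)] and
   [phi_(j+1,k+1) = phi_(j,k) - (alpha + beta) phi_(j,k+1)], row operations show
   that multiplying [D_mu] by the product of the [1 / (1 - x y_i)] gives the sum
   over [la] of the branching weight of [la / mu] times [D_la]. Iterating this
   Pieri rule, and comparing with its case [alpha = beta = 0], yields
   [s_kap = sum_la C_(la,kap) F_la], where [C_(la,kap)] is the coefficient of
   [s_kap] in [G_la]. As [C] is unitriangular, this inverts by induction on the
   size of [kap], and says exactly that [F] is dual to [G]. *)

Require Import Defs.
From HB Require Import structures.
From mathcomp Require Import all_boot all_fingroup all_algebra zify ring boolp.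

Set Implicit Arguments.
Unset Strict Implicit.
Unset Printing Implicit Defensive.

Import GRing.Theory.

Local Open Scope ring_scope.

(** * Determinants with rows related to each other *)

(** The skew shapes [la / mu] of the branching rule are arbitrary, since a box below another one has
    weight [b] or [a + b] rather than 0. So the Pieri rule is no sum over interlacing partitions:
    each row is first summed over all its lengths, and the terms in which a row exceeds the one
    above cancel afterwards. They cancel because beyond the row above the weights are geometric with
    ratio [a + b], exactly the ratio in the relation between neighbouring rows of the determinant.
    The comparison with [alpha = beta = 0] reads one determinant in two ways: the factors 1 / (1 - x
    y_i) act either on the functions phi_(j,k) or on the exponents at which coefficients are taken.

    Quotients, Schur coefficients and dual polynomials are all chosen by [xget], so each calls for
    uniqueness besides existence. For the dual polynomials this means expanding an arbitrary
    symmetric series of bounded degree in Schur functions; the argument goes through alternating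
    series and uses that x = -x implies x = 0 in Z[alpha, beta]. *)

Section DetTools.
Context {R : comNzRingType}.

Lemma det_sum_rows (N M : nat) (F : 'I_N -> 'I_M -> 'rV[R]_N) :
  \det (\matrix_j \sum_(l < M) F j l) =
  \sum_(f : {ffun 'I_N -> 'I_M}) \det (\matrix_j F j (f j)).
Proof.
rewrite /determinant exchange_big /=; apply: eq_bigr => s _.
rewrite -big_distrr /=; congr (_ * _).
transitivity (\prod_(i < N) \sum_(l < M) F i l 0 (s i)).
  by apply: eq_bigr => i _; rewrite mxE summxE.
rewrite bigA_distr_bigA /=; apply: eq_bigr => f _.
by apply: eq_bigr => i _; rewrite mxE.
Qed.

Lemma det_scale_rows (N : nat) (c : 'I_N -> R) (r : 'I_N -> 'rV[R]_N) :
  \det (\matrix_j (c j *: r j)) = \prod_j c j * \det (\matrix_j r j).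
Proof.
rewrite (_ : \matrix_j _ = diag_mx (\row_j c j) *m \matrix_j r j).
  by rewrite det_mulmx det_diag; congr (_ * _); apply: eq_bigr => j _; rewrite mxE.
by apply/row_matrixP => j; rewrite rowK row_mul row_diag_mx -scalemxAl -rowE rowK mxE.
Qed.

(** The row added is the already modified [s j], so [r] arises from [s] by a lower unitriangular
    matrix with a single subdiagonal. *)
Lemma det_add_prev (N : nat) (c : nat -> R) (r s : nat -> 'rV[R]_N) :
  s 0%N = r 0%N ->
  (forall j, (j.+1 < N)%N -> s j.+1 = r j.+1 + c j *: s j) ->
  \det (\matrix_(j < N) s j) = \det (\matrix_(j < N) r j).
Proof.
move=> s0 sS.
pose B : 'M[R]_N := \matrix_(i, j) ((i == j)%:R - (i == j.+1 :> nat)%:R * c j).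
have -> : \matrix_(j < N) r j = B *m \matrix_(j < N) s j.
  apply/row_matrixP => i; rewrite rowK; apply/rowP => k; rewrite row_mul.
  rewrite !mxE (bigD1 i) //= !mxE eqxx.
  have -> : (i == i.+1 :> nat) = false by apply/negP => /eqP; lia.
  rewrite mul0r subr0 mul1r.
  case: i => -[|i] lti /=.
    rewrite big1 ?addr0 ?s0 // => j /negPf nj; rewrite !mxE eq_sym nj.
    by rewrite mul0r subr0 mul0r.
  have lti' : (i < N)%N by lia.
  rewrite (bigD1 (Ordinal lti')) /=; last by rewrite -val_eqE /=; lia.
  rewrite !mxE eqxx big1 ?addr0; last first.
    move=> j /andP[/negPf nj /negPf nj2]; rewrite !mxE eq_sym nj.
    have -> : (i.+1 == j.+1) = false.
      by apply: contraFF nj2 => /eqP[e]; apply/eqP/val_inj; rewrite /= e.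
    by rewrite mul0r subr0 mul0r.
  have -> : (Ordinal lti == Ordinal lti') = false.
    by apply/negP => /eqP/(congr1 val) /=; lia.
  by rewrite mul1r sub0r mulNr sS // !mxE addrK.
rewrite det_mulmx det_trig; last first.
  apply/is_trig_mxP => i j ltij; rewrite mxE.
  have -> : (i == j) = false by apply/negP => /eqP e; rewrite e ltnn in ltij.
  have -> : (i == j.+1 :> nat) = false by apply/negP => /eqP e; lia.
  by rewrite mul0r subr0.
rewrite big1 ?mul1r // => i _; rewrite !mxE eqxx.
have -> : (i == i.+1 :> nat) = false by apply/negP => /eqP; lia.
by rewrite mul0r subr0.
Qed.

(** Mirror image of [det_add_prev], with an upper unitriangular matrix; [s N = 0] lets the last row
    obey the same relation. *)
Lemma det_add_next (N : nat) (c : nat -> R) (r s : nat -> 'rV[R]_N) :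
  s N = 0 -> (forall j, (j < N)%N -> s j = r j + c j *: s j.+1) ->
  \det (\matrix_(j < N) s j) = \det (\matrix_(j < N) r j).
Proof.
move=> s0 sS.
pose B : 'M[R]_N := \matrix_(i, j) ((i == j)%:R - (i.+1 == j :> nat)%:R * c i).
have -> : \matrix_(j < N) r j = B *m \matrix_(j < N) s j.
  apply/row_matrixP => i; rewrite rowK; apply/rowP => k; rewrite row_mul.
  rewrite !mxE (bigD1 i) //= !mxE eqxx.
  have -> : (i.+1 == i :> nat) = false by apply/negP => /eqP; lia.
  rewrite mul0r subr0 mul1r (sS i) // !mxE.
  have [lti|gei] := ltnP i.+1 N.
    rewrite (bigD1 (Ordinal lti)) /=; last by rewrite -val_eqE /=; lia.
    rewrite !mxE eqxx big1 ?addr0; last first.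
      move=> j /andP[/negPf nj /negPf nj2]; rewrite !mxE eq_sym nj.
      have -> : (i.+1 == j) = false.
        by apply: contraFF nj2 => /eqP e; apply/eqP/val_inj; rewrite /= e.
      by rewrite mul0r subr0 mul0r.
    have -> : (i == Ordinal lti) = false.
      by apply/negP => /eqP/(congr1 val) /=; lia.
    by rewrite mul1r sub0r mulNr addrK.
  have -> : i.+1 = N by have := ltn_ord i; lia.
  rewrite s0 mxE mulr0 addr0 big1 ?addr0 // => j /negPf nj.
  rewrite !mxE eq_sym nj.
  have -> : (i.+1 == j) = false by have := ltn_ord j; lia.
  by rewrite mul0r subr0 mul0r.
rewrite -det_tr -[RHS]det_tr trmx_mul det_mulmx [X in _ = _ * X]det_trig.
  rewrite [X in _ * X]big1 ?mulr1 // => i _; rewrite !mxE eqxx.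
  have -> : (i.+1 == i :> nat) = false by apply/negP => /eqP; lia.
  by rewrite mul0r subr0.
apply/is_trig_mxP => i j ltij; rewrite !mxE.
have -> : (j == i) = false by apply/negP => /eqP e; rewrite e ltnn in ltij.
have -> : (j.+1 == i :> nat) = false by apply/negP => /eqP e; lia.
by rewrite mul0r subr0.
Qed.

Lemma det_two_rows (N : nat) (A : 'M[R]_N) (i j : 'I_N) (c : R) :
  i != j -> row i A = c *: row j A -> \det A = 0.
Proof.
move=> nij Aij.
pose B : 'M[R]_N := \matrix_l (if l == i then row j A else row l A).
rewrite (@determinant_multilinear _ _ A B B i c 0).
- rewrite mul0r addr0 (determinant_alternate nij) ?mulr0 //.
  by move=> k; rewrite !mxE eqxx eq_sym (negPf nij) !mxE.
- by rewrite scale0r addr0 /B rowK eqxx.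
- by apply/matrixP => k l; rewrite !mxE eq_sym (negPf (neq_lift i k)) mxE.
- by apply/matrixP => k l; rewrite !mxE eq_sym (negPf (neq_lift i k)) mxE.
Qed.

End DetTools.

(* The weight of the boxes [m <= c < l] of a row, when the boxes [u <= c] of the
   row above belong to the same skew shape. *)
Definition row_weight {R : comNzRingType} (a b x : R) (u m l : nat) : R :=
  \prod_(m <= c < l)
    (if (u < c)%N then a + b else if c == u then b
     else if (c.+1 < l)%N then a + x else x).

(* In the first row no box has a neighbour above, so the cutoff is put beyond the
   last box. *)
Definition prev_row (la mu : nat -> nat) (j : nat) : nat :=
  if j is i.+1 then mu i else la 0%N.

Definition strip_weight {R : comNzRingType} (N : nat) (a b x : R)
    (la mu : nat -> nat) : R :=
  \prod_(j < N) (if (mu j <= la j)%N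
                 then row_weight a b x (prev_row la mu j) (mu j) (la j) else 0).

Section RowWeight.
Context {R : comNzRingType} (a b x : R).

Lemma row_weight0 u m : row_weight a b x u m m = 1.
Proof. by rewrite /row_weight big_geq. Qed.

Lemma row_weight_low u m d : (m + d < u)%N ->
  row_weight a b x u m (m + d.+1) = x * (a + x) ^+ d.
Proof.
move=> ltu; rewrite /row_weight addnS big_nat_recr ?leq_addr //=.
rewrite !ltnn (_ : (u < m + d)%N = false); last by lia.
rewrite (_ : (m + d == u)%N = false); last by lia.
rewrite mulrC; congr (_ * _).
rewrite (eq_big_nat _ _ (F2 := fun=> a + x)) => [|c /andP[mc cd]].
  by rewrite prodr_const_nat addKn.
by do 2 (rewrite ifF; last by lia); rewrite ifT //; lia.
Qed.

(** Past the cutoff the weight is geometric in the excess [d], with ratio [a + b]; [telescope] sums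
    this progression. *)
Lemma row_weight_high u m d : (m <= u)%N ->
  row_weight a b x u m (u + d.+1) = b * (a + x) ^+ (u - m) * (a + b) ^+ d.
Proof.
move=> lemu; rewrite /row_weight (big_cat_nat (n := u)) //=; last by lia.
rewrite [X in _ * X]big_ltn ?ltnn ?eqxx; last by lia.
rewrite mulrA [X in X * _]mulrC -!mulrA; congr (_ * _).
rewrite (eq_big_nat _ _ (F2 := fun=> a + x)) => [|c /andP[mc cd]]; last first.
  by do 2 (rewrite ifF; last by lia); rewrite ifT //; lia.
rewrite prodr_const_nat; congr (_ * _).
rewrite (eq_big_nat _ _ (F2 := fun=> a + b)) => [|c /andP[mc cd]]; last first.
  by rewrite ifT //; lia.
by rewrite prodr_const_nat; congr (_ ^+ _); lia.
Qed.

End RowWeight.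

Section FinFun.
Context {N M : nat}.
Implicit Types (g : {ffun 'I_N -> 'I_M}) (i : 'I_N) (l : 'I_M).

Definition nat_fun g : nat -> nat :=
  fun j => if insub j is Some i then nat_of_ord (g i) else 0%N.

Lemma nat_funE g i : nat_fun g i = g i.
Proof. by rewrite /nat_fun valK. Qed.

Lemma nat_fun_out g j : (N <= j)%N -> nat_fun g j = 0%N.
Proof. by move=> leN; rewrite /nat_fun insubF //; apply/negbTE; rewrite -leqNgt. Qed.

Definition upd g i l : {ffun 'I_N -> 'I_M} :=
  [ffun k => if k == i then l else g k].

Lemma updE g i l k : upd g i l k = if k == i then l else g k.
Proof. by rewrite ffunE. Qed.

Lemma nat_fun_upd g i l j :
  nat_fun (upd g i l) j = if j == i :> nat then nat_of_ord l else nat_fun g j.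
Proof.
rewrite /nat_fun; case: insubP => [k _ <-|nj]; first by rewrite updE -val_eqE; case: eqP.
by case: eqP => // ej; rewrite ej ltn_ord in nj.
Qed.

(** Fubini for one coordinate: the functions with [g i = l0] represent the choices of all other
    coordinates. *)
Lemma sum_upd (V : nmodType) (F : {ffun 'I_N -> 'I_M} -> V) i (l0 : 'I_M) :
  \sum_g F g = \sum_(g : {ffun 'I_N -> 'I_M} | g i == l0) \sum_l F (upd g i l).
Proof.
rewrite (partition_big (fun g => upd g i l0) (fun g => g i == l0)) /=; last first.
  by move=> g _; rewrite updE eqxx.
apply: eq_bigr => g /eqP gi.
rewrite (reindex_onto (fun l => upd g i l) (fun g' => g' i)) /=.
  apply: eq_bigl => l; rewrite updE !eqxx andbT; apply/eqP/ffunP => k.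
  by rewrite !updE; case: eqP => // ->.
move=> g' /eqP <-; apply/ffunP => k; rewrite !updE.
by case: eqP => // ->.
Qed.

Definition nonincr g : bool := [forall i : 'I_N, nat_fun g i.+1 <= nat_fun g i]%N.

Lemma nonincrP g : nonincr g -> forall j, (nat_fun g j.+1 <= nat_fun g j)%N.
Proof.
move=> /forallP h j; have [ltj|lej] := ltnP j N; first exact: (h (Ordinal ltj)).
by rewrite nat_fun_out // leqW.
Qed.

End FinFun.

(** * Row operations: from full rows to strips *)

Section Wedge.
Context {R : comNzRingType} (N M : nat) (a b x : R) (f : nat -> nat -> 'rV[R]_N).
Hypothesis f_big : forall j k, (M <= k)%N -> f j k = 0.
Hypothesis f_rel : forall j k, (j.+1 < N)%N ->
  f j.+1 k.+1 = f j k - (a + b) *: f j k.+1.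

(** With [f j k] standing for phi_(j,k), this is phi_(j,k) / (1 - (a + x) z). As 1 / (1 - x y) = 1 +
    x z / (1 - (a + x) z), [full_row j k] below stands for phi_(j,k) / (1 - x y). *)
Definition tail_sum j k := \sum_(k <= l < M) (a + x) ^+ (l - k) *: f j l.

Lemma tail_sumS j k : tail_sum j k = f j k + (a + x) *: tail_sum j k.+1.
Proof.
rewrite /tail_sum; have [leMk|ltkM] := leqP M k.
  by rewrite !big_geq ?f_big ?scaler0 ?addr0 //; lia.
rewrite big_ltn // subnn scale1r scaler_sumr; congr (_ + _).
apply: eq_big_nat => l /andP[kl lM]; rewrite scalerA -exprS.
by congr (_ ^+ _ *: _); lia.
Qed.

Definition full_row j k := f j k + x *: tail_sum j k.+1.

Lemma tail_rel j k : (j.+1 < N)%N ->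
  tail_sum j.+1 k.+1 = f j k + (x - b) *: tail_sum j k.+1.
Proof.
move=> ltj.
have -> : tail_sum j.+1 k.+1 = tail_sum j k - (a + b) *: tail_sum j k.+1.
  rewrite /tail_sum; have [leMk|ltkM] := leqP M k.+1.
    rewrite !(@big_geq _ _ _ k.+1) // scaler0 subr0.
    have [leMk'|ltkM] := leqP M k; first by rewrite big_geq.
    have -> : M = k.+1 by lia.
    rewrite big_nat1 subnn scale1r; have := f_rel k ltj.
    by rewrite (f_big j.+1 leMk) (f_big j leMk) scaler0 subr0 => <-.
  rewrite (_ : M = M.-1.+1); last by lia.
  have MM : M.-1.+1 = M by lia.
  rewrite big_add1 /=.
  have -> : \sum_(k <= i < M.-1) (a + x) ^+ (i.+1 - k.+1) *: f j.+1 i.+1 =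
     \sum_(k <= i < M.-1) ((a + x) ^+ (i - k) *: f j i
         - (a + b) *: ((a + x) ^+ (i - k) *: f j i.+1)).
    apply: eq_big_nat => i _; rewrite subSS f_rel // scalerBr !scalerA.
    by rewrite [_ * (a + b)]mulrC.
  rewrite sumrB -scaler_sumr.
  rewrite [in RHS]big_nat_recr /=; last by lia.
  rewrite [in RHS]big_add1 /=.
  (* [f_rel] at the cutoff forces [f j M.-1 = 0], so shifting the summation index loses no term. *)
  have := f_rel M.-1 ltj; rewrite MM (f_big j.+1 (leqnn M)) (f_big j (leqnn M)) scaler0 subr0 => <-.
  by rewrite scaler0 addr0; congr (_ - _ *: _); apply: eq_big_nat => i _; rewrite subSS.
by rewrite tail_sumS -addrA -scalerBl; congr (_ + _ *: _); ring.
Qed.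

(** [f_rel] reads f_j(c) = f_(j+1)(c+1) + (a + b) f_j(c+1); iterating it up to [M] exhausts the last
    term. *)
Lemma telescope j c : (j.+1 < N)%N ->
  \sum_(c.+1 <= l < M) (a + b) ^+ (l - c.+1) *: f j.+1 l = f j c.
Proof.
move=> ltj.
have [n] := ubnP (M - c); elim: n c => // n IHn c len.
have [leMk|ltkM] := leqP M c.+1.
  rewrite big_geq //; have := f_rel c ltj.
  by rewrite (f_big j.+1 leMk) (f_big j leMk) scaler0 subr0.
rewrite big_ltn // subnn scale1r f_rel //.
rewrite -[in RHS](subrK ((a + b) *: f j c.+1) (f j c)); congr (_ + _).
rewrite -(IHn c.+1) ?scaler_sumr; last by lia.
apply: eq_big_nat => l /andP[kl lM]; rewrite scalerA -exprS.
by congr (_ ^+ _ *: _); lia.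
Qed.

Context (mu : nat -> nat).
Hypothesis mu_dec : forall j, (mu j.+1 <= mu j)%N.
Hypothesis mu_lt : (mu 0 < M)%N.

Lemma mu_ltM j : (mu j < M)%N.
Proof. by elim: j => // j IH; apply: leq_ltn_trans IH. Qed.

(* The length [l] is not bounded by that of the row above: [ascent_cancel] shows
   that the excess terms do not contribute. *)
Definition strip_row j : 'rV[R]_N :=
  \sum_(mu j <= l < M) row_weight a b x (prev_row (fun=> M) mu j) (mu j) l *: f j l.

(** Up to the cutoff the weights are the coefficients in the expansion of [full_row j m], so only
    the tail from [n] on is missing. *)
Lemma low_sum u m n j : (m < n)%N -> (n <= u.+1)%N -> (n <= M)%N ->
  \sum_(m <= l < n) row_weight a b x u m l *: f j l =
  full_row j m - (x * (a + x) ^+ (n.-1 - m)) *: tail_sum j n.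
Proof.
move=> mn nu nM; apply/eqP; rewrite -subr_eq opprK; apply/eqP.
rewrite big_ltn // row_weight0 scale1r -addrA; congr (_ + _).
rewrite /tail_sum [in RHS](big_cat_nat (n := n)) //= scalerDr !scaler_sumr.
congr (_ + _); last first.
  apply: eq_big_nat => l /andP[kl lM].
  rewrite !scalerA -mulrA -exprD; congr ((_ * _ ^+ _) *: _); lia.
apply: eq_big_nat => l /andP[ml lu].
rewrite {1}(_ : l = m + (l - m.+1).+1)%N; last by lia.
by rewrite row_weight_low ?scalerA //; lia.
Qed.

Lemma strip_row0 : strip_row 0 = full_row 0 (mu 0%N).
Proof.
rewrite /strip_row /= low_sum ?leqnSn //.
by rewrite /tail_sum [X in _ *: X]big_geq // scaler0 subr0.
Qed.

(** The lengths beyond [c] add up to a multiple of the entry [f j c] of the row above. This serves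
    twice: for [c = mu j] in [strip_rowS], and for [c] the length of the row above in
    [ascent_cancel]. *)
Lemma high_sum j c : (j.+1 < N)%N -> (mu j <= c)%N ->
  \sum_(c.+1 <= l < M) row_weight a b x (mu j) (mu j.+1) l *: f j.+1 l =
  (b * (a + x) ^+ (mu j - mu j.+1) * (a + b) ^+ (c - mu j)) *: f j c.
Proof.
move=> ltj lec; rewrite -(telescope c ltj) scaler_sumr.
apply: eq_big_nat => l /andP[cl lM]; rewrite scalerA -mulrA -exprD.
rewrite {1}(_ : l = mu j + (l - (mu j).+1).+1)%N; last by lia.
by rewrite row_weight_high //; congr (_ * _ ^+ _ *: _); lia.
Qed.

(** Write A for the power of [a + x], f for [f j (mu j)] and t for [tail_sum j (mu j).+1]. The tail
    missing from [low_sum] is x A (f + (x - b) t) by [tail_rel], and the excess lengths contribute b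
    A f. The difference is (x - b) A (f + x t), a multiple of the previous full row, which the
    determinant ignores. *)
Lemma strip_rowS j : (j.+1 < N)%N -> full_row j.+1 (mu j.+1) =
  strip_row j.+1 + ((x - b) * (a + x) ^+ (mu j - mu j.+1)) *: full_row j (mu j).
Proof.
move=> ltj; rewrite /strip_row /= (big_cat_nat (n := (mu j).+1)) ?mu_ltM //=; last first.
  exact: leqW.
rewrite high_sum // low_sum ?ltnS ?mu_ltM //= tail_rel // subnn expr0 mulr1.
rewrite /full_row !scalerDr !scalerA.
move: (tail_sum j _) (tail_sum j.+1 _) (f j _) (f j.+1 _) (_ ^+ _) => u v w z A.
by apply/rowP => i; rewrite !mxE; ring.
Qed.

Lemma det_full_row :
  \det (\matrix_(j < N) full_row j (mu j)) = \det (\matrix_(j < N) strip_row j).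
Proof.
by apply: det_add_prev (esym strip_row0) strip_rowS.
Qed.

Definition strip_coef j l : R :=
  if (mu j <= l)%N then row_weight a b x (prev_row (fun=> M) mu j) (mu j) l else 0.

Lemma strip_rowE j : strip_row j = \sum_(l < M) strip_coef j l *: f j l.
Proof.
rewrite /strip_row -(big_mkord predT (fun l => strip_coef j l *: f j l)).
rewrite [RHS](big_cat_nat (n := mu j)) ?(ltnW (mu_ltM j)) //=.
rewrite [X in _ = X + _]big_nat_cond [X in _ = X + _]big1 ?add0r.
  by apply: eq_big_nat => l /andP[le _]; rewrite /strip_coef le.
by move=> l /andP[/andP[_ lt] _]; rewrite /strip_coef leqNgt lt scale0r.
Qed.

(** Monotonicity among the first [t] rows only: [ascent_cancel] removes the ascents one row at a
    time, from the top. *)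
Definition nonincr_upto t (g : {ffun 'I_N -> 'I_M}) : bool :=
  [forall i : 'I_N, (i.+1 < t)%N ==> (nat_fun g i.+1 <= nat_fun g i)%N].

Let term (g : {ffun 'I_N -> 'I_M}) : R :=
  (\prod_(j < N) strip_coef j (g j)) * \det (\matrix_(j < N) f j (g j)).

(* By [high_sum], summing over the length of row [t.+1] when it exceeds that of
   row [t] gives a determinant with two proportional rows. *)
Lemma ascent_cancel t : (t.+1 < N)%N ->
  \sum_(g | nonincr_upto t.+1 g && (nat_fun g t < nat_fun g t.+1)%N) term g = 0.
Proof.
move=> ltt; have ltt' : (t < N)%N by lia.
pose i := Ordinal ltt; pose i' := Ordinal ltt'.
have nii : i' != i by rewrite -val_eqE /=; lia.
have M_gt0 : (0 < M)%N by lia.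
rewrite big_mkcond (sum_upd _ i (Ordinal M_gt0)) big1 // => g _.
have updi l : upd g i l i' = g i' by rewrite updE (negPf nii).
under eq_bigr => l _.
  rewrite (_ : nat_fun (upd g i l) t.+1 = l); last by rewrite nat_fun_upd eqxx.
  rewrite (_ : nat_fun (upd g i l) t = nat_fun g t); last first.
    by rewrite nat_fun_upd ifF //=; lia.
  rewrite (_ : nonincr_upto t.+1 (upd g i l) = nonincr_upto t.+1 g); last first.
    apply: eq_forallb => k; case: ltnP => //= ltk; rewrite !nat_fun_upd /=.
    by rewrite !ifF //; lia.
  over.
case: (nonincr_upto t.+1 g); last by rewrite big1.
(* If row [t] is shorter than [mu t], its coefficient is already 0; otherwise [high_sum] applies
   with [c = g i']. *)
have [ltg|leg] := ltnP (g i') (mu t).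
  rewrite big1 // => l _; case: ifP => // _; rewrite /term (bigD1 i') //= updi.
  by rewrite /strip_coef leqNgt ltg mul0r mul0r.
pose c := \prod_(k | k != i) strip_coef k (g k).
pose A (v : 'rV[R]_N) : 'M[R]_N := \matrix_k (if k == i then v else f k (g k)).
have termE l : term (upd g i l) = c * (strip_coef i l * \det (A (f i l))).
  rewrite /term (bigD1 i) //= updE eqxx mulrA [c * _]mulrC; congr (_ * _ * _).
    by apply: eq_bigr => k /negPf nk; rewrite updE nk.
  congr (\det _); apply/row_matrixP => k; rewrite !rowK updE.
  by case: eqP => // ->.
have linA (F : 'I_M -> 'rV[R]_N) (P : pred 'I_M) :
    \det (A (\sum_(l | P l) F l)) = \sum_(l | P l) \det (A (F l)).
  have A0 : \det (A 0) = 0.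
    rewrite (@determinant_multilinear _ _ _ (A 0) (A 0) i 0 0) ?mul0r ?addr0 //.
    by rewrite rowK eqxx !scale0r addr0.
  have AD v w : \det (A (v + w)) = \det (A v) + \det (A w).
    rewrite (@determinant_multilinear _ _ _ (A v) (A w) i 1 1) ?mul1r //.
    - by rewrite !rowK eqxx !scale1r.
    - by apply/matrixP => k l; rewrite !mxE eq_sym (negPf (neq_lift i k)).
    - by apply/matrixP => k l; rewrite !mxE eq_sym (negPf (neq_lift i k)).
  exact: (big_morph (fun v => \det (A v)) AD A0).
have AZ d v : \det (A (d *: v)) = d * \det (A v).
  rewrite (@determinant_multilinear _ _ _ (A v) (A v) i d 0) ?mul0r ?addr0 //.
  - by rewrite !rowK eqxx scale0r addr0.
  - by apply/matrixP => k l; rewrite !mxE eq_sym (negPf (neq_lift i k)).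
  - by apply/matrixP => k l; rewrite !mxE eq_sym (negPf (neq_lift i k)).
under eq_bigr => l _ do rewrite termE -AZ.
rewrite -big_mkcond /= -big_distrr -linA /=.
have -> : \sum_(l < M | (nat_fun g t < l)%N) strip_coef t.+1 l *: f t.+1 l =
   \sum_((nat_fun g t).+1 <= l < M) strip_coef t.+1 l *: f t.+1 l.
  rewrite -(big_mkord (fun l => nat_fun g t < l)%N
     (fun l => strip_coef t.+1 l *: f t.+1 l)).
  have gt : (nat_fun g t < M)%N by rewrite (nat_funE g i').
  rewrite (big_cat_nat (n := (nat_fun g t).+1)) //= big_nat_cond big1 ?add0r.
    by rewrite [RHS]big_nat_cond [LHS]big_nat_cond; apply: eq_bigl => l; lia.
  by move=> l; lia.
rewrite (nat_funE g i') (_ : \sum_(_ <= l < M) _ =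
   \sum_((g i').+1 <= l < M)
      row_weight a b x (mu t) (mu t.+1) l *: f t.+1 l); last first.
  apply: eq_big_nat => l /andP[gl lM]; rewrite /strip_coef ifT //.
  by apply: leq_trans (mu_dec t) (leq_trans leg (ltnW gl)).
rewrite high_sum // (@det_two_rows _ _ _ i i' 
   (b * (a + x) ^+ (mu t - mu t.+1) * (a + b) ^+ (g i' - mu t))) ?mulr0 //.
  by rewrite eq_sym.
by rewrite !rowK eqxx (negPf nii).
Qed.

Lemma det_strip_row :
  \det (\matrix_(j < N) strip_row j) =
  \sum_(g : {ffun 'I_N -> 'I_M} | nonincr g)
     strip_weight N a b x (nat_fun g) mu * \det (\matrix_(j < N) f j (g j)).
Proof.
transitivity (\sum_(g | nonincr_upto N g) term g); last first.
  apply: eq_big => [g|g ].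
    apply: eq_forallb => i; have [//|leN /=] := ltnP i.+1 N.
    by rewrite nat_fun_out.
  rewrite /term /strip_weight => _; congr (_ * _); apply: eq_bigr => j _.
  rewrite /strip_coef nat_funE; case: ifP => // lej.
  case: j lej => -[|j] ltj lej //=; rewrite -(nat_funE g (Ordinal ltj)) /=.
  (* Only the first row is left: its cutoff is [M] in [strip_coef] and its own length in
     [strip_weight], both past every box. *)
  apply: eq_big_nat => c /andP[_ ltc].
  have := ltn_ord (g (Ordinal ltj)); rewrite -nat_funE /= => ltM.
  by do 2 (rewrite [LHS]ifF; last by lia); do 2 (rewrite [RHS]ifF; last by lia).
have -> : \det (\matrix_(j < N) strip_row j) = \sum_(g | nonincr_upto 0 g) term g.
  rewrite (_ : \matrix_(j < N) strip_row j = \matrix_(j < N) \sum_(l < M) strip_coef j l *: f j l).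
    rewrite (det_sum_rows (fun (j : 'I_N) (l : 'I_M) => strip_coef j l *: f j l)).
    apply: eq_big => [g|g _]; first by symmetry; apply/forallP.
    by rewrite det_scale_rows.
  by apply/row_matrixP => j; rewrite !rowK strip_rowE.
have step t : (t < N)%N -> \sum_(g | nonincr_upto t g) term g =
    \sum_(g | nonincr_upto t.+1 g) term g.
  case: t => [|t] ltt.
    by apply: eq_bigl => g; apply: eq_forallb => i.
  rewrite (bigID (fun g => nat_fun g t.+1 <= nat_fun g t)%N) /=.
  rewrite [X in _ + X](eq_bigl (fun g =>
    nonincr_upto t.+1 g && (nat_fun g t < nat_fun g t.+1)%N)); last first.
    by move=> g; rewrite ltnNge.
  rewrite ascent_cancel // addr0; apply: eq_bigl => g.
  have ltt' : (t < N)%N by lia.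
  apply/andP/forallP => [[/forallP hg hgt] i|hg].
    apply/implyP => lti; have [->//|nit] := eqVneq (i : nat) t.
    by have /implyP := hg i; apply; lia.
  split; last by have /implyP := hg (Ordinal ltt'); apply; rewrite /= ltnS.
  by apply/forallP => i; apply/implyP => lti; have /implyP := hg i; apply; lia.
suff H t : (t <= N)%N -> \sum_(g | nonincr_upto 0 g) term g =
  \sum_(g | nonincr_upto t g) term g by exact: H.
by elim: t => // t IH ltt; rewrite -step // IH // ltnW.
Qed.

End Wedge.

(** * Columns of power series and the Pieri rule *)

Section Sequences.
Context {R : comNzRingType}.
Implicit Types (u v : nat -> R) (p q x : R).

(** Sequences are power series in one variable y: [shift] multiplies by y, [geom p] divides by 1 - p
    y, and [linfac q] multiplies by 1 + q y. *)
Definition shift u : nat -> R := fun m => if m is k.+1 then u k else 0.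

Fixpoint geom p u (m : nat) : R :=
  if m is k.+1 then u k.+1 + p * geom p u k else u 0%N.

Definition linfac q u : nat -> R := fun m => u m + q * shift u m.

Lemma geomE p u m : geom p u m = u m + p * shift (geom p u) m.
Proof. by case: m => [|m] //=; rewrite mulr0 addr0. Qed.

(** Since v = u + p y v determines v, commuting [geom p] with another operator amounts to checking
    this equation. *)
Lemma geom_uniq p u v : (forall m, v m = u m + p * shift v m) -> v = geom p u.
Proof.
move=> h; apply/funext; elim=> [|m IH]; rewrite h /= ?mulr0 ?addr0 //.
by rewrite IH.
Qed.

Lemma geom_shift p u : geom p (shift u) = shift (geom p u).
Proof.
apply/esym/geom_uniq => -[|m] /=; first by rewrite mulr0 addr0.
by rewrite geomE.
Qed.

Lemma linfac_shift q u : linfac q (shift u) = shift (linfac q u).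
Proof. by apply/funext => -[|m]; rewrite /linfac //= mulr0 addr0. Qed.

Lemma linfac_geom p q u : linfac q (geom p u) = geom p (linfac q u).
Proof.
apply: geom_uniq => -[|m]; rewrite /linfac /= ?mulr0 ?addr0 //.
have := geomE p u m; move: (geom p u m) (shift _ m) => v w ->; ring.
Qed.

Definition vanish_below d u := forall m, (m < d)%N -> u m = 0.

Lemma vanish_shift d u : vanish_below d u -> vanish_below d.+1 (shift u).
Proof. by move=> h [|m] //= lt; apply: h. Qed.

Lemma vanish_geom d p u : vanish_below d u -> vanish_below d (geom p u).
Proof.
move=> h; elim=> [|m IH] lt /=; first by apply: h.
by rewrite h // IH ?mulr0 ?addr0 // ltnW.
Qed.

(* The coefficients of [y^(N-1-j) (1 + q y)^j (y / (1 - p y))^k]. *)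
Definition column p q (N j k : nat) : nat -> R :=
  iter (N - j.+1) shift
    (iter k (shift \o geom p) (iter j (linfac q) (fun m => (m == 0%N)%:R))).

Lemma iter_comm (T : Type) (f g : T -> T) n (t : T) :
  (forall s, f (g s) = g (f s)) -> f (iter n g t) = iter n g (f t).
Proof. by move=> c; elim: n => //= n <-; rewrite c. Qed.

Lemma columnS p q N j k : column p q N j k.+1 = shift (geom p (column p q N j k)).
Proof.
rewrite /column /=; set u := iter k _ _; rewrite (iter_comm _ _ (geom_shift p)).
by rewrite [RHS](iter_comm (f := shift)).
Qed.

Lemma column_vanish p q N j k : vanish_below (k + (N - j.+1)) (column p q N j k).
Proof.
rewrite addnC /column; elim: (N - j.+1)%N => [|n IH]; last exact: vanish_shift.
elim: k => [|k IH]; first by move=> m.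
exact/vanish_shift/vanish_geom.
Qed.

(** This is y z^k = z^(k+1) (1 - p y), for z = y / (1 - p y). *)
Lemma shift_column p q N j k m :
  shift (column p q N j k) m =
  column p q N j k.+1 m - p * shift (column p q N j k.+1) m.
Proof.
rewrite columnS; set u := column _ _ _ _ _; set w := shift (geom p u).
have -> : shift u = fun m => w m - p * shift w m.
  apply/funext => -[|n]; rewrite /w /= ?mulr0 ?subr0 //.
  by rewrite geomE; case: n => [|n] /=; ring.
by [].
Qed.

(** The quotient of the columns (j+1, k+1) and (j, k) is (1 + q y) z / y = (1 + q y) / (1 - p y) = 1
    + (p + q) z. *)
Lemma column_rel p q N j k m : (j.+1 < N)%N ->
  column p q N j.+1 k.+1 m = column p q N j k m + (p + q) * column p q N j k.+1 m.
Proof.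
move=> ltj.
have e : (N - j.+1 = (N - j.+2).+1)%N by lia.
rewrite /column e; set n := (N - j.+2)%N; set u := iter j _ _.
have -> : iter k.+1 (shift \o geom p) (iter j.+1 (linfac q) (fun m => (m == 0%N)%:R)) =
   linfac q (iter k.+1 (shift \o geom p) u).
  rewrite [RHS](iter_comm (f := linfac q)) // => v /=.
  by rewrite linfac_shift linfac_geom.
rewrite -[X in X m = _](iter_comm _ _ (linfac_shift q)).
rewrite /=; set w := iter k _ _; set v := iter n shift w.
have -> : iter n shift (shift (geom p w)) = shift (geom p v).
  by rewrite -[LHS](iter_comm (f := shift)) // -(iter_comm _ _ (geom_shift p)).
case: m => [|m]; rewrite /linfac /= ?mulr0 ?addr0 //.
by rewrite geomE; ring.
Qed.

End Sequences.

(** The coefficient of the monomial with exponents kap_i + N - i in the numerator of G_mu at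
    parameters (p, q) in [N] variables, hence the coefficient of s_kap in G_mu; see
    [groth_expansion]. *)
Definition transition {R : comNzRingType} (p q : R) (N : nat) (mu kap : nat -> nat) : R :=
  \det (\matrix_(j < N) \row_(i < N) column p q N j (mu j) (kap i + (N - i.+1))%N).

Section Pieri.
Context {R : comNzRingType} (a b x : R) (N M : nat).

Let col := column (- a) (- b) N.

Lemma col0 j k m : (m < k)%N -> col j k m = 0.
Proof. by move=> lt; apply: column_vanish; rewrite ltn_addr. Qed.

(** This is 1 / (1 - x y) = 1 + x z / (1 - (a + x) z) with z = y / (1 + a y). Columns [l >= M] have
    no coefficient below [M], so the sum may stop there. *)
Lemma geom_column j k m : (m < M)%N ->
  geom x (col j k) m =
  col j k m + x * \sum_(k.+1 <= l < M) (a + x) ^+ (l - k.+1) * col j l m.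
Proof.
pose W k m := \sum_(k <= l < M) (a + x) ^+ (l - k) * col j l m.
have WS k' m' : (m' < M)%N -> W k' m' = col j k' m' + (a + x) * W k'.+1 m'.
  move=> ltm; rewrite /W; have [leMk|ltkM] := leqP M k'.
    by rewrite !big_geq ?mulr0 ?addr0 ?col0 //; lia.
  rewrite big_ltn // subnn expr0 mul1r mulr_sumr; congr (_ + _).
  apply: eq_big_nat => l /andP[kl lM]; rewrite mulrA -exprS.
  by congr (_ ^+ _ * _); lia.
have Wsh k' m' : (m' < M)%N -> shift (W k') m' = W k'.+1 m' + a * shift (W k'.+1) m'.
  move=> ltm.
  transitivity (\sum_(k' <= l < M) (a + x) ^+ (l - k') * shift (col j l) m').
    by case: m' ltm => [|m'] ltm //=; rewrite big1 // => l _; rewrite mulr0.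
  transitivity (\sum_(k' <= l < M) (a + x) ^+ (l - k') *
      (col j l.+1 m' + a * shift (col j l.+1) m')).
    by apply: eq_bigr => l _; rewrite /col shift_column mulNr opprK.
  transitivity (\sum_(k'.+1 <= l < M.+1) (a + x) ^+ (l - k'.+1) *
      (col j l m' + a * shift (col j l) m')).
    by rewrite big_add1.
  have cM : col j M m' + a * shift (col j M) m' = 0.
    case: m' ltm => [|m'] ltm; rewrite /= ?mulr0 ?addr0 !col0 ?mulr0 ?addr0 //.
    exact: ltnW.
  have [leMk|ltkM] := leqP M k'.
    rewrite /W !big_geq //; case: m' ltm cM => [|m'] ltm cM /=.
    - by rewrite mulr0 addr0.
    - by rewrite big_geq ?mulr0 ?addr0 //; lia.
    - by lia.
    - by lia.
  rewrite big_nat_recr //= cM mulr0 addr0.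
  case: m' ltm cM => [|m'] ltm cM /=.
    rewrite !mulr0 addr0; apply: eq_bigr => l _; rewrite addr0 //.
  rewrite /W mulr_sumr -big_split /=; apply: eq_bigr => l _; ring.
(* [WS] peels off the first term of the geometric sum, and [Wsh] is y z^k = z^(k+1) (1 + a y).
   Eliminating [W k] between them gives the recurrence that defines [geom x]. *)
have key m' : (m' < M)%N -> col j k m' + x * W k.+1 m' = geom x (col j k) m'.
  elim: m' => [|m' IH] ltm.
    rewrite /W big_nat big1 ?mulr0 ?addr0 // => l /andP[kl _].
    by rewrite col0 ?mulr0 //; lia.
  have ltm' := ltnW ltm.
  rewrite geomE /= -IH //; congr (_ + x * _).
  have := Wsh k m'.+1 ltm; rewrite /= (WS k) // => e.
  by apply: (addIr (a * W k.+1 m')); rewrite -e; ring.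
by move=> ltm; rewrite -key.
Qed.

End Pieri.

(** * Horizontal strips and the two readings of the Pieri determinant *)

Section Interlacing.
Context {R : comNzRingType}.
Implicit Types (x : R) (kap nu : nat -> nat).

(** The skew Schur polynomial of kap / nu in one variable, restricted to the first [n] rows: nonzero
    only on horizontal strips. *)
Definition interlace_weight n x kap nu : R :=
  \prod_(i < n) (if (kap i.+1 <= nu i <= kap i)%N then x ^+ (kap i - nu i) else 0).

Lemma interlace_weight0 n x kap nu i : (i < n)%N ->
  ~~ (kap i.+1 <= nu i <= kap i)%N -> interlace_weight n x kap nu = 0.
Proof.
by move=> lti /negPf h; rewrite /interlace_weight (bigD1 (Ordinal lti)) //= h mul0r.
Qed.

Lemma det_interlace n M x kap (w : nat -> 'rV[R]_n) : (forall i, kap i < M)%N ->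
  \det (\matrix_(i < n)
     \sum_(kap i.+1 <= v < (kap i).+1) x ^+ (kap i - v) *: w (v + (n - i.+1))%N) =
  \sum_(g : {ffun 'I_n -> 'I_M}) interlace_weight n x kap (nat_fun g) *
     \det (\matrix_(i < n) w (g i + (n - i.+1))%N).
Proof.
move=> ltM.
pose c (i v : nat) : R := if (kap i.+1 <= v <= kap i)%N then x ^+ (kap i - v) else 0.
transitivity (\det (\matrix_(i < n) \sum_(v < M) c i v *: w (v + (n - i.+1))%N)).
  congr (\det _); apply/row_matrixP => i; rewrite !rowK.
  rewrite -(big_mkord predT (fun v => c i v *: w (v + (n - i.+1))%N)).
  rewrite [LHS](big_nat_widen _ _ M) ?ltM // (big_nat_widenl _ 0) // [LHS]big_mkcond /=.
  by apply: eq_bigr => v _; rewrite ltnS andbC /c; case: ifP; rewrite ?scale0r.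
rewrite (det_sum_rows (fun (i : 'I_n) (v : 'I_M) => c i v *: w (v + (n - i.+1))%N)).
apply: eq_bigr => g _; rewrite det_scale_rows; congr (_ * _).
by apply: eq_bigr => i _; rewrite nat_funE.
Qed.

(** At [a = b = 0] a box below another box of the strip has weight 0, so a nonempty row must end at
    the cutoff [u]. An empty row has weight 1 wherever it ends. *)
Lemma row_weight00 x u m l : (m <= l)%N ->
  row_weight 0 0 x u m l = if (l <= u)%N || (l == m) then x ^+ (l - m) else 0.
Proof.
move=> ml; have [->|nlm] := eqVneq l m; first by rewrite row_weight0 orbT subnn.
rewrite orbF; have -> : l = (m + (l - m.+1).+1)%N by lia.
set d := (l - _)%N; case: leqP => lu.
  rewrite row_weight_low; last by lia.
  by rewrite add0r -exprS; congr (_ ^+ _); lia.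
rewrite /row_weight addnS big_nat_recr ?leq_addr //= addr0.
by case: ltngtP => h; rewrite ?mulr0 //; lia.
Qed.

(** The cutoff of row i+1 is [nu i], which yields the interlacing condition [kap i.+1 <= nu i]; for
    the last row that condition comes from [kap N = 0]. *)
Lemma strip_weight00 N x kap nu : (forall j, nu j.+1 <= nu j)%N -> kap N = 0%N ->
  strip_weight N 0 0 x kap nu = interlace_weight N x kap nu.
Proof.
move=> nu_dec kapN.
have [/forallP h|/forallPn[i h]] :=
    boolP [forall i : 'I_N, (kap i.+1 <= nu i <= kap i)%N].
  apply: eq_bigr => i _; rewrite h; have /andP[_ ->] := h i.
  rewrite row_weight00 //; last by have /andP[_ ->] := h i.
  rewrite ifT //; case: i => -[|i] lti /=; first by rewrite leqnn.
  have ltiN : (i < N)%N by lia.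
  by have /= /andP[-> _] := h (Ordinal ltiN).
rewrite (interlace_weight0 _ (ltn_ord i) h) /strip_weight.
case/nandP: h => h; last by rewrite (bigD1 i) //= (negPf h) mul0r.
have [ltiN|geN] := ltnP i.+1 N; last first.
  by rewrite (_ : i.+1 = N) ?kapN // in h; have := ltn_ord i; lia.
rewrite (bigD1 (Ordinal ltiN)) //=; case: ifP => [le|]; last by rewrite mul0r.
rewrite row_weight00 // (negPf h) /= ifF ?mul0r //.
by apply/negP => /eqP e; move: h; rewrite e nu_dec.
Qed.

End Interlacing.

Section PieriRule.
Context {R : comNzRingType} (a b x : R) (N M : nat) (mu kap : nat -> nat).
Hypothesis mu_dec : forall j, (mu j.+1 <= mu j)%N.
Hypothesis mu_lt : (mu 0 < M)%N.
Hypothesis kap_dec : forall j, (kap j.+1 <= kap j)%N.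
Hypothesis kap_lt : (kap 0 + N <= M)%N.
Hypothesis kap_out : forall j, (N <= j)%N -> kap j = 0%N.

Let idx (kap : nat -> nat) i := (kap i + (N - i.+1))%N.

Lemma kap_le0 j : (kap j <= kap 0)%N.
Proof. by elim: j => // j; apply: leq_trans. Qed.

Lemma kap_ltM j : (kap j < M)%N.
Proof.
case: (posnP N) => [N0|N_gt0]; last by have := kap_le0 j; lia.
by rewrite kap_out; lia.
Qed.

Lemma idx_lt (i : 'I_N) : (idx kap i < M)%N.
Proof. by have := kap_le0 i; have := ltn_ord i; rewrite /idx; lia. Qed.

Lemma pieri_left :
  \det (\matrix_(j < N) \row_(i < N)
          geom x (column (- a) (- b) N j (mu j)) (idx kap i)) =
  \sum_(g : {ffun 'I_N -> 'I_M} | nonincr g)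
     strip_weight N a b x (nat_fun g) mu * transition (- a) (- b) N (nat_fun g) kap.
Proof.
pose f j k : 'rV[R]_N := \row_(i < N) column (- a) (- b) N j k (idx kap i).
have f_big j k : (M <= k)%N -> f j k = 0.
  by move=> leM; apply/rowP => i; rewrite !mxE col0 //; have := idx_lt i; lia.
have f_rel j k : (j.+1 < N)%N -> f j.+1 k.+1 = f j k - (a + b) *: f j k.+1.
  by move=> ltj; apply/rowP => i; rewrite !mxE column_rel // -opprD mulNr.
have := det_full_row x f_big f_rel mu_dec mu_lt.
rewrite (det_strip_row x f_big f_rel mu_dec mu_lt) => e.
transitivity (\det (\matrix_(j < N) full_row M a x f j (mu j))).
  congr (\det _); apply/matrixP => j i; rewrite !mxE (geom_column a b x N j (mu j) (idx_lt i)).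
  congr (_ + _ * _); rewrite /tail_sum summxE.
  by apply: eq_bigr => l _; rewrite !mxE.
rewrite e; apply: eq_bigr => g _; congr (_ * \det _).
by apply/matrixP => j i; rewrite !mxE nat_funE.
Qed.

(** Here 1 / (1 - x y_i) acts on the exponents: the coefficient at an exponent becomes a weighted
    sum over all smaller ones. Subtracting a multiple of the vector at the next exponent cuts this
    sum off just above that exponent, which leaves the horizontal strips. *)
Lemma pieri_right :
  \det (\matrix_(j < N) \row_(i < N)
          geom x (column (- a) (- b) N j (mu j)) (idx kap i)) =
  \sum_(g : {ffun 'I_N -> 'I_M} | nonincr g)
     strip_weight N 0 0 x kap (nat_fun g) * transition (- a) (- b) N mu (nat_fun g).
Proof.
pose w l : 'rV[R]_N := \row_(j < N) column (- a) (- b) N j (mu j) l.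
pose gw l : 'rV[R]_N := \row_(j < N) geom x (column (- a) (- b) N j (mu j)) l.
have gwS l d : gw (l + d)%N =
    \sum_(l.+1 <= m < (l + d).+1) x ^+ (l + d - m) *: w m + x ^+ d *: gw l.
  elim: d => [|d IH]; first by rewrite addn0 big_geq // expr0 scale1r add0r.
  rewrite addnS big_nat_recr /=; last by lia.
  rewrite subnn expr0 scale1r -addrA [w _ + _]addrC addrA.
  rewrite exprS -scalerA.
  have -> : \sum_(l.+1 <= m < (l + d).+1) x ^+ ((l + d).+1 - m) *: w m =
     x *: \sum_(l.+1 <= m < (l + d).+1) x ^+ (l + d - m) *: w m.
    rewrite scaler_sumr; apply: eq_big_nat => m /andP[_ lm].
    by rewrite scalerA -exprS subSn.
  rewrite -scalerDr -IH; apply/rowP => j; rewrite !mxE geomE /=; ring.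
pose s i := if (i < N)%N then gw (idx kap i) else 0.
pose r i := \sum_(kap i.+1 <= v < (kap i).+1) x ^+ (kap i - v) *: w (v + (N - i.+1))%N.
have sN : s N = 0 by rewrite /s ltnn.
have sr i : (i < N)%N -> s i = r i + x ^+ (kap i - kap i.+1).+1 *: s i.+1.
  move=> lti; rewrite /s lti /r.
  have := kap_dec i; have := kap_out (j := i.+1).
  rewrite /idx; set k := kap i; set k' := kap i.+1 => k'0 lek.
  have [ltiN|geN] := ltnP i.+1 N.
    have e : (k + (N - i.+1) = k' + (N - i.+2) + (k - k').+1)%N by lia.
    rewrite e gwS; congr (_ + _).
    have -> : (k' + (N - i.+2)).+1 = (k' + (N - i.+1))%N by lia.
    rewrite -e big_addn (_ : ((k + (N - i.+1)).+1 - (N - i.+1) = k.+1)%N); last by lia.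
    by apply: eq_bigr => v _; congr (_ ^+ _ *: _); lia.
  (* For the last exponent nothing is subtracted; the sum reaches down to [kap N = 0], and
     [gw 0 = w 0] supplies its lowest term. *)
  rewrite scaler0 addr0 (_ : N - i.+1 = 0)%N ?addn0; last by lia.
  rewrite k'0 // -[k in LHS]add0n gwS [RHS]big_ltn // add0n subn0 addrC addn0.
  have -> : gw 0%N = w 0%N by apply/rowP => j; rewrite !mxE.
  congr (_ + _).
  by apply: eq_bigr => v _; rewrite addn0.
rewrite -det_tr.
transitivity (\det (\matrix_(i < N) s i)).
  by congr (\det _); apply/matrixP => i j; rewrite !mxE /s ltn_ord mxE.
rewrite (det_add_next sN sr) (@det_interlace _ _ M) => [|i]; last first.
  exact: kap_ltM.
rewrite (bigID (@nonincr N M)) /= [X in _ + X]big1 ?addr0; last first.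
  move=> g /forallPn[i]; rewrite -ltnNge => lt.
  have ltiN : (i.+1 < N)%N.
    by rewrite ltnNge; apply: contraL lt => leN; rewrite (nat_fun_out g leN).
  have [h|h] := boolP (kap i.+1 <= nat_fun g i <= kap i)%N; last first.
    by rewrite (interlace_weight0 _ (ltn_ord i) h) mul0r.
  by rewrite (interlace_weight0 _ ltiN) ?mul0r //; lia.
apply: eq_bigr => g hg; rewrite -strip_weight00 ?kap_out //; last exact: nonincrP.
congr (_ * _); rewrite -det_tr; congr (\det _); apply/matrixP => j i.
by rewrite !mxE nat_funE.
Qed.

End PieriRule.

(** * Triangularity and stability of the transition coefficients *)

Section PermTools.

Lemma leq_sum_eq (I : finType) (F G : I -> nat) :
  (forall i, F i <= G i)%N -> (\sum_i G i <= \sum_i F i)%N -> F =1 G.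
Proof.
move=> le_FG le_sum.
have := leqif_sum (fun i (_ : true) => leqif_eq (le_FG i)).
case=> le1 e i; have : (\sum_i F i == \sum_i G i)%N by rewrite eqn_leq le1.
by rewrite e => /forallP/(_ i)/eqP.
Qed.

(** An increasing [s] satisfies i <= s i, and both sides have the same sum. *)
Lemma perm_increasing n (s : 'S_n) :
  (forall i j : 'I_n, (i < j)%N -> (s i < s j)%N) -> s = 1%g.
Proof.
move=> inc; have ge (i : 'I_n) : (i <= s i)%N.
  case: i => i; elim: i => //= i IH lti.
  have lti' : (i < n)%N by apply: ltnW.
  by apply: leq_ltn_trans (IH lti') _; apply: inc.
apply/permP => i; apply/val_inj; rewrite perm1 /=; apply/esym.
apply: (leq_sum_eq (F := fun i : 'I_n => i : nat) (G := fun i => s i : nat)) => //.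
by rewrite [X in (_ <= X)%N](reindex_inj (@perm_inj _ s)).
Qed.

Lemma perm_decreasing N (L K : nat -> nat) (s : 'S_N) :
  (forall i j, (i < j < N)%N -> (L j < L i)%N) ->
  (forall i j, (i < j < N)%N -> (K j < K i)%N) ->
  (forall i : 'I_N, L i = K (s i)) -> s = 1%g.
Proof.
move=> decL decK e; apply: perm_increasing => i j ltij.
rewrite ltnNge; apply/negP => le; have /= := decL i j; rewrite ltij ltn_ord /=.
move=> /(_ isT); rewrite !e ltnNge => /negP; apply.
move: le; rewrite leq_eqVlt => /orP[/eqP ->//|lt]; apply: ltnW.
by apply: decK; rewrite lt ltn_ord.
Qed.

Lemma staircase_lt N (k : nat -> nat) : (forall j, (k j.+1 <= k j)%N) ->
  forall i j, (i < j < N)%N -> (k j + (N - j.+1) < k i + (N - i.+1))%N.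
Proof.
move=> dec i j /andP[ij jN].
suff : (k j <= k i)%N by lia.
move: (ltnW ij); elim: j {ij jN} => [|j IH]; first by rewrite leqn0 => /eqP ->.
by rewrite leq_eqVlt => /orP[/eqP ->//|/IH]; apply: leq_trans.
Qed.

End PermTools.

Section Transition.
Context {R : comNzRingType} (p q : R).
Implicit Types (N : nat) (mu kap : nat -> nat).

Lemma column_lead N j k : column p q N j k (k + (N - j.+1))%N = 1.
Proof.
rewrite addnC /column; elim: (N - j.+1)%N => [|n IH]; last exact: IH.
rewrite add0n /=.
elim: k => [|k IH].
  by elim: j => [|j IH] //=; rewrite /linfac /= mulr0 addr0.
rewrite iterS /=; set u := iter k _ _ in IH *.
rewrite geomE IH; case: k @u IH => [|k] u IH /=; first by rewrite mulr0 addr0.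
have := @column_vanish R p q j.+1 j k.+1; rewrite /column subnn addn0 -/u => van.
by rewrite (vanish_geom _ van) ?mulr0 ?addr0.
Qed.

Lemma column0_big N j m : (j < N <= m)%N -> column p q N j 0 m = 0.
Proof.
move=> /andP[ltj leN]; rewrite /column /=.
have h : forall j m, (j < m)%N -> iter j (linfac q) (fun m => (m == 0%N)%:R) m = 0.
  elim=> [|j' IH] [|m'] //= lt; rewrite /linfac /= !IH ?mulr0 ?addr0 //.
  exact: ltnW.
have e : (m = N - j.+1 + (m - (N - j.+1)))%N by lia.
have : (j < m - (N - j.+1))%N by lia.
move: (m - _)%N e => m' -> /h <-.
by elim: (N - j.+1)%N => [|n IH] //=.
Qed.

(** By [column_vanish], a permutation [s] contributes to the Leibniz sum only if L_i <= K_(s i) for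
    all i. The comparison of sums turns these into equalities; both staircases decrease strictly, so
    [s] is the identity, and the leading coefficients are 1. *)
Lemma transition_triangular N mu kap :
  (forall j, mu j.+1 <= mu j)%N -> (forall j, kap j.+1 <= kap j)%N ->
  (\sum_(j < N) kap j <= \sum_(j < N) mu j)%N ->
  transition p q N mu kap = [forall j : 'I_N, mu j == kap j]%:R.
Proof.
move=> mu_dec kap_dec le_sum; rewrite /transition /determinant.
pose L j := (mu j + (N - j.+1))%N; pose K j := (kap j + (N - j.+1))%N.
have termE (s : 'S_N) : (exists j : 'I_N, L j != K (s j)) ->
   \prod_(i < N) (\matrix_(j < N) \row_(i < N)
     column p q N j (mu j) (kap i + (N - i.+1))%N) i (s i) = 0.
  move=> [j nj]; have [/forallP h|/forallPn[i]] := boolP [forall i : 'I_N, L i <= K (s i)]%N.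
    exfalso; move/eqP: nj; apply.
    apply: (leq_sum_eq (F := fun i : 'I_N => L i) (G := fun i => K (s i)) h).
    rewrite (_ : \sum_i K (s i) = \sum_(i < N) K i)%N; last first.
      by rewrite [RHS](reindex_inj (@perm_inj _ s)).
    by rewrite /L /K !big_split /= leq_add2r.
  rewrite -ltnNge => lt; rewrite (bigD1 i) //= !mxE.
  by rewrite (@column_vanish R p q N i (mu i) _ lt) mul0r.
have LK : (exists s : 'S_N, forall j : 'I_N, L j = K (s j)) -> forall j : 'I_N, mu j = kap j.
  move=> [s h] j; have := h j.
  rewrite (perm_decreasing (staircase_lt mu_dec) (staircase_lt kap_dec) h) perm1.
  by rewrite /L /K => /addIn.
have [/forallP h|/forallPn[j0 nj0]] := boolP [forall j : 'I_N, mu j == kap j].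
  rewrite (bigD1 1%g) //= odd_perm1 expr0 mul1r big1 => [|i _]; last first.
    by rewrite perm1 !mxE -(eqP (h i)) column_lead.
  rewrite big1 ?addr0 // => s /eqP ns; rewrite termE ?mulr0 //.
  apply: contrapT => /forallNP hs; apply: ns.
  apply: (perm_decreasing (staircase_lt mu_dec) (staircase_lt kap_dec)) => i.
  by have /negP := hs i; rewrite negbK => /eqP.
rewrite big1 // => s _; rewrite termE ?mulr0 //.
apply: contrapT => /forallNP hs; move/eqP: nj0; apply; apply: LK; exists s => i.
by have /negP := hs i; rewrite negbK => /eqP.
Qed.

(** The functions phi_(j,0) are polynomials of degree below [N], so the column at the exponent
    [kap 0 + (N - 1)] is zero as soon as [kap 0 > 0]. In other words, G of the empty partition is 1,
    in all degrees. *)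
Lemma transition0 N kap : (0 < N)%N -> (forall j, kap j.+1 <= kap j)%N ->
  transition p q N (fun=> 0%N) kap = (kap 0 == 0)%:R.
Proof.
move=> N_gt0 kap_dec; have [k0|k0] := posnP (kap 0%N).
  have kz j : kap j = 0%N by elim: j => // j IH; have := kap_dec j; lia.
  rewrite transition_triangular //; last by rewrite !big1 // => i _; rewrite kz.
  by case: forallP => // -[] i; rewrite kz.
rewrite /transition (expand_det_col _ (Ordinal N_gt0)) big1 // => j _.
by rewrite !mxE column0_big ?mul0r //= ltn_ord; lia.
Qed.

(** The last exponent is 0, and only the last row has a nonzero constant term there. In the
    remaining minor every row and every exponent is shifted by one. *)
Lemma transitionS N mu kap : mu N = 0%N -> kap N = 0%N ->
  transition p q N.+1 mu kap = transition p q N mu kap.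
Proof.
move=> mu0 kap0; rewrite /transition (expand_det_col _ ord_max).
rewrite (bigD1 ord_max) //= big1 ?addr0; last first.
  move=> j nj; rewrite !mxE column_vanish ?mul0r //= kap0 subnn.
  have : (j < N)%N by rewrite ltn_neqAle -ltnS ltn_ord andbT; exact: nj.
  lia.
rewrite !mxE /= kap0 mu0.
rewrite [X in X * _](column_lead N.+1 N 0); rewrite mul1r /cofactor /=.
rewrite addnn -signr_odd odd_double mul1r; congr (\det _).
apply/matrixP => j i; rewrite !mxE !lift_max.
rewrite /column (_ : N.+1 - j.+1 = (N - j.+1).+1)%N; last by have := ltn_ord j; lia.
rewrite (_ : N.+1 - i.+1 = (N - i.+1).+1)%N; last by have := ltn_ord i; lia.
by rewrite addnS.
Qed.

End Transition.

Section TransitionMorph.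
Context {R S : comNzRingType} (f : {rmorphism R -> S}).

Lemma rmorph_column p q N j k m :
  f (column p q N j k m) = column (f p) (f q) N j k m.
Proof.
pose F (u : nat -> R) : nat -> S := f \o u.
have iterF n G G' u : (forall v, F (G v) = G' (F v)) -> F (iter n G u) = iter n G' (F u).
  by move=> h; elim: n => //= n <-.
have Fs v : F (shift v) = shift (F v) by apply/funext => -[|n]; rewrite /F //= rmorph0.
have Fg v : F (geom p v) = geom (f p) (F v).
  by apply/funext; elim=> [|n IH] //=; rewrite /F /= rmorphD rmorphM -IH.
have Fl v : F (linfac q v) = linfac (f q) (F v).
  by apply/funext => n; rewrite /F /linfac /= rmorphD rmorphM -Fs.
rewrite -[LHS]/(F (column p q N j k) m) /column.
rewrite (iterF _ _ _ _ Fs) (iterF _ _ (shift \o geom (f p))) => [|v].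
  rewrite (iterF _ _ _ _ Fl); congr (iter _ _ (iter _ _ (iter _ _ _)) _).
  by apply/funext => n; rewrite /F /= rmorph_nat.
by rewrite /= Fs Fg.
Qed.

(** For passing from coefficients in [K] to constant polynomials over [K] in [cauchy_series]. *)
Lemma rmorph_transition p q N mu kap :
  f (transition p q N mu kap) = transition (f p) (f q) N mu kap.
Proof.
rewrite /transition -det_map_mx; congr (\det _).
by apply/matrixP => j i; rewrite !mxE rmorph_column.
Qed.
End TransitionMorph.

(** * Partitions of the borders into rim hooks *)

(** [A] is a transversal of the fibres of [f] on [B]; this is how the columns and rows of a rim hook
    are counted. *)
Lemma size_undup_image (I : finType) (J : eqType) (f : I -> J) (A B : {set I}) :
  A \subset B -> {in A &, injective f} ->
  (forall x, x \in B -> exists2 y, y \in A & f y = f x) ->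
  size (undup [seq f x | x in B]) = #|A|.
Proof.
move=> /subsetP AB inj_f surj_f.
rewrite cardE -(size_map f); apply/perm_size/uniq_perm; first exact: undup_uniq.
  rewrite map_inj_in_uniq ?enum_uniq // => x y; rewrite !mem_enum; exact: inj_f.
move=> z; rewrite mem_undup; apply/imageP/mapP => [[x xB ->]|[x]].
  by have [y yA <-] := surj_f x xB; exists y; rewrite ?mem_enum.
by rewrite mem_enum => /AB xB ->; exists x.
Qed.

Section Boxes.
Context {la : seq nat}.
Implicit Types b c d : box la.

Lemma box_inj b c : box_row b = box_row c -> box_col b = box_col c -> b = c.
Proof.
case: b c => [i k] [j l]; rewrite /box_row /box_col /= => /val_inj e.
by case: j / e l => l /val_inj ->.
Qed.

Lemma box_row_lt b : (box_row b < size la)%N.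
Proof. exact: ltn_ord. Qed.

Lemma box_col_lt b : (box_col b < nth 0%N la (box_row b))%N.
Proof. exact: ltn_ord. Qed.

Lemma box_at i j : (j < nth 0%N la i)%N -> exists b, box_row b = i /\ box_col b = j.
Proof.
move=> ltj; have lti : (i < size la)%N.
  by rewrite ltnNge; apply: contraL ltj => /(nth_default 0%N) ->.
by exists (Tagged (fun k : 'I_(size la) => 'I_(nth 0%N la k))
             (Ordinal ltj : 'I_(nth 0%N la (Ordinal lti)))).
Qed.

Hypothesis la_sorted : sorted geq la.

Lemma nth_part_le i j : (i <= j)%N -> (nth 0%N la j <= nth 0%N la i)%N.
Proof.
move=> ij; have [ltj|gej] := ltnP j (size la); last by rewrite nth_default.
have tr : transitive geq by move=> x y z /= xy zx; apply: leq_trans xy.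
have rf : reflexive geq by move=> x; apply: leqnn.
by apply: (sorted_leq_nth tr rf 0%N la_sorted) => //=; apply: leq_ltn_trans ltj.
Qed.

Lemma box_at_nw b i j : (i <= box_row b)%N -> (j <= box_col b)%N ->
  exists d, box_row d = i /\ box_col d = j.
Proof.
move=> lei lej; apply: box_at; apply: leq_ltn_trans lej _.
exact: leq_trans (box_col_lt b) (nth_part_le lei).
Qed.

Context (T : {ffun box la -> nat}).
Hypothesis T_rpp : is_rpp T.

Lemma rpp_le b c : (box_row b <= box_row c)%N -> (box_col b <= box_col c)%N ->
  (T b <= T c)%N.
Proof.
move=> ler lec; have [d [rd cd]] := box_at_nw ler (leqnn (box_col c)).
have [rows cols] := T_rpp; apply: (@leq_trans (T d)).
  by apply: rows; rewrite ?rd ?cd.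
by apply: cols; rewrite ?rd ?cd.
Qed.

Lemma rpp_between b c d : T b = T d ->
  (box_row b <= box_row c <= box_row d)%N ->
  (box_col b <= box_col c <= box_col d)%N -> T c = T b.
Proof.
move=> e /andP[r1 r2] /andP[c1 c2]; apply/eqP; rewrite eqn_leq {1}e.
by rewrite !rpp_le.
Qed.

End Boxes.

Definition north_same {la} (T : {ffun box la -> nat}) (b : box la) : bool :=
  [exists c, (T c == T b) && below c b].

Definition east_same {la} (T : {ffun box la -> nat}) (b : box la) : bool :=
  [exists c, (T c == T b) && right_of b c].

Definition nw_same {la} (T : {ffun box la -> nat}) (b : box la) : bool :=
  [exists c, [&& T c == T b, (box_row c).+1 == box_row b
               & (box_col c).+1 == box_col b]].

Definition box_weight {la} {R : comNzRingType} (a b : R) (x : nat -> R)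
    (T : {ffun box la -> nat}) (c : box la) : R :=
  if nw_same T c then a + b else if north_same T c then b
  else if east_same T c then a + x (T c) else x (T c).

Section Hooks.
Context {la : seq nat} (la_sorted : sorted geq la).
Context (T : {ffun box la -> nat}) (T_rpp : is_rpp T).
Implicit Types (b c d : box la) (X B : {set box la}).

Let between := rpp_between la_sorted T_rpp.

(** A box of the level farther up the diagonal forces the adjacent diagonal box, which lies between
    two equal entries, into the level. *)
Lemma mem_border b i : (b \in border T i) = (T b == i) && ~~ nw_same T b.
Proof.
rewrite !inE; case: eqP => //= Tb; congr (~~ _); apply/existsP/existsP.
  move=> [c]; rewrite !inE => /and4P[/eqP Tc dg rlt clt]; rewrite /same_diagonal in dg.
  have [d [rd cd]] := box_at_nw la_sorted (leq_pred (box_row b)) (leq_pred (box_col b)).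
  exists d; rewrite rd cd !prednK ?eqxx ?andbT; [|lia|lia].
  by rewrite (@between c d b) ?rd ?cd ?Tc ?Tb //; lia.
move=> [c /and3P[/eqP Tc /eqP rc /eqP cc]]; exists c; rewrite !inE Tc Tb eqxx.
by rewrite -rc -cc !ltnSn /same_diagonal -rc -cc addnS addSn eqxx.
Qed.

Definition borders : {set box la} := [set b | ~~ nw_same T b].
Definition north_set : {set box la} := [set b in borders | north_same T b].
(** The places where a cut is possible. A box with an equal north neighbour is excluded: an equal
    east neighbour would then be in the inner part. *)
Definition east_set : {set box la} :=
  [set b in borders | ~~ north_same T b & east_same T b].

(* The hook_next box of the hook of [b], in the direction from south-west to
   north-east; [X] is the set of boxes with a cut on their right. *)
Definition hook_next X b : box la :=
  odflt b [pick c | (T c == T b) &&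
    (below c b || [&& ~~ north_same T b, b \notin X & right_of b c])].

Variant hook_next_spec X b : box la -> Prop :=
  | NextNorth c of b \in north_set & T c = T b & below c b : hook_next_spec X b c
  | NextEast c of b \in east_set & b \notin X & T c = T b & right_of b c :
      hook_next_spec X b c
  | NextRoot of b \notin north_set & b \notin east_set :\: X : hook_next_spec X b b.

Lemma hook_nextP X b : b \in borders -> hook_next_spec X b (hook_next X b).
Proof.
move=> bR; rewrite /hook_next; case: pickP => [c /= /andP[/eqP Tc]|h] /=.
  case/orP=> [bc|/and3P[nN nX rc]].
    apply: NextNorth => //; rewrite inE bR.
    by apply/existsP; exists c; rewrite Tc eqxx.
  apply: NextEast => //; rewrite inE bR nN /=.
  by apply/existsP; exists c; rewrite Tc eqxx.
have nN : ~~ north_same T b.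
  by apply/existsPn => c; have := h c; rewrite /=; case: eqP => //= _ /norP[/negPf ->].
apply: NextRoot; rewrite !inE ?(negPf nN) ?andbF //=.
apply/negP => /and3P[nX _ /existsP[c /andP[Tc rc]]].
by have := h c; rewrite Tc nN nX rc /= orbT.
Qed.

(** Column minus row, shifted by [size la] to stay in [nat]; it rises by one with each proper step
    along a hook. *)
Definition content b : nat := (box_col b + (size la - box_row b))%N.

Lemma content_diag b c : (content b == content c) = same_diagonal b c.
Proof.
rewrite /content /same_diagonal; have := box_row_lt b; have := box_row_lt c.
by move=> *; apply/eqP/eqP; lia.
Qed.

Lemma border_diag_inj b c : b \in borders -> c \in borders -> T b = T c ->
  content b = content c -> b = c.
Proof.
wlog: b c / (box_row b <= box_row c)%N => [hw|].
  case: (leqP (box_row b) (box_row c)) => [|/ltnW] le bR cR e ct; first exact: hw.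
  by apply/esym/hw.
rewrite !inE => le bR cR Tbc /eqP; rewrite content_diag /same_diagonal => /eqP dg.
move: le; rewrite leq_eqVlt => /orP[/eqP e|lt].
  by apply: box_inj => //; lia.
case/negP: cR.
have [d [rd cd]] := box_at_nw la_sorted (leq_pred (box_row c)) (leq_pred (box_col c)).
apply/existsP; exists d; rewrite rd cd !prednK ?eqxx ?andbT; [|lia|lia].
by rewrite (@between b d c) ?rd ?cd ?Tbc //; lia.
Qed.

(** After a step north, an equal north-west neighbour of the new box would make that of [b] equal
    too; after a step east, it would be an equal north neighbour of [b]. *)
Lemma hook_next_border X b : b \in borders -> hook_next X b \in borders.
Proof.
move=> bR; case: (hook_nextP X bR) => // c.
  rewrite !inE => /andP[/negP nb _] Tc /andP[/eqP cc /eqP rc].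
  apply/negP => /existsP[d /and3P[/eqP Td /eqP rd /eqP cd]]; apply: nb.
  have [e [re ce]] := box_at_nw la_sorted (leq_pred (box_row b)) (leq_pred (box_col b)).
  apply/existsP; exists e; rewrite re ce !prednK ?eqxx ?andbT; [|lia|lia].
  by rewrite (@between d e b) ?re ?ce ?Td ?Tc //; lia.
rewrite !inE => /and3P[_ /negP nN _] _ Tc /andP[/eqP rc /eqP cc].
apply/negP => /existsP[d /and3P[/eqP Td /eqP rd /eqP cd]]; apply: nN.
apply/existsP; exists d; rewrite Td Tc eqxx /below; lia.
Qed.

Lemma hook_next_above X b c : c \in borders -> T b = T c -> below b c -> hook_next X c = b.
Proof.
move=> cR Tbc bc; have cN : north_same T c by apply/existsP; exists b; rewrite Tbc eqxx.
case: (hook_nextP X cR) => [d _ _|d|].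
- move: bc => /andP[/eqP e1 /eqP e2] /andP[/eqP e3 /eqP e4]; apply: box_inj; lia.
- by rewrite !inE cN andbF.
by rewrite inE cR cN.
Qed.

Lemma hook_next_level X b : b \in borders -> T (hook_next X b) = T b.
Proof. by move=> bR; case: (hook_nextP X bR). Qed.

Lemma hook_next_content X b : b \in borders ->
  hook_next X b = b \/ content (hook_next X b) = (content b).+1.
Proof.
move=> bR; case: (hook_nextP X bR) => [c _ _|c _ _ _|]; last by left.
  move=> /andP[/eqP cc /eqP rc]; right; rewrite /content cc rc.
  by have := box_row_lt b; lia.
by move=> /andP[/eqP rc /eqP cc]; right; rewrite /content cc rc.
Qed.

(** More steps than the contents allow, so that iterating [bound] times surely ends at the
    north-east end of the hook. *)
Let bound := (\max_b content b).+1.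

Definition hook_root X b := iter bound (hook_next X) b.

Lemma iter_border X k b : b \in borders -> iter k (hook_next X) b \in borders.
Proof. by move=> bR; elim: k => //= k; apply: hook_next_border. Qed.

Lemma iter_level X k b : b \in borders -> T (iter k (hook_next X) b) = T b.
Proof. by move=> bR; elim: k => //= k <-; rewrite hook_next_level ?iter_border. Qed.

Lemma iter_content X k b : b \in borders ->
  (hook_next X (iter k (hook_next X) b) = iter k (hook_next X) b /\
   (content (iter k (hook_next X) b) <= content b + k)%N)
  \/ content (iter k (hook_next X) b) = (content b + k)%N.
Proof.
move=> bR; elim: k => [|k [[IH1 IH2]|IH]] /=; first by right; rewrite addn0.
  by left; rewrite !IH1; split => //; rewrite addnS ltnW.
have [e|e] := hook_next_content X (iter_border X k bR).
  by left; rewrite !e; split => //; rewrite IH addnS.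
by right; rewrite e IH addnS.
Qed.

Lemma hook_next_root X b : b \in borders -> hook_next X (hook_root X b) = hook_root X b.
Proof.
move=> bR; case: (iter_content X bound bR) => [[//]|e].
have : (content (hook_root X b) <= \max_b content b)%N by exact: leq_bigmax.
by rewrite /hook_root e /bound; lia.
Qed.

Lemma hook_root_next X b : b \in borders -> hook_root X (hook_next X b) = hook_root X b.
Proof. by move=> bR; rewrite -[RHS]hook_next_root // /hook_root -iterSr. Qed.

Lemma hook_root_iter X k b : b \in borders -> hook_root X (iter k (hook_next X) b) = hook_root X b.
Proof. by move=> bR; elim: k => //= k IH; rewrite hook_root_next ?iter_border. Qed.

Lemma hook_root_fix X b : hook_next X b = b -> hook_root X b = b.
Proof. by move=> e; rewrite /hook_root; elim: bound => //= k ->. Qed.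

Lemma hook_root_border X b : b \in borders -> hook_root X b \in borders.
Proof. exact: iter_border. Qed.

Lemma hook_root_level X b : b \in borders -> T (hook_root X b) = T b.
Proof. exact: iter_level. Qed.

Lemma iter_root X k b : b \in borders ->
  content (iter k (hook_next X) b) = (content b + k)%N \/
  (iter k (hook_next X) b = hook_root X b /\ (content (hook_root X b) <= content b + k)%N).
Proof.
move=> bR; case: (iter_content X k bR) => [[e le]|]; last by left.
by right; rewrite -(hook_root_iter X k bR) hook_root_fix.
Qed.

Lemma content_root X b : b \in borders -> (content b <= content (hook_root X b))%N.
Proof.
move=> bR; rewrite /hook_root; elim: bound => //= k IH; apply: leq_trans IH _.
by have [->//|->] := hook_next_content X (iter_border X k bR).
Qed.

(* A hook is an interval of contents: it meets every diagonal between two of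
   its boxes, and a border meets a diagonal in at most one box. *)
Lemma hook_root_between X b c d :
  b \in borders -> c \in borders -> d \in borders ->
  hook_root X b = hook_root X d -> T c = T b -> (content b <= content c <= content d)%N ->
  hook_root X c = hook_root X b.
Proof.
move=> bR cR dR bd Tc /andP[bc cd].
pose k := (content c - content b)%N.
suff <- : iter k (hook_next X) b = c by rewrite hook_root_iter.
apply: border_diag_inj => //; rewrite ?iter_border ?iter_level //.
have [->|[->]] := iter_root X k bR; first by rewrite /k; lia.
by have := content_root X dR; rewrite -bd /k; lia.
Qed.

Definition hooks X : {set {set box la}} := preim_partition (hook_root X) borders.

Definition fiber X b : {set box la} := [set c in borders | hook_root X b == hook_root X c].

Lemma hooksP X B :
  reflect (exists2 b, b \in borders & B = fiber X b) (B \in hooks X).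
Proof. by apply: (iffP imsetP) => -[b bR ->]; exists b. Qed.

Lemma mem_fiber X b c :
  (c \in fiber X b) = (c \in borders) && (hook_root X b == hook_root X c).
Proof. by rewrite inE. Qed.

Lemma fiber_id X b : b \in borders -> b \in fiber X b.
Proof. by move=> bR; rewrite mem_fiber bR /=. Qed.

Lemma fiber_eq X b c : c \in fiber X b -> fiber X c = fiber X b.
Proof.
by rewrite mem_fiber => /andP[_ /eqP e]; apply/setP => d; rewrite !mem_fiber e.
Qed.

Lemma fiber_border X b : b \in borders -> fiber X b \subset border T (T b).
Proof.
move=> bR; apply/subsetP => c; rewrite mem_fiber mem_border => /andP[cR /eqP e].
rewrite -(hook_root_level X bR) e hook_root_level // eqxx /=; by rewrite inE in cR.
Qed.

Lemma sub_border_fiber X b i : b \in borders ->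
  (fiber X b \subset border T i) = (T b == i).
Proof.
move=> bR; apply/idP/eqP => [/subsetP/(_ _ (fiber_id X bR))|<-]; last exact: fiber_border.
by rewrite mem_border => /andP[/eqP].
Qed.

Lemma border_borders i b : b \in border T i -> b \in borders /\ T b = i.
Proof. by rewrite mem_border inE => /andP[/eqP -> ->]. Qed.

Lemma mem_hooks_at X B i :
  reflect (exists2 b, b \in border T i & B = fiber X b) (B \in hooks_at (T, hooks X) i).
Proof.
apply: (iffP idP).
  rewrite inE /= => /andP[/hooksP[b bR ->]]; rewrite sub_border_fiber // => /eqP <-.
  by exists b => //; rewrite mem_border eqxx; rewrite inE in bR.
move=> [b /border_borders[bR Tb] ->]; rewrite inE /= sub_border_fiber // Tb eqxx andbT.
by apply/hooksP; exists b.
Qed.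

Lemma hooks_partition X i : finset.partition (hooks_at (T, hooks X) i) (border T i).
Proof.
apply/and3P; split.
- apply/eqP/setP => b; apply/bigcupP/idP => [[B /mem_hooks_at[c cb ->]]|bb].
    have [cR <-] := border_borders cb.
    exact/subsetP/fiber_border.
  by exists (fiber X b); [apply/mem_hooks_at; exists b|
     have [bR _] := border_borders bb; rewrite fiber_id].
- apply/trivIsetP => _ _ /mem_hooks_at[b _ ->] /mem_hooks_at[c _ ->].
  apply: contraR; rewrite -setI_eq0 => /set0Pn[d /setIP[db dc]].
  by rewrite -(fiber_eq db) -(fiber_eq dc).
- apply/negP => /mem_hooks_at[b /border_borders[bR _]] /setP/(_ b).
  by rewrite fiber_id // inE.
Qed.

Lemma step_adjacent X b : b \in borders -> hook_next X b != b -> adjacent b (hook_next X b).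
Proof.
move=> bR; case: (hook_nextP X bR) => [c _ _ bc _|c _ _ _ bc _|_ _]; last by rewrite eqxx.
  by rewrite /adjacent bc orbT.
by rewrite /adjacent bc !orbT.
Qed.

Lemma adjacent_sym b c : adjacent b c = adjacent c b.
Proof.
rewrite /adjacent.
by case: (below b c) (below c b) (right_of b c) (right_of c b) => [] [] [] [].
Qed.

Lemma fiber_connected X b : b \in borders -> is_connected (fiber X b).
Proof.
move=> bR c d cB dB; set e := [rel x y | _].
have e_sym : connect_sym e.
  by apply: sym_connect_sym => x y /=; rewrite andbCA adjacent_sym.
have to_root x : x \in fiber X b -> connect e x (hook_root X x).
  move=> xB; have xR : x \in borders by move: xB; rewrite mem_fiber => /andP[].
  rewrite /hook_root; elim: bound => [|k IH]; first exact: connect0.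
  apply: connect_trans IH _ => /=.
  have [->|ne] := eqVneq (hook_next X (iter k (hook_next X) x)) (iter k (hook_next X) x).
    exact: connect0.
  apply: connect1; rewrite /= step_adjacent ?iter_border // andbT.
  rewrite -(fiber_eq xB) !mem_fiber -[hook_next X (iter _ _ _)]/(iter k.+1 (hook_next X) x).
  by rewrite !hook_root_iter // !iter_border // eqxx.
apply: connect_trans (to_root c cB) _; rewrite e_sym.
move: (cB) (dB) (to_root d dB); rewrite !mem_fiber.
by move=> /andP[_ /eqP <-] /andP[_ /eqP <-].
Qed.

Lemma fiber_no_square X b : b \in borders -> no_square (fiber X b).
Proof.
move=> bR r s; apply/negP => /and4P[/existsP[c /and3P[cB /eqP rc /eqP cc]] _ _].
move=> /existsP[d /and3P[dB /eqP rd /eqP cd]].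
have /subsetP sub := fiber_border X bR.
move: (sub _ cB) (sub _ dB); rewrite !mem_border => /andP[/eqP Tc _] /andP[/eqP Td].
by move/negP; apply; apply/existsP; exists c; rewrite Tc Td rc cc rd cd !eqxx.
Qed.

(** [nu] is the north-west closure of the hook. Removing the hook leaves a diagram: if [c] and [e]
    are in the hook with [c] weakly north-west of [e], they share a row or a column, and every box
    between them belongs to the hook by [hook_root_between]. *)
Lemma fiber_skew X b : b \in borders -> is_skew_shape (fiber X b).
Proof.
move=> bR; set B := fiber X b.
pose nu := [set c : box la | [exists d in B,
  (box_row c <= box_row d)%N && (box_col c <= box_col d)%N]].
have nu_nw c d : d \in nu -> (box_row c <= box_row d)%N -> (box_col c <= box_col d)%N ->
    c \in nu.
  rewrite !inE => /existsP[e /and3P[eB re ce]] rc cc; apply/existsP; exists e.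
  by rewrite eB (leq_trans rc re) (leq_trans cc ce).
exists (nu :\: B), nu; split; last 1 first.
- apply/setP => c; rewrite !in_setD; case: (boolP (c \in B)) => cB /=.
    by symmetry; rewrite inE; apply/existsP; exists c; rewrite cB !leqnn.
  by rewrite andNb.
- move=> c d /setDP[dnu dB] rc cc; rewrite inE (nu_nw c d) // andbT.
apply/negP => cB; move: dnu; rewrite inE => /existsP[e /and3P[eB re ce]].
have [cR /eqP bc] : c \in borders /\ hook_root X b == hook_root X c.
  by apply/andP; rewrite -mem_fiber.
have [eR /eqP be] : e \in borders /\ hook_root X b == hook_root X e.
  by apply/andP; rewrite -mem_fiber.
have Tce : T c = T e by rewrite -(hook_root_level X cR) -(hook_root_level X eR) -bc be.
have Td : T d = T c by apply: (@between c d e) => //; lia.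
(* Otherwise the north-west neighbour of [e] lies between [c] and [e], and [e] is not in a
   border. *)
have ninw : (box_row c == box_row e) || (box_col c == box_col e).
  apply: contraT; rewrite negb_or => /andP[nr nc].
  rewrite inE in eR; case/negP: eR.
  have [f [rf cf]] := box_at_nw la_sorted (leq_pred (box_row e)) (leq_pred (box_col e)).
  apply/existsP; exists f; rewrite rf cf !prednK ?eqxx ?andbT; [|lia|lia].
  by rewrite (@between c f e) ?rf ?cf ?Tce //; lia.
have dR : d \in borders.
  rewrite inE; apply/negP => /existsP[f /and3P[/eqP Tf /eqP rf /eqP cf]].
  case/orP: ninw => /eqP ece.
    rewrite inE in eR; case/negP: eR.
    have [g [rg cg]] := box_at_nw la_sorted (leq_pred (box_row e)) (leq_pred (box_col e)).
    apply/existsP; exists g; rewrite rg cg !prednK ?eqxx ?andbT; [|lia|lia].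
    by rewrite (@between f g e) ?rg ?cg ?Tf ?Td ?Tce //; lia.
  rewrite inE in eR; case/negP: eR.
  have [g [rg cg]] := box_at_nw la_sorted (leq_pred (box_row e)) (leq_pred (box_col e)).
  apply/existsP; exists g; rewrite rg cg !prednK ?eqxx ?andbT; [|lia|lia].
  by rewrite (@between f g e) ?rg ?cg ?Tf ?Td ?Tce //; lia.
case/negP: dB; rewrite mem_fiber dR /= bc; apply/eqP/esym.
have rlt := box_row_lt e; have rlt2 := box_row_lt d.
case/orP: ninw => /eqP ece.
  apply: (@hook_root_between X c d e) => //; first by rewrite -bc.
  by rewrite /content; lia.
rewrite -bc be; apply: (@hook_root_between X e d c) => //; first by rewrite -be.
  by rewrite Td.
by rewrite /content; lia.
- by move=> c d dnu rc cc; apply: nu_nw dnu rc cc.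
- exact: subsetDl.
Qed.

Lemma hooks_rbt X : is_rbt (T, hooks X).
Proof.
split => //=.
- by move=> B /hooksP[b bR ->]; exists (T b); apply: fiber_border.
- exact: hooks_partition.
- move=> B /hooksP[b bR ->]; split.
  + by apply/set0Pn; exists b; apply: fiber_id.
  + exact: fiber_skew.
  + exact: fiber_connected.
  + exact: fiber_no_square.
move=> i b c bb cb bc; exists (fiber X b).
have [bR Tb] := border_borders bb; have [cR Tc] := border_borders cb.
split; [by apply/mem_hooks_at; exists b | exact: fiber_id|].
rewrite mem_fiber cR /=.
by rewrite -(hook_root_next X cR) (@hook_next_above X b c) ?Tb ?Tc.
Qed.

Lemma right_east X b c : b \in borders -> c \in borders -> T b = T c ->
  right_of b c -> b \in east_set /\ (b \notin X -> hook_next X b = c).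
Proof.
move=> bR cR Tbc bc; have /andP[/eqP rc /eqP cc] := bc.
have nN : ~~ north_same T b.
  rewrite inE in cR; apply: contra cR => /existsP[d /and3P[/eqP Td /eqP cd /eqP rd]].
  by apply/existsP; exists d; rewrite Td Tbc eqxx rc rd cc cd !eqxx.
have bE : east_same T b by apply/existsP; exists c; rewrite Tbc eqxx.
split=> [|nX]; first by rewrite inE bR nN.
case: (hook_nextP X bR) => [d|d _ _ _|].
- by rewrite inE (negPf nN) andbF.
- by move=> /andP[/eqP rd /eqP cd]; apply: box_inj; lia.
by rewrite !inE nX bE nN; move: bR; rewrite inE => ->.
Qed.

Definition cut (Q : {set {set box la}}) : {set box la} :=
  [set b in east_set | ~~ [exists B in Q, (b \in B) && [exists c in B, right_of b c]]].

(** A block is closed under [hook_next], because vertical neighbours stay together and uncut east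
    neighbours lie in a common block; so it contains the roots of its boxes. Conversely the root is
    constant along adjacencies inside a block, hence on the block, as blocks are connected. *)
Lemma rbt_hooks Q : is_rbt (T, Q) -> Q = hooks (cut Q).
Proof.
move=> [_ /= Qsub Qpart Qrim Qvert]; set X := cut Q.
have level_of B b : B \in Q -> b \in B -> B \in hooks_at (T, Q) (T b) /\ b \in borders.
  move=> BQ bB; have [i Bi] := Qsub B BQ.
  have [bR Tb] := border_borders (subsetP Bi b bB).
  by split => //; rewrite inE /= BQ Tb.
have block b : b \in borders -> exists2 B, B \in Q & b \in B.
  move=> bR; have bb : b \in border T (T b).
    by rewrite mem_border eqxx; rewrite inE in bR.
  have /and3P[/eqP cov _ _] := Qpart (T b); move: bb; rewrite -cov.
  by case/bigcupP => B; rewrite inE => /andP[BQ _] bB; exists B.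
have block_uniq B B' b : B \in Q -> B' \in Q -> b \in B -> b \in B' -> B = B'.
  move=> BQ B'Q bB bB'; have /and3P[_ /trivIsetP triv _] := Qpart (T b).
  apply/eqP; apply: contraT => /(triv _ _ (level_of B b BQ bB).1 (level_of B' b B'Q bB').1).
  by rewrite -setI_eq0 => /eqP/setP/(_ b); rewrite !inE bB bB'.
have cutP B b c : B \in Q -> b \in B -> c \in B -> right_of b c -> b \notin X.
  move=> BQ bB cB bc; rewrite inE negb_and negbK orbC.
  apply/orP; left; apply/existsP; exists B; rewrite BQ bB /=.
  by apply/existsP; exists c; rewrite cB.
have hook_next_in B b : B \in Q -> b \in B -> hook_next X b \in B.
  move=> BQ bB; have [_ bR] := level_of B b BQ bB.
  have := hook_next_border X bR; case: (hook_nextP X bR) => // c.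
    move=> _ Tc bc cR.
    have [||B' [B'Q cB' bB']] := Qvert (T b) c b _ _ bc.
    - by rewrite mem_border Tc eqxx; rewrite inE in cR.
    - by rewrite mem_border eqxx; rewrite inE in bR.
    by move: B'Q; rewrite inE => /andP[B'Q _]; rewrite (block_uniq B B' b).
  move=> bE bX Tc bc cR; move: bX; rewrite inE bE /= negbK.
  case/existsP => B' /and3P[B'Q bB' /existsP[d /andP[dB' /andP[/eqP rd /eqP cd]]]].
  rewrite (block_uniq B B' b) //; suff -> : c = d by [].
  by move: bc => /andP[/eqP rc /eqP cc]; apply: box_inj; lia.
have hook_root_in B b : B \in Q -> b \in B -> hook_root X b \in B.
  by move=> BQ bB; rewrite /hook_root; elim: bound => //= k IH; apply: hook_next_in.
have same_root B b c : B \in Q -> b \in B -> c \in B -> hook_root X b = hook_root X c.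
  move=> BQ bB cB; have [_ _ conn _] := Qrim B BQ.
  have := conn b c bB cB.
  have clo : closed [rel x y | [&& x \in B, y \in B & adjacent x y]]
                    [pred x | hook_root X x == hook_root X b].
    move=> x y /= /and3P[xB yB adj]; rewrite !inE; congr (_ == _).
    have [+ xR] := level_of B x BQ xB; have [+ yR] := level_of B y BQ yB.
    rewrite !inE => /andP[_ sy] /andP[_ sx].
    have Txy : T x = T y by have [_] := border_borders (subsetP sy x xB).
    case/or4P: adj => adj.
    + by rewrite -(hook_root_next X yR) (@hook_next_above X x y).
    + by rewrite -(hook_root_next X xR) (@hook_next_above X y x).
    + have [_ /(_ (cutP B x y BQ xB yB adj)) e] := right_east X xR yR Txy adj.
      by rewrite -(hook_root_next X xR) e.
    + have [_ /(_ (cutP B y x BQ yB xB adj)) e] := right_east X yR xR (esym Txy) adj.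
      by rewrite -(hook_root_next X yR) e.
  by move=> /(closed_connect clo); rewrite !inE eqxx => /esym/eqP.
have fiberE B b : B \in Q -> b \in B -> B = fiber X b.
  move=> BQ bB; apply/setP => c; rewrite mem_fiber; apply/idP/andP => [cB|[cR /eqP e]].
    by rewrite (same_root B b c) // eqxx; have [_ ->] := level_of B c BQ cB.
  have [B' B'Q cB'] := block c cR.
  rewrite (block_uniq B B' (hook_root X b)) //; first exact: hook_root_in.
  by rewrite e; apply: hook_root_in.
apply/setP => B; apply/idP/hooksP => [BQ|[b bR ->]].
  have [/set0Pn[b bB] _ _ _] := Qrim B BQ.
  by exists b; [have [_] := level_of B b BQ bB|exact: fiberE].
by have [B' B'Q bB'] := block b bR; rewrite -(fiberE B' b).
Qed.

Lemma hook_root_id X b : b \in borders ->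
  (hook_root X b == b) = (b \notin north_set) && (b \notin east_set :\: X).
Proof.
move=> bR; have ne c : content c = (content b).+1 -> hook_next X b = c ->
    (hook_root X b == b) = false.
  move=> e ec; apply/negP => /eqP rb; have := content_root X (hook_next_border X bR).
  by rewrite hook_root_next // rb ec e ltnn.
case: (hook_nextP X bR) (hook_next_content X bR) (ne (hook_next X b)) => [c|c|].
- move=> -> Tc /andP[/eqP e1 /eqP e2] [e|e ->] //.
  by move: e2; rewrite e; lia.
- move=> bE bX Tc /andP[/eqP e1 /eqP e2] [|e ->] //; first by move=> e; move: e2; rewrite e; lia.
  by rewrite in_setD bX bE andbF.
move=> nN nE _ _; rewrite nN nE; apply/eqP/hook_root_fix.
case: (hook_nextP X bR) => // c; first by rewrite (negPf nN).
by move=> bE bX; rewrite in_setD bX bE in nE.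
Qed.

(** A box of [X] is its own root, while its east neighbour has larger content and hence another
    root; an uncut box of [east_set] shares its root with its east neighbour. *)
Lemma cut_hooks X : X \subset east_set -> cut (hooks X) = X.
Proof.
move=> /subsetP sX; apply/setP => b; rewrite inE; case: (boolP (b \in X)) => bX.
  have bE := sX b bX; have bR : b \in borders by move: bE; rewrite inE => /andP[].
  rewrite bE /=; apply/existsPn => B; rewrite negb_and; apply/orP.
  case: (boolP (B \in hooks X)) => [/hooksP[d dR ->]|]; [right|by left].
  apply/negP => /andP[bB /existsP[c /andP[cB /andP[/eqP rc /eqP cc]]]].
  have rb : hook_root X b == b.
    rewrite hook_root_id // in_setD bX /= andbT; move: bE; rewrite !inE.
    by move=> /and3P[-> /negPf-> _]; rewrite andbF.
  move: bB cB; rewrite !mem_fiber => /andP[_ /eqP eb] /andP[cR /eqP ec].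
  have := content_root X cR; rewrite -ec eb (eqP rb) /content rc cc; lia.
apply/negbTE; rewrite negb_and negbK; case: (boolP (b \in east_set)) => //= bE.
have bR : b \in borders by move: bE; rewrite inE => /andP[].
have := hook_next_border X bR; case: (hook_nextP X bR) => [c|c _ _ Tc bc cR|].
- by move: bE; rewrite !inE => /and3P[_ /negPf-> _]; rewrite andbF.
- apply/existsP; exists (fiber X b); rewrite fiber_id //=.
  apply/andP; split; first by apply/hooksP; exists b.
  apply/existsP; exists c; rewrite bc andbT mem_fiber cR /=.
  have [_ <-//] := @right_east X b c bR cR (esym Tc) bc.
  by rewrite hook_root_next.
by rewrite in_setD bE bX.
Qed.

Lemma fiber_north X b c : c \in fiber X b -> c \in north_set ->
  exists2 d, d \in fiber X b & box_col d = box_col c /\ box_row c = (box_row d).+1.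
Proof.
move=> cB cN; have cR : c \in borders by move: cB; rewrite mem_fiber => /andP[].
have dR := hook_next_border X cR.
have dB : hook_next X c \in fiber X b.
  by rewrite -(fiber_eq cB) mem_fiber dR hook_root_next /=.
case: (hook_nextP X cR) dB => [d _ _ /andP[/eqP e1 /eqP e2] dB|d|]; last by rewrite cN.
  by exists d.
by rewrite inE; move: cN; rewrite inE => /andP[_ ->]; rewrite andbF.
Qed.

Lemma fiber_east X b c : c \in fiber X b -> c \in east_set :\: X ->
  exists2 d, d \in fiber X b &
    box_row d = box_row c /\ content d = (content c).+1.
Proof.
move=> cB cE; have cR : c \in borders by move: cB; rewrite mem_fiber => /andP[].
have dR := hook_next_border X cR.
have dB : hook_next X c \in fiber X b.
  by rewrite -(fiber_eq cB) mem_fiber dR hook_root_next /=.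
case: (hook_nextP X cR) dB => [d cN|d _ _ _ /andP[/eqP e1 /eqP e2] dB|]; last by rewrite cE.
  by move: cE cN; rewrite !inE => /and4P[_ _ /negPf->]; rewrite andbF.
by exists d => //; rewrite /content e1 e2; split.
Qed.

Lemma fiber_root X b c : b \in borders -> c \in fiber X b ->
  (c == hook_root X b) = (c \notin north_set) && (c \notin east_set :\: X).
Proof.
by move=> bR; rewrite mem_fiber => /andP[cR /eqP e]; rewrite -hook_root_id // -e eq_sym.
Qed.

Lemma hook_root_fiber X b : b \in borders -> hook_root X b \in fiber X b.
Proof.
move=> bR; rewrite mem_fiber hook_root_border //=.
by rewrite -{1}(hook_root_iter X bound bR).
Qed.

(** Each column of the hook has one box without a step north, its topmost one. Apart from the root,
    these are the boxes with a step east. *)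
Lemma width_fiber X b : b \in borders ->
  (width (fiber X b) - 1)%N = #|[set c in fiber X b | c \in east_set :\: X]|.
Proof.
move=> bR; pose A := [set c in fiber X b | c \notin north_set].
have -> : width (fiber X b) = #|A|.
  apply: size_undup_image.
  - by apply/subsetP => c; rewrite inE => /andP[].
  - have wl c d : c \in A -> d \in A -> box_col c = box_col d ->
       (box_row d <= box_row c)%N.
      move=> cA dA e; rewrite leqNgt; apply/negP => lt.
      move: cA dA; rewrite !inE => /andP[/andP[cR /eqP bc] _] /andP[/andP[dR /eqP bd]].
      rewrite dR => /negP; apply.
      have [f [rf cf]] := box_at_nw la_sorted (leq_pred (box_row d)) (leqnn (box_col d)).
      have Tcd : T c = T d.
        rewrite -(@hook_root_level X c) ?inE // -(@hook_root_level X d) ?inE //.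
        by rewrite -bc bd.
      apply/existsP; exists f; rewrite /below rf cf prednK ?eqxx ?andbT; last by lia.
      by rewrite (@between c f d) ?Tcd ?rf ?cf //; lia.
    move=> c d cA dA e; apply: box_inj => //; apply/eqP.
    by rewrite eqn_leq !wl.
  move=> c; have [n] := ubnP (box_row c); elim: n c => // n IH c ltn cB.
  case: (boolP (c \in north_set)) => cN; last by exists c; rewrite // inE cB.
  have [d dB [e1 e2]] := fiber_north cB cN.
  by have [|f fA e] := IH d _ dB; [lia | exists f; rewrite // e].
have -> : A = hook_root X b |: [set c in fiber X b | c \in east_set :\: X].
  apply/setP => c; rewrite in_setU1 [in LHS]inE [in RHS]inE.
  have [->|ne] := eqVneq c (hook_root X b).
    rewrite hook_root_fiber //=; have := fiber_root bR (hook_root_fiber X bR).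
    by rewrite eqxx => /esym/andP[].
  case: (boolP (c \in fiber X b)) => //= cB.
  have := fiber_root bR cB; rewrite (negPf ne) => /esym/negbT.
  rewrite negb_and !negbK => h; apply/idP/idP => [/negPf cN|]; first by rewrite cN in h.
  by rewrite !inE => /and4P[_ _ /negPf->]; rewrite andbF.
rewrite cardsU1; have := fiber_root bR (hook_root_fiber X bR).
rewrite eqxx => /esym/andP[_ /negPf h].
by rewrite inE h andbF addKn.
Qed.

(** Each row of the hook has one box without a step east, its last one. Apart from the root, these
    are the boxes with a step north. *)
Lemma height_fiber X b : b \in borders ->
  (height (fiber X b) - 1)%N = #|[set c in fiber X b | c \in north_set]|.
Proof.
move=> bR; pose A := [set c in fiber X b | c \notin east_set :\: X].
have -> : height (fiber X b) = #|A|.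
  apply: size_undup_image.
  - by apply/subsetP => c; rewrite inE => /andP[].
  - have wl c d : c \in A -> d \in A -> box_row c = box_row d ->
       (box_col d <= box_col c)%N.
      move=> cA dA e; rewrite leqNgt; apply/negP => lt.
      move: cA dA; rewrite inE => /andP[cB cE]; rewrite inE => /andP[dB _].
      move: (cB) (dB); rewrite !mem_fiber => /andP[cR /eqP bc] /andP[dR /eqP bd].
      have Tcd : T c = T d by rewrite -(hook_root_level X cR) -(hook_root_level X dR) -bc bd.
      have ctl : (content c < content d)%N by rewrite /content e; lia.
      have : c != hook_root X b.
        by apply/eqP => ec; have := content_root X dR; rewrite -bd -ec; lia.
      rewrite (fiber_root bR cB) cE andbT negbK inE => /andP[_ /existsP[f]].
      move=> /andP[/eqP Tf /andP[/eqP cf /eqP rf]].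
      rewrite inE in dR; case/negP: dR.
      have [g [rg cg]] := box_at_nw la_sorted (leq_pred (box_row d)) (leq_pred (box_col d)).
      apply/existsP; exists g; rewrite rg cg !prednK ?eqxx ?andbT; [|lia|lia].
      by rewrite (@between f g d) ?rg ?cg ?Tf ?Tcd //; lia.
    move=> c d cA dA e; apply: box_inj => //; apply/eqP.
    by rewrite eqn_leq !wl.
  move=> c; have [n] := ubnP (content (hook_root X b) - content c)%N.
  elim: n c => // n IH c ltn cB.
  case: (boolP (c \in east_set :\: X)) => cE; last by exists c; rewrite // inE cB.
  have [d dB [e1 e2]] := fiber_east cB cE.
  have [dR /eqP bd] : d \in borders /\ hook_root X b == hook_root X d.
    by apply/andP; rewrite -mem_fiber.
  have := content_root X dR; rewrite -bd => le.
  by have [|f fA e] := IH d _ dB; [lia | exists f; rewrite // e].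
have -> : A = hook_root X b |: [set c in fiber X b | c \in north_set].
  apply/setP => c; rewrite in_setU1 [in LHS]inE [in RHS]inE.
  have [->|ne] := eqVneq c (hook_root X b).
    rewrite hook_root_fiber //=; have := fiber_root bR (hook_root_fiber X bR).
    by rewrite eqxx => /esym/andP[].
  case: (boolP (c \in fiber X b)) => //= cB.
  have := fiber_root bR cB; rewrite (negPf ne) => /esym/negbT.
  rewrite negb_and !negbK => h; apply/idP/idP => [/negPf cN|]; first by rewrite cN orbF in h.
  by rewrite !inE => /andP[_ ->] /=; rewrite !andbF.
rewrite cardsU1; have := fiber_root bR (hook_root_fiber X bR).
rewrite eqxx => /esym/andP[/negPf h _].
by rewrite inE h andbF addKn.
Qed.

Lemma sum_hooks X (F : {set box la} -> nat) (S : {set box la}) : S \subset borders ->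
  (forall b, b \in borders -> F (fiber X b) = #|[set c in fiber X b | c \in S]|) ->
  (\sum_(B in hooks X) F B)%N = #|S|.
Proof.
move=> /setIidPr SR FE; have /and3P[/eqP cov triv _] := preim_partitionP (hook_root X) borders.
rewrite -SR -sum1_card (eq_bigl (fun c => (c \in cover (hooks X)) && (c \in S))).
  rewrite big_trivIset_cond //; apply: eq_bigr => B /hooksP[b bR ->].
  rewrite FE // -sum1_card; apply: eq_bigl => c; by rewrite inE.
by move=> c; rewrite inE cov.
Qed.

Lemma wt_hooks X : wt (T, hooks X) = #|east_set :\: X|.
Proof.
apply: sum_hooks => [|b bR]; last exact: width_fiber.
by apply/subsetP => c; rewrite !inE => /and3P[].
Qed.

Lemma ht_hooks X : ht (T, hooks X) = #|north_set|.
Proof.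
apply: sum_hooks => [|b bR]; last exact: height_fiber.
by apply/subsetP => c; rewrite !inE => /andP[].
Qed.

(** Each hook is counted at its root. *)
Lemma card_hooks_at X i : #|hooks_at (T, hooks X) i| =
  #|[set b in borders | (hook_root X b == b) && (T b == i)]|.
Proof.
rewrite -(card_in_imset (f := fiber X)).
  congr #|pred_of_set _|; apply/setP => B; apply/mem_hooks_at/imsetP => [[b bb ->]|[b]].
    have [bR Tb] := border_borders bb; exists (hook_root X b).
      rewrite inE hook_root_border // hook_root_level // Tb eqxx andbT /=.
      by rewrite -{2}(hook_root_iter X bound bR).
    by apply/esym/fiber_eq/hook_root_fiber.
  rewrite inE => /and3P[bR _ /eqP Tb] ->; exists b => //.
  by rewrite mem_border Tb eqxx; rewrite inE in bR.
move=> b c; rewrite !inE => /and3P[bR /eqP rb _] /and3P[cR /eqP rc _] e.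
have : c \in fiber X b by rewrite e fiber_id ?inE.
by rewrite mem_fiber rb rc => /andP[_ /eqP].
Qed.

(** By [rbt_hooks] and [cut_hooks], the tableaux on [T] correspond to the subsets of [east_set], and
    such a subset is what one chooses when the product of the box weights is expanded. *)
Lemma hooks_sum (R : comNzRingType) (a b : R) (x : nat -> R) (n : nat) :
  (forall c, T c < n)%N ->
  \sum_(Q | `[< is_rbt (T, Q) >]) weight a b (T, Q) *
     \prod_(i < n) x i ^+ #|hooks_at (T, Q) i| =
  \prod_c box_weight a b x T c.
Proof.
move=> Tn.
(* [F c] is the contribution of a box with a cut on its right, which ends a hook; [G c] is that of a
   box without one. *)
pose F c := if c \in east_set then x (T c) else 0.
pose G c := if nw_same T c then a + b else if c \in north_set then b
            else if c \in east_set then a else x (T c).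
rewrite [RHS](_ : _ = \prod_c (F c + G c)); last first.
  apply: eq_bigr => c _; rewrite /F /G /box_weight !inE.
  case: (nw_same T c) => /=; first by rewrite add0r.
  case: (north_same T c) => /=; first by rewrite add0r.
  by case: (east_same T c) => /=; rewrite ?add0r // addrC.
rewrite bigA_distr /= (reindex_onto hooks cut) /=; last first.
  by move=> Q /asboolP /rbt_hooks.
rewrite [RHS](bigID (fun X => X \subset east_set)) /= [X in _ = _ + X]big1 ?addr0; last first.
  move=> X /subsetPn[c cX cE]; rewrite (bigD1 c) //= cX /F (negPf cE) mul0r.
  by [].
apply: eq_big => [X|X /andP[_ /eqP cX]].
  rewrite (asboolT (hooks_rbt X)) /=; apply/eqP/idP => [<-|]; last exact: cut_hooks.
  by apply/subsetP => c; rewrite inE => /andP[].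
have {cX} /subsetP sX : X \subset east_set.
  by rewrite -cX; apply/subsetP => c; rewrite inE => /andP[].
rewrite /weight wt_hooks ht_hooks /inn.
pose S := [set c in borders | hook_root X c == c].
have -> : \prod_(i < n) x i ^+ #|hooks_at (T, hooks X) i| = \prod_(c in S) x (T c).
  rewrite (partition_big (fun c => Ordinal (Tn c)) xpredT) //=.
  apply: eq_bigr => i _; rewrite card_hooks_at -prodr_const.
  apply: eq_big => [c|c]; first by rewrite !inE andbA -val_eqE.
  by rewrite !inE => /and3P[_ _ /eqP->].
rewrite -!prodr_const ![\prod_(_ in _) _]big_mkcond -!big_split /=.
apply: eq_bigr => c _.
have XE : c \in X -> [&& ~~ nw_same T c, ~~ north_same T c & east_same T c].
  by move=> /sX; rewrite !inE.
have -> : (c \in S) = [&& ~~ nw_same T c, ~~ north_same T c & (c \in X) || ~~ east_same T c].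
  rewrite inE; have [cR|] := boolP (c \in borders); last first.
    by rewrite inE negbK => ->.
  rewrite hook_root_id // !inE; move: cR; rewrite inE => -> /=.
  by case: (north_same T c) => //=; rewrite negb_and negbK.
have -> : (c \in [set b0 : box la | b0 \in inner_part T (T b0)]) = nw_same T c.
  by rewrite inE in_setD mem_border eqxx /= negbK inE eqxx andbT.
rewrite /F /G !inE /=.
case: (c \in X) XE => [/(_ isT)/and3P[/negPf-> /negPf-> ->]|_] /=.
  by rewrite !mul1r.
by case: (nw_same T c) (north_same T c) (east_same T c) => [] [] [] /=;
  rewrite ?mul1r ?mulr1.
Qed.

End Hooks.

(** * Branching of the tableau polynomials *)

Lemma nth_filter_pos (s : seq nat) i : sorted geq s ->
  nth 0%N [seq k <- s | k != 0%N] i = nth 0%N s i.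
Proof.
elim: s i => //= k s IH i; rewrite (path_sortedE (leT := geq)); last first.
  by move=> x y z /= xy zx; apply: leq_trans xy.
move=> /andP[/allP kmax /IH {}IH].
have [k0|k0] := eqVneq k 0%N; last by case: i => //= i; apply: IH.
have s0 j : nth 0%N s j = 0%N.
  have [ltj|gej] := ltnP j (size s); last by rewrite nth_default.
  by have := kmax _ (mem_nth 0%N ltj); rewrite /= k0 leqn0 => /eqP.
by rewrite IH s0 k0; case: i => //= i; rewrite s0.
Qed.

Section Parts.
Implicit Types la mu : intpart.

Lemma part_sorted la : sorted geq la.
Proof. by have /andP[] := valP la. Qed.

Definition part_fun la : nat -> nat := nth 0%N la.

Lemma part_dec la j : (part_fun la j.+1 <= part_fun la j)%N.
Proof. by rewrite /part_fun nth_part_le ?part_sorted. Qed.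

Lemma part_eq0 la j : (part_fun la j == 0%N) = (size la <= j)%N.
Proof.
have [lt|le] := ltnP j (size la); last by rewrite /part_fun nth_default.
by apply/eqP => e; have /andP[_ /negP] := valP la; apply; rewrite -e mem_nth.
Qed.

Lemma part_fun_inj la mu : part_fun la =1 part_fun mu -> la = mu.
Proof.
move=> e; apply/val_inj/(@eq_from_nth _ 0%N) => [|i _]; last exact: e.
by apply/eqP; rewrite eqn_leq -!part_eq0 (e (size mu)) -(e (size la)) !part_eq0 !leqnn.
Qed.

Fact empty_is_part : is_part [::]. Proof. by []. Qed.
Definition empty_part : intpart := exist _ [::] empty_is_part.

Definition part_of (N M : nat) (g : {ffun 'I_N -> 'I_M}) : intpart :=
  insubd empty_part [seq k <- mkseq (nat_fun g) N | k != 0%N].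

Lemma part_ofE N M (g : {ffun 'I_N -> 'I_M}) : nonincr g ->
  part_fun (part_of g) = nat_fun g.
Proof.
move=> gdec; have srt : sorted geq (mkseq (nat_fun g) N).
  apply/(sortedP 0%N) => i; rewrite size_mkseq => lti.
  by rewrite !nth_mkseq ?(ltnW lti) //=; apply: nonincrP.
apply/funext => i; rewrite /part_fun /part_of /seq_of_part insubdK.
  rewrite nth_filter_pos //; have [lt|le] := ltnP i N; first by rewrite nth_mkseq.
  by rewrite nth_default ?size_mkseq // nat_fun_out.
rewrite unfold_in /is_part mem_filter eqxx andbT; apply: sorted_filter srt.
by move=> x y z /= xy zx; apply: leq_trans xy.
Qed.

Definition parts_in (N M : nat) : seq intpart :=
  [seq part_of g | g : {ffun 'I_N -> 'I_M} in nonincr].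

Lemma sum_parts_in (V : nmodType) N M (F : intpart -> V) :
  \sum_(la <- parts_in N M) F la =
  \sum_(g : {ffun 'I_N -> 'I_M} | nonincr g) F (part_of g).
Proof. by rewrite big_image. Qed.

Lemma parts_in_uniq N M : uniq (parts_in N M).
Proof.
rewrite map_inj_in_uniq ?enum_uniq // => g h; rewrite !mem_enum => gd hd e.
apply/ffunP => i; apply/val_inj.
by have := congr1 (fun la => part_fun la i) e; rewrite !part_ofE // !nat_funE.
Qed.

Lemma ffun_of_fun N M (f : nat -> nat) : (forall i, f i < M)%N ->
  (forall i, N <= i -> f i = 0)%N -> exists g : {ffun 'I_N -> 'I_M}, nat_fun g = f.
Proof.
move=> ltM out; exists [ffun i : 'I_N => Ordinal (ltM i)].
apply/funext => i; have [lti|gei] := ltnP i N; last by rewrite nat_fun_out ?out.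
by rewrite (nat_funE _ (Ordinal lti)) ffunE.
Qed.

Lemma mem_parts_in N M la : (0 < M)%N ->
  (la \in parts_in N M) = (size la <= N)%N && (part_fun la 0 < M)%N.
Proof.
move=> M0; apply/imageP/andP => [[g gdec ->]|[sz lt]].
  have pE := part_ofE gdec; rewrite pE; split.
    by rewrite -part_eq0 pE nat_fun_out.
  by rewrite /nat_fun; case: insubP => // i _ _; apply: ltn_ord.
have [||g gE] := @ffun_of_fun N M (part_fun la).
- move=> i; apply: leq_ltn_trans lt.
  by rewrite /part_fun nth_part_le ?part_sorted.
- by move=> i le; apply/eqP; rewrite part_eq0 (leq_trans sz).
have gdec : nonincr g by apply/forallP => i; rewrite gE part_dec.
by exists g => //; apply: part_fun_inj => i; rewrite part_ofE // gE.
Qed.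

End Parts.

Definition nat_filling {I : finType} {n} (T : {ffun I -> 'I_n}) : {ffun I -> nat} :=
  [ffun c => T c : nat].

(** The tableau sum in the variables [x 0], ..., [x n.-1], with the choices of rim hooks already
    summed out by [hooks_sum]. *)
Definition rpp_poly {R : comNzRingType} (a b : R) (x : nat -> R) (n : nat)
    (la : seq nat) : R :=
  \sum_(T : {ffun box la -> 'I_n} | `[< is_rpp (nat_filling T) >])
    \prod_c box_weight a b x (nat_filling T) c.

Fact row_lt (la : seq nat) i j : (j < nth 0%N la i)%N -> (i < size la)%N.
Proof. by move=> lt; rewrite ltnNge; apply: contraL lt => /(nth_default 0%N) ->. Qed.

Definition mkbox (la : seq nat) i j (lt : (j < nth 0%N la i)%N) : box la :=
  Tagged (fun k : 'I_(size la) => 'I_(nth 0%N la k))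
     (Ordinal lt : 'I_(nth 0%N la (Ordinal (row_lt lt)))).

Lemma nat_fillingE (I : finType) m (T : {ffun I -> 'I_m}) c : nat_filling T c = T c.
Proof. exact: ffunE. Qed.

Section Embedding.
Context {la mu : intpart} (mu_la : forall i, (part_fun mu i <= part_fun la i)%N) (n : nat).

Definition embed (c : box mu) : box la :=
  mkbox (leq_trans (box_col_lt c) (mu_la (box_row c))).

Lemma embed_inj : injective embed.
Proof.
move=> c d e; apply: box_inj.
  exact: (congr1 box_row e).
exact: (congr1 box_col e).
Qed.

Lemma in_embed (c : box la) :
  reflect (exists d, c = embed d) (box_col c < part_fun mu (box_row c))%N.
Proof.
apply: (iffP idP) => [lt|[d ->]]; last exact: box_col_lt d.
by exists (mkbox lt); apply: box_inj.
Qed.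

Definition extend (T : {ffun box mu -> 'I_n}) : {ffun box la -> 'I_n.+1} :=
  [ffun c => if [pick d | c == embed d] is Some d then widen_ord (leqnSn n) (T d)
             else ord_max].

Lemma extend_embed T d : extend T (embed d) = T d :> nat.
Proof.
rewrite ffunE; case: pickP => [e /eqP/embed_inj -> //|/(_ d)].
by rewrite eqxx.
Qed.

Lemma extend_out T c : (part_fun mu (box_row c) <= box_col c)%N -> extend T c = n :> nat.
Proof.
move=> le; rewrite ffunE; case: pickP => [d /eqP e|//].
by move: le; rewrite leqNgt; case/negP; apply/in_embed; exists d.
Qed.

Lemma extend_lt T c : (extend T c < n)%N = (box_col c < part_fun mu (box_row c))%N.
Proof.
case: (ltnP (box_col c) _) => [/in_embed[d ->]|le]; last by rewrite extend_out // ltnn.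
by rewrite extend_embed ltn_ord.
Qed.

Lemma extend_inj : injective extend.
Proof.
move=> T T' e; apply/ffunP => d; apply/val_inj => /=.
by rewrite -(extend_embed T) -(extend_embed T') e.
Qed.

Lemma extend_rpp T : is_rpp (nat_filling T) -> is_rpp (nat_filling (extend T)).
Proof.
move=> [rows cols].
have h c d : (box_row c <= box_row d)%N -> (box_col c <= box_col d)%N ->
    (forall c' d', c = embed c' -> d = embed d' ->
       nat_filling T c' <= nat_filling T d')%N ->
    (nat_filling (extend T) c <= nat_filling (extend T) d)%N.
  move=> ler lec hT; rewrite !nat_fillingE.
  case: (ltnP (box_col d) (part_fun mu (box_row d))) => [|le]; last first.
    by rewrite (extend_out _ le) -ltnS ltn_ord.
  move=> ltd; have ltc : (box_col c < part_fun mu (box_row c))%N.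
    apply: leq_ltn_trans lec (leq_trans ltd _).
    by rewrite /part_fun nth_part_le ?part_sorted.
  have [d' ed] := in_embed _ ltd; have [c' ec] := in_embed _ ltc.
  have := hT c' d' ec ed; rewrite !nat_fillingE.
  by rewrite ed ec !extend_embed.
split=> c d e le; apply: h => //; rewrite ?e // => c' d' ec ed.
  by apply: rows; move: e le; rewrite ec ed.
by apply: cols; move: e le; rewrite ec ed.
Qed.

Lemma extend_rppK (T : {ffun box la -> 'I_n.+1}) : is_rpp (nat_filling T) ->
  (forall c, (T c < n)%N = (box_col c < part_fun mu (box_row c))%N) ->
  exists2 T', is_rpp (nat_filling T') & T = extend T'.
Proof.
move=> [rows cols] Tn; have lt d : (T (embed d) < n)%N by rewrite Tn; apply: box_col_lt d.
exists [ffun d => Ordinal (lt d)].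
  split=> c d e le; rewrite !nat_fillingE !ffunE /=.
    by have := rows (embed c) (embed d) e le; rewrite !nat_fillingE.
  by have := cols (embed c) (embed d) e le; rewrite !nat_fillingE.
apply/ffunP => c; apply/val_inj => /=.
case: (ltnP (box_col c) (part_fun mu (box_row c))) => [/in_embed[d ->]|le].
  by rewrite extend_embed ffunE.
rewrite extend_out //; apply/eqP; rewrite eqn_leq -ltnS ltn_ord /=.
by rewrite leqNgt Tn -leqNgt.
Qed.

Context {R : comNzRingType} (a b : R) (x : nat -> R).

(** The entry of the box is below [n], so a neighbour with the same entry lies in [mu] as well. *)
Lemma box_weight_embed T d :
  box_weight a b x (nat_filling (extend T)) (embed d) =
  box_weight a b x (nat_filling T) d.
Proof.
have TE e : nat_filling (extend T) (embed e) = nat_filling T e.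
  by rewrite !nat_fillingE extend_embed.
have lt e : (nat_filling T e < n)%N by rewrite nat_fillingE.
have exE (P : box la -> bool) :
    [exists c, (nat_filling (extend T) c == nat_filling (extend T) (embed d)) && P c] =
    [exists e, (nat_filling T e == nat_filling T d) && P (embed e)].
  apply/existsP/existsP => [[c /andP[/eqP e Pc]]|[e /andP[/eqP ee Pe]]].
    have /in_embed[c' ec] : (box_col c < part_fun mu (box_row c))%N.
      by rewrite -(extend_lt T) -nat_fillingE e TE.
    by exists c'; rewrite -!TE -ec e eqxx.
  by exists (embed e); rewrite !TE ee eqxx.
rewrite /box_weight !TE /nw_same /north_same /east_same.
by rewrite (exE (fun c => ((box_row c).+1 == _) && ((box_col c).+1 == _))) !exE.
Qed.

(** All boxes outside [mu] have entry [n], so the tests on neighbours only ask whether the neighbour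
    is in [la / mu]. In the first row [prev_row] is [la 0], past every column, and the tests to the
    north fail. *)
Lemma box_weight_out T (c : box la) : (part_fun mu (box_row c) <= box_col c)%N ->
  box_weight a b x (nat_filling (extend T)) c =
  if (prev_row (part_fun la) (part_fun mu) (box_row c) < box_col c)%N then a + b
  else if box_col c == prev_row (part_fun la) (part_fun mu) (box_row c) then b
  else if ((box_col c).+1 < part_fun la (box_row c))%N then a + x n else x n.
Proof.
move=> le; have Tc : nat_filling (extend T) c = n by rewrite nat_fillingE extend_out.
have TE d : (nat_filling (extend T) d == n) =
    (part_fun mu (box_row d) <= box_col d)%N.
  rewrite nat_fillingE leqNgt -(extend_lt T) ltn_neqAle negb_and negbK.
  by rewrite -ltnS ltn_ord orbF.
have Nla := nth_part_le (part_sorted la).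
have ltla := box_col_lt c; have la0 := leq_trans ltla (Nla _ _ (leq0n _)).
have nwE : nw_same (nat_filling (extend T)) c =
   (prev_row (part_fun la) (part_fun mu) (box_row c) < box_col c)%N.
  rewrite /nw_same Tc; apply/existsP/idP => [[d /and3P[+ /eqP rd /eqP cd]]|].
    by rewrite TE -rd -cd /=.
  case er : (box_row c) => [|i] /= lt.
    by move: lt; rewrite ltnNge (ltnW la0).
  have [||d [rd cd]] := @box_at_nw _ (part_sorted la) c i (box_col c).-1.
  - by rewrite er.
  - exact: leq_pred.
  have c_gt0 : (0 < box_col c)%N by apply: leq_ltn_trans lt.
  by exists d; rewrite TE rd cd !prednK // !eqxx !andbT -ltnS prednK.
have nE : north_same (nat_filling (extend T)) c =
   (prev_row (part_fun la) (part_fun mu) (box_row c) <= box_col c)%N.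
  rewrite /north_same Tc; apply/existsP/idP => [[d /and3P[+ /eqP cd /eqP rd]]|].
    by rewrite TE rd cd /=.
  case er : (box_row c) => [|i] /= lt.
    by move: lt; rewrite leqNgt la0.
  have [||d [rd cd]] := @box_at_nw _ (part_sorted la) c i (box_col c); rewrite ?er //.
  by exists d; rewrite TE rd cd /below er rd cd !eqxx !andbT.
have eE : east_same (nat_filling (extend T)) c =
   ((box_col c).+1 < part_fun la (box_row c))%N.
  rewrite /east_same Tc; apply/existsP/idP => [[d /and3P[_ /eqP rd /eqP cd]]|lt].
    by rewrite -cd -rd; apply: box_col_lt.
  exists (mkbox lt); rewrite TE /right_of !eqxx !andbT /=.
  exact: leqW.
rewrite /box_weight nwE nE eE Tc; case: ltngtP => //.
Qed.

End Embedding.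

Section Branching.
Context {R : comNzRingType} (a b : R) (x : nat -> R) (n : nat).
Implicit Types la mu : intpart.

Lemma strip_weight_box (N : nat) la mu (y : R) : (size la <= N)%N ->
  (forall i, part_fun mu i <= part_fun la i)%N ->
  strip_weight N a b y (part_fun la) (part_fun mu) =
  \prod_(c : box la | (part_fun mu (box_row c) <= box_col c)%N)
    (if (prev_row (part_fun la) (part_fun mu) (box_row c) < box_col c)%N then a + b
     else if box_col c == prev_row (part_fun la) (part_fun mu) (box_row c) then b
     else if ((box_col c).+1 < part_fun la (box_row c))%N then a + y else y).
Proof.
move=> leN mu_la; pose w i j := if (prev_row (part_fun la) (part_fun mu) i < j)%N then a + b
     else if j == prev_row (part_fun la) (part_fun mu) i then b
     else if (j.+1 < part_fun la i)%N then a + y else y.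
transitivity (\prod_(i < size la)
  \prod_(j < part_fun la i | (part_fun mu i <= j)%N) w i j); last first.
  by rewrite sig_big_dep.
rewrite /strip_weight (big_ord_widen_cond _ xpredT
  (fun i => \prod_(j < part_fun la i | (part_fun mu i <= j)%N) w i j) leN) [RHS]big_mkcond.
apply: eq_bigr => i _; rewrite mu_la /=; case: ifP => [_|/negbT]; last first.
  rewrite -leqNgt -part_eq0 => /eqP e; have := mu_la i; rewrite e leqn0 => /eqP ->.
  by rewrite row_weight0.
rewrite -(big_mkord (fun j => part_fun mu i <= j)%N (fun j => w i j)).
by rewrite /row_weight [LHS](big_nat_widenl _ 0).
Qed.

Lemma part_of_rpp la N M (T : {ffun box la -> 'I_n.+1}) : (0 < M)%N ->
  la \in parts_in N M -> is_rpp (nat_filling T) ->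
  exists2 mu, mu \in parts_in N M &
    (forall i, part_fun mu i <= part_fun la i)%N /\
    forall c, (T c < n)%N = (box_col c < part_fun mu (box_row c))%N.
Proof.
move=> M0 laP Trpp; have srt := part_sorted la.
pose f i := (\max_(c : box la | (box_row c == i) && (T c < n)%N) (box_col c).+1)%N.
have fP i k : reflect (forall c, box_row c = i -> (T c < n)%N -> (box_col c < k)%N) (f i <= k)%N.
  apply: (iffP (bigmax_leqP _ _ _)) => [h c rc Tc|h c /andP[/eqP]]; last exact: h.
  by apply: h; rewrite rc eqxx.
have f_la i : (f i <= part_fun la i)%N by apply/fP => c <- _; apply: box_col_lt.
have f_dec i : (f i.+1 <= f i)%N.
  apply/fP => c rc Tc.
  have [||d [rd cd]] := @box_at_nw _ srt c i (box_col c); rewrite ?rc //.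
  have := fP i (f i); rewrite leqnn => /elimT/(_ isT) => h.
  rewrite -cd; apply: h => //; apply: leq_ltn_trans Tc.
  have := rpp_le srt Trpp (b := d) (c := c); rewrite !nat_fillingE rd rc cd.
  by apply.
move: laP; rewrite mem_parts_in // => /andP[sz lt].
have [||g gE] := @ffun_of_fun N M f.
- move=> i; apply: leq_ltn_trans (f_la i) (leq_ltn_trans _ lt).
  by rewrite /part_fun nth_part_le.
- move=> i le; apply/eqP; rewrite -leqn0 (leq_trans (f_la i)) // leqn0 part_eq0.
  exact: leq_trans le.
have gdec : nonincr g by apply/forallP => i; rewrite gE.
have muE : part_fun (part_of g) = f by rewrite part_ofE.
exists (part_of g); first by apply/imageP; exists g.
rewrite muE; split=> // c; apply/idP/idP => [Tc|].
  have := fP (box_row c) (f (box_row c)); rewrite leqnn => /elimT/(_ isT).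
  exact.
apply: contraLR; rewrite -!leqNgt => Tc; apply/fP => d rd Td.
rewrite ltnNge; apply/negP => le; move: Td; rewrite ltnNge; case/negP.
apply: leq_trans Tc _; have := rpp_le srt Trpp (b := c) (c := d).
by rewrite !nat_fillingE rd; apply.
Qed.

(** The fillings are sorted by the shape [mu] of their entries below [n]; the boxes of [la / mu]
    contribute the strip weight. *)
Lemma rpp_polyS N M la : (0 < M)%N -> la \in parts_in N M ->
  rpp_poly a b x n.+1 la =
  \sum_(mu <- parts_in N M)
    strip_weight N a b (x n) (part_fun la) (part_fun mu) * rpp_poly a b x n mu.
Proof.
move=> M0 laP.
pose good mu (T : {ffun box la -> 'I_n.+1}) :=
  `[< forall i, part_fun mu i <= part_fun la i >]%N &&
  [forall c, (T c < n)%N == (box_col c < part_fun mu (box_row c))%N].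
transitivity (\sum_(mu <- parts_in N M)
   \sum_(T : {ffun box la -> 'I_n.+1} | `[< is_rpp (nat_filling T) >] && good mu T)
     \prod_c box_weight a b x (nat_filling T) c).
  rewrite (exchange_big_dep (fun T => `[< is_rpp (nat_filling T) >])) /=; last first.
    by move=> mu T _ /andP[].
  apply: eq_bigr => T /asboolP Trpp.
  have [mu muP [mu_la Tmu]] := part_of_rpp M0 laP Trpp.
  have gmu : good mu T.
    by rewrite /good asboolT //; apply/forallP => c; rewrite Tmu.
  rewrite (asboolT Trpp) -[RHS]big_filter (perm_big [:: mu]) ?big_seq1 //.
  apply: uniq_perm; rewrite ?filter_uniq ?parts_in_uniq // => nu.
  rewrite mem_filter mem_seq1 /=; apply/andP/eqP => [[/andP[/asboolP nu_la /forallP Tnu] _]|-> //].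
  have le mu1 mu2 : (forall i, part_fun mu1 i <= part_fun la i)%N ->
     (forall c, (T c < n)%N = (box_col c < part_fun mu1 (box_row c))%N) ->
     (forall c, (T c < n)%N = (box_col c < part_fun mu2 (box_row c))%N) ->
     forall i, (part_fun mu1 i <= part_fun mu2 i)%N.
    move=> h1 h2 h3 i; rewrite leqNgt; apply/negP => lt.
    have ltla := leq_trans lt (h1 i).
    have e1 : (T (mkbox ltla) < n)%N = (part_fun mu2 i < part_fun mu1 i)%N := h2 _.
    have e2 : (T (mkbox ltla) < n)%N = (part_fun mu2 i < part_fun mu2 i)%N := h3 _.
    by rewrite e1 lt ltnn in e2.
  apply: part_fun_inj => i; apply/eqP; rewrite eqn_leq.
  by apply/andP; split; apply: le => // c; exact: (eqP (Tnu c)).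
rewrite !big_seq; apply: eq_bigr => mu muP; rewrite /good.
case: asboolP => [mu_la|nmu_la]; last first.
  (* A shape not contained in [la] has no fillings, and its strip weight is 0 as well. *)
  rewrite big_pred0 => [|T]; last by rewrite andbF.
  have /existsNP[i /negP] := nmu_la; rewrite -ltnNge => lti.
  have ltN : (i < N)%N.
    rewrite ltnNge; apply/negP => leN; move: muP; rewrite mem_parts_in // => /andP[sz _].
    have /eqP e : part_fun mu i == 0%N by rewrite part_eq0 (leq_trans sz).
    by rewrite e in lti.
  by rewrite /strip_weight (bigD1 (Ordinal ltN)) //= leqNgt lti !mul0r.
rewrite (strip_weight_box _ _ mu_la); last first.
  by move: laP; rewrite mem_parts_in // => /andP[].
rewrite /rpp_poly big_distrr /=.
rewrite (eq_bigl (mem [set extend mu_la T | T in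
  [pred T | `[< is_rpp (nat_filling T) >]]])); last first.
  move=> T; apply/andP/imsetP => [[/asboolP Trpp /forallP Tn]|[T' /asboolP T'rpp ->]].
    have [|T' T'rpp ->] := extend_rppK mu_la Trpp; first by move=> c; exact: (eqP (Tn c)).
    by exists T' => //; apply/asboolP.
  split; first exact/asboolP/extend_rpp.
  by apply/forallP => c; rewrite extend_lt.
rewrite big_imset /=; last by move=> ? ? _ _; apply: extend_inj.
apply: eq_bigr => T _.
rewrite (bigID (fun c => part_fun mu (box_row c) <= box_col c)%N) /=; congr (_ * _).
  by apply: eq_bigr => c le; rewrite box_weight_out.
rewrite (eq_bigl (mem [set embed mu_la c | c in predT])); last first.
  move=> c; rewrite -ltnNge; apply/in_embed/imsetP => [[d ->]|[d _ ->]]; by exists d.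
rewrite big_imset /=; last by move=> ? ? _ _; apply: embed_inj.
by apply: eq_bigr => c _; rewrite box_weight_embed.
Qed.

Lemma rpp_poly_empty k : rpp_poly a b x k empty_part = 1.
Proof.
have e0 : box empty_part -> False by move=> c; have := box_row_lt c.
rewrite /rpp_poly (big_pred1 [ffun c => False_rect _ (e0 c)]) => [|T].
  by rewrite big_pred0 // => c; case: (e0 c).
rewrite (_ : T = [ffun c => False_rect _ (e0 c)]); last first.
  by apply/ffunP => c; case: (e0 c).
by rewrite /= eqxx; apply: asboolT; split=> c; have [] := e0 c.
Qed.

Lemma rpp_poly0 la : rpp_poly a b x 0 la = (la == empty_part)%:R.
Proof.
have [->|ne] := eqVneq la empty_part; first exact: rpp_poly_empty.
rewrite /rpp_poly big1 // => T.
have lt : (0 < nth 0 la 0)%N.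
  rewrite lt0n; apply: contra ne => /eqP e; apply/eqP/part_fun_inj => i.
  have : (part_fun la i <= part_fun la 0)%N by rewrite /part_fun nth_part_le ?part_sorted.
  by rewrite {2}/part_fun e leqn0 => /eqP ->; rewrite /part_fun nth_nil.
by have := ltn_ord (T (mkbox lt)).
Qed.

End Branching.

(** * The Cauchy identity and alternants *)

Section Cauchy.
Context {R : comNzRingType} (a b : R) (x : nat -> R) (N M : nat).
Hypothesis N_gt0 : (0 < N)%N.
Implicit Types la mu nu kap : intpart.

Let C mu kap := transition (- a) (- b) N (part_fun mu) (part_fun kap).

Lemma part_out la j : (size la <= j)%N -> part_fun la j = 0%N.
Proof. by move=> le; apply/eqP; rewrite part_eq0. Qed.

(** Both sides expand one determinant, whose entries carry the factor 1 / (1 - y y_i): [pieri_left]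
    and [pieri_right]. *)
Lemma pieri y mu kap : (part_fun mu 0 < M)%N -> (size kap <= N)%N ->
  (part_fun kap 0 + N <= M)%N ->
  \sum_(la <- parts_in N M)
     strip_weight N a b y (part_fun la) (part_fun mu) * C la kap =
  \sum_(nu <- parts_in N M)
     strip_weight N 0 0 y (part_fun kap) (part_fun nu) * C mu nu.
Proof.
move=> mulM szk kapM; rewrite !sum_parts_in.
have kap_out j : (N <= j)%N -> part_fun kap j = 0%N.
  by move=> le; apply/part_out/(leq_trans szk).
rewrite (eq_bigr (fun g : {ffun 'I_N -> 'I_M} =>
    strip_weight N a b y (nat_fun g) (part_fun mu) *
    transition (- a) (- b) N (nat_fun g) (part_fun kap))); last first.
  by move=> g gdec; rewrite /C part_ofE.
rewrite -(@pieri_left _ a b y N M) //; try exact: part_dec.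
rewrite (@pieri_right _ a b y N M) //; try exact: part_dec.
by apply: eq_bigr => g gdec; rewrite /C part_ofE.
Qed.

Lemma strip_weight00_gt y kap nu : (part_fun kap 0 < part_fun nu 0)%N ->
  strip_weight N 0 0 y (part_fun kap) (part_fun nu) = 0 :> R.
Proof.
by move=> lt; rewrite /strip_weight (bigD1 (Ordinal N_gt0)) //= leqNgt lt mul0r.
Qed.

Lemma part_empty kap : (part_fun kap 0 == 0%N) = (kap == empty_part).
Proof.
rewrite part_eq0 leqn0 size_eq0; apply/eqP/eqP => [e|-> //].
by apply/val_inj.
Qed.

(** Induction on the number of variables: the last variable is removed from the tableau sums by
    branching, moved from [la] to [kap] by the Pieri rule, and reabsorbed by branching at
    [a = b = 0]. *)
Lemma cauchy n kap : (size kap <= N)%N -> (part_fun kap 0 + N <= M)%N ->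
  \sum_(la <- parts_in N M) rpp_poly a b x n la * C la kap = rpp_poly 0 0 x n kap.
Proof.
elim: n kap => [|n IH] kap szk kapM; have M_gt0 : (0 < M)%N by lia.
  rewrite (bigD1_seq empty_part) ?parts_in_uniq ?mem_parts_in //=.
  rewrite big1 ?addr0 => [|la /negPf ne]; last by rewrite rpp_poly0 ne mul0r.
  rewrite !rpp_poly0 eqxx mul1r /C (_ : part_fun _ = fun=> 0%N); last first.
    by apply/funext => i; rewrite /part_fun nth_nil.
  by rewrite transition0 ?part_empty //; apply: part_dec.
have kapP : kap \in parts_in N M by rewrite mem_parts_in // szk; lia.
transitivity (\sum_(mu <- parts_in N M) rpp_poly a b x n mu *
    \sum_(la <- parts_in N M)
       strip_weight N a b (x n) (part_fun la) (part_fun mu) * C la kap).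
  under [RHS]eq_bigr do rewrite mulr_sumr.
  rewrite [RHS]exchange_big /= !big_seq; apply: eq_bigr => la laP.
  rewrite (rpp_polyS _ _ _ _ M_gt0 laP) mulr_suml; apply: eq_bigr => mu _; ring.
transitivity (\sum_(mu <- parts_in N M) rpp_poly a b x n mu *
    \sum_(nu <- parts_in N M)
       strip_weight N 0 0 (x n) (part_fun kap) (part_fun nu) * C mu nu).
  rewrite !big_seq; apply: eq_bigr => mu; rewrite mem_parts_in // => /andP[_ lt].
  by rewrite pieri.
under eq_bigr do rewrite mulr_sumr.
rewrite exchange_big /= (rpp_polyS _ _ _ _ M_gt0 kapP) !big_seq.
apply: eq_bigr => nu; rewrite mem_parts_in // => /andP[sznu _].
(* Only [nu] with first part at most that of [kap] contribute, and these inherit the bound involving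
   [M]. *)
have [le|lt] := leqP (part_fun nu 0) (part_fun kap 0); last first.
  by rewrite strip_weight00_gt // mul0r big1 // => mu _; rewrite mul0r mulr0.
rewrite -IH //; last by lia.
by rewrite mulr_sumr; apply: eq_bigr => mu _; ring.
Qed.

End Cauchy.

(** * Schur polynomials as quotients of alternants *)

Section Alternants.
Context {R : comNzRingType} (x : nat -> R).
Implicit Types nu kap : intpart.

Definition alternant n (kap : nat -> nat) : R :=
  \det (\matrix_(i < n, j < n) x i ^+ (kap j + (n - j.+1))).

Lemma geometric_interval (y z : R) k' k : (k' <= k.+1)%N ->
  (\sum_(k' <= v < k.+1) y ^+ (k - v) * z ^+ v) * (z - y) =
  z ^+ k.+1 - y ^+ (k.+1 - k') * z ^+ k'.
Proof.
move=> le; rewrite mulr_suml.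
have := telescope_sumr (fun v => y ^+ (k.+1 - v) * z ^+ v) le.
rewrite subnn expr0 mul1r => <-; apply: eq_big_nat => v /andP[_ ltv].
by rewrite subSS exprS (subSn (ltnSE ltv)) exprS; ring.
Qed.

(** Subtracting from each exponent's vector the right multiple of the next one clears the entries of
    the last variable, except for the last exponent. The other entries become divisible by
    [x i - x n], and the quotients are sums over the intervals from [kap j.+1] to [kap j]. *)
Lemma alternant_branch n M (kap : nat -> nat) :
  (forall j, kap j.+1 <= kap j)%N -> (forall j, kap j < M)%N ->
  alternant n.+1 kap = (\prod_(i < n) (x i - x n)) *
   \sum_(g : {ffun 'I_n -> 'I_M})
     interlace_weight n (x n) kap (nat_fun g) * x n ^+ kap n * alternant n (nat_fun g).
Proof.
move=> kap_dec ltM.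
pose l j := (kap j + (n.+1 - j.+1))%N.
pose s j : 'rV[R]_n.+1 := if (j < n.+1)%N then \row_(i < n.+1) x i ^+ l j else 0.
pose c j := if (j < n)%N then x n ^+ (l j - l j.+1) else 0.
pose r j : 'rV[R]_n.+1 := s j - c j *: s j.+1.
have sN : s n.+1 = 0 by rewrite /s ltnn.
have sr j : (j < n.+1)%N -> s j = r j + c j *: s j.+1 by rewrite subrK.
have -> : alternant n.+1 kap = \det (\matrix_(j < n.+1) s j).
  rewrite /alternant -det_tr; congr (\det _); apply/matrixP => i j.
  by rewrite !mxE /s ltn_ord mxE.
rewrite (det_add_next sN sr) (expand_det_col _ ord_max) (bigD1 ord_max) //=.
rewrite big1 ?addr0 => [|j nj]; last first.
  have ltj : (j < n)%N by rewrite ltn_neqAle -ltnS ltn_ord andbT; exact: nj.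
  rewrite !mxE /s /c ltn_ord ltnS ltj !mxE /= -exprD.
  rewrite (_ : l j - l j.+1 + l j.+1 = l j)%N ?subrr ?mul0r // subnK //.
  by rewrite /l; have := kap_dec j; lia.
have -> : (\matrix_(j < n.+1) r j) ord_max ord_max = x n ^+ kap n.
  by rewrite !mxE /s /c ltnn ltnSn !mxE mul0r subr0 /l subnn addn0.
rewrite /cofactor /= addnn -signr_odd odd_double mul1r.
pose w m : 'rV[R]_n := \row_(i < n) x i ^+ m.
have -> : row' ord_max (col' ord_max (\matrix_(j < n.+1) r j)) =
   (\matrix_(j < n) \sum_(kap j.+1 <= v < (kap j).+1)
       x n ^+ (kap j - v) *: w (v + (n - j.+1))%N) *m diag_mx (\row_(i < n) (x i - x n)).
  apply/matrixP => j i; rewrite mul_mx_diag !mxE !lift_max /s /c.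
  rewrite !ltnS (ltnW (ltn_ord j)) ltn_ord !mxE !lift_max.
  rewrite summxE mulr_suml.
  have := kap_dec j; rewrite /l subSS; set k := kap j; set k' := kap j.+1 => lek.
  have eN : (n.+1 - j.+2 = n - j.+1)%N by rewrite subSS.
  have -> : (k + (n.+1 - j.+1) = k.+1 + (n - j.+1))%N by have := ltn_ord j; lia.
  have -> : (k.+1 + (n - j.+1) - (k' + (n - j.+1)) = k.+1 - k')%N by lia.
  rewrite !exprD mulrA -mulrBl -geometric_interval ?leqW // !mulr_suml.
  by apply: eq_bigr => v _; rewrite !mxE exprD; ring.
rewrite det_mulmx det_diag (@det_interlace _ _ M) // mulrA mulrC.
congr (_ * _).
  by apply: eq_bigr => i _; rewrite mxE.
rewrite mulr_sumr; apply: eq_bigr => g _; rewrite mulrA [X in X * _]mulrC; congr (_ * _).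
rewrite /alternant -det_tr; congr (\det _); apply/matrixP => j i.
by rewrite !mxE nat_funE.
Qed.

Definition vdm n : R := \prod_(i < n) \prod_(j < n | (i < j)%N) (x i - x j).

Lemma vdmS n : vdm n.+1 = vdm n * \prod_(i < n) (x i - x n).
Proof.
rewrite /vdm big_ord_recr /= [X in _ * X]big1 ?mulr1 => [|j]; last first.
  by rewrite ltnNge -ltnS ltn_ord.
rewrite -big_split /=; apply: eq_bigr => i _.
by rewrite big_mkcond big_ord_recr /= ltn_ord -big_mkcond.
Qed.

Lemma sum_parts_size n M (F : intpart -> R) : (0 < M)%N ->
  (forall nu, size nu = n.+1 -> F nu = 0) ->
  \sum_(nu <- parts_in n.+1 M) F nu = \sum_(nu <- parts_in n M) F nu.
Proof.
move=> M_gt0 F0; rewrite (bigID (fun nu : intpart => size nu <= n)%N) /=.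
rewrite addrC [X in X + _ = _]big_seq_cond [X in X + _ = _]big1 ?add0r; last first.
  move=> nu; rewrite mem_parts_in // => /andP[/andP[le _] nle].
  by apply: F0; apply/eqP; rewrite eqn_leq le ltnNge.
rewrite -big_filter; apply/perm_big/uniq_perm; rewrite ?filter_uniq ?parts_in_uniq //.
move=> nu; rewrite mem_filter !mem_parts_in // andbA; congr (_ && _).
by apply: andb_idr => le; apply: leqW.
Qed.

Let P n (kap : seq nat) : R := rpp_poly 0 0 x n kap.

Lemma schur_branch n kap M : (size kap <= n.+1)%N -> (part_fun kap 0 < M)%N ->
  P n.+1 kap = \sum_(nu <- parts_in n.+1 M)
    interlace_weight n.+1 (x n) (part_fun kap) (part_fun nu) * P n nu.
Proof.
move=> sz lt; have M_gt0 : (0 < M)%N by apply: leq_trans lt.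
rewrite /P (@rpp_polyS _ _ _ _ _ n.+1 M) ?mem_parts_in ?sz //.
by apply: eq_bigr => nu _; rewrite strip_weight00 ?part_out //; apply: part_dec.
Qed.

(** Removing a horizontal strip shortens the first column by at most one box. *)
Lemma schur_vanish n kap : (n < size kap)%N -> P n kap = 0.
Proof.
elim: n kap => [|n IH] kap lt.
  rewrite /P rpp_poly0 -part_empty part_eq0 leqn0.
  by rewrite eqn0Ngt lt.
pose M := (part_fun kap 0).+1.
rewrite /P (@rpp_polyS _ _ _ _ _ (size kap) M) ?mem_parts_in ?leqnn //=.
apply: big1 => nu _; have [le|lt'] := leqP (size nu) n; last by rewrite -/(P n nu) IH ?mulr0.
rewrite strip_weight00 ?part_out //; last exact: part_dec.
rewrite (interlace_weight0 _ (i := n)) ?mul0r //; first by apply: ltnW.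
rewrite (part_out le) leqn0 part_eq0 leqNgt lt.
by [].
Qed.

(** Both sides obey the same branching rule when the last variable is removed. *)
Lemma schur_alternant n kap : (size kap <= n)%N ->
  P n kap * vdm n = alternant n (part_fun kap).
Proof.
elim: n kap => [|n IH] kap sz.
  rewrite /P rpp_poly0 -part_empty part_eq0 sz mul1r /vdm big_ord0.
  by rewrite /alternant det_mx00.
pose M := (part_fun kap 0).+1.
have ltM j : (part_fun kap j < M)%N.
  by rewrite ltnS /part_fun nth_part_le ?part_sorted.
rewrite (@alternant_branch n M) //; last exact: part_dec.
rewrite vdmS mulrA mulrC; congr (_ * _).
rewrite (schur_branch (M := M)) // (sum_parts_size (M := M)) //; last first.
  by move=> nu e; rewrite schur_vanish ?e ?mulr0.
rewrite mulr_suml sum_parts_in [RHS](bigID (@nonincr n M)) /=.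
rewrite [X in _ = _ + X]big1 ?addr0 => [|g /forallPn[i]].
  apply: eq_bigr => g gdec; rewrite -mulrA IH ?part_ofE //; last first.
    by rewrite -part_eq0 part_ofE // nat_fun_out.
  (* Here [nu] has at most [n] parts, so the last row of the strip contributes [x n ^+ kap n]. *)
  rewrite {1}/interlace_weight big_ord_recr /=; congr (_ * _ * _).
  by rewrite nat_fun_out // leq0n andbT part_out // subn0.
rewrite -ltnNge => lt.
have ltiN : (i.+1 < n)%N.
  by rewrite ltnNge; apply: contraL lt => leN; rewrite (nat_fun_out g leN).
have [h|h] := boolP (part_fun kap i.+1 <= nat_fun g i <= part_fun kap i)%N; last first.
  by rewrite (interlace_weight0 _ (ltn_ord i) h) !mul0r.
by rewrite (interlace_weight0 _ ltiN) ?mul0r //; lia.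
Qed.

End Alternants.

(* Tableau sums in infinitely many variables *)
From mathcomp Require Import finmap classical_sets functions fsbigop mpoly.

Definition mvar {K : comNzRingType} n (i : nat) : {mpoly K[n]} :=
  if insub i is Some j then 'X_j else 0.

Definition monom_of n (m : monom) : 'X_{1..n} := [multinom m i | i < n].

Lemma mvarE {K : comNzRingType} n (i : 'I_n) : mvar n i = 'X_i :> {mpoly K[n]}.
Proof. by rewrite /mvar valK. Qed.

Lemma nvars_out (m : monom) i : (nvars m <= i)%N -> m i = 0%N.
Proof.
move=> le; apply: fsfun_dflt; apply: contraTN le => im; rewrite -ltnNge.
by rewrite /nvars; apply: (@bigmaxn_sup_seq _ (enum_fset (finsupp m)) i).
Qed.

Section RbtSum.
Context {la : seq nat} (la_sorted : sorted geq la).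

Lemma border_neq0 (T : {ffun box la -> nat}) c : border T (T c) != finset.set0.
Proof.
have [d] := arg_minnP (P := fun d => T d == T c)
   (fun d => box_row d + box_col d)%N (eqxx (T c)).
move=> /eqP Td dmin; apply/set0Pn; exists d; rewrite !inE Td eqxx /=.
apply/existsPn => e; rewrite !inE; apply/negP => /and4P[/eqP Te _ rlt clt].
by have := dmin e; rewrite Te eqxx => /(_ isT); lia.
Qed.

Lemma rbt_monomE (T : hooked_filling la) i : is_rbt T ->
  rbt_monom T i = #|hooks_at T i|.
Proof.
move=> [_ _ Tpart _ _]; rewrite fsfunE; case: ifP => // /negbT ni.
have /and3P[/eqP cov _ n0] := Tpart i; apply/esym/eqP; rewrite cards_eq0 -finset.subset0.
apply/fintype.subsetP => B BT; case/negP: n0; suff -> : finset.set0 = B by [].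
apply/esym/eqP; rewrite -finset.subset0; apply/fintype.subsetP => c cB; case/negP: ni.
have : c \in finset.cover (hooks_at T i) by apply/finset.bigcupP; exists B.
rewrite cov !inE => /andP[/eqP Tc _]; apply/imfsetP; exists c => //=.
Qed.

Lemma rbt_monom_gt0 (T : hooked_filling la) c : is_rbt T ->
  (0 < rbt_monom T (T.1 c))%N.
Proof.
move=> Trbt; have [_ _ Tpart _ _] := Trbt; rewrite rbt_monomE // card_gt0.
have /and3P[/eqP cov _ _] := Tpart (T.1 c).
apply: contraNneq (border_neq0 T.1 c) => h0; rewrite -cov h0.
by apply/eqP/setP => d; rewrite inE; apply/finset.bigcupP => -[B]; rewrite inE.
Qed.

(** Every entry of [T] occurs in its monomial, because a nonempty level has a nonempty border. So
    tableaux with monomial [m] have entries below [n], and finitely many fillings account for the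
    coefficient. *)
Lemma rbt_sumE (K : comNzRingType) (a b : K) (m : monom) n : (nvars m <= n)%N ->
  rbt_sum a b la m = (rpp_poly a%:MP b%:MP (@mvar K n) n la)@_(monom_of n m).
Proof.
move=> len; rewrite /rbt_sum.
pose F (p : {ffun box la -> 'I_n} * {set {set box la}}) : hooked_filling la :=
  (nat_filling p.1, p.2).
have F_inj : injective F.
  move=> [T Q] [T' Q'] [/ffunP e ->]; congr (_, _); apply/ffunP => c.
  by apply/val_inj; have := e c; rewrite !ffunE.
pose r := [seq T <- [seq F p | p in predT] | `[< is_rbt T >] ].
rewrite (fsbigE r); last first.
- move=> T Trbt nr; have [e|] := eqVneq; last by rewrite mulr0.
  case/negP: nr; rewrite mem_filter; apply/andP; split; first exact/asboolP.
  have lt c : (T.1 c < n)%N.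
    rewrite ltnNge; apply/negP => le.
    have := rbt_monom_gt0 c Trbt; rewrite e nvars_out //.
    exact: leq_trans le.
  apply/fintype.imageP; exists ([ffun c => Ordinal (lt c)], T.2) => //.
  case: T Trbt e lt => [T Q] /= *; congr (_, _).
  by apply/ffunP => c; rewrite !ffunE.
- by move=> T /=; rewrite mem_filter => /andP[/asboolP].
- by rewrite filter_uniq // map_inj_uniq // enum_uniq.
rewrite big_filter_cond (eq_bigl (fun T => `[< is_rbt T >])); last first.
  move=> T; case: asboolP => //= h; exact/mem_set.
rewrite big_image_cond /=.
rewrite -(pair_big_dep xpredT (fun T Q => `[< is_rbt (nat_filling T, Q) >])
   (fun T Q => weight a b (nat_filling T, Q) * (rbt_monom (nat_filling T, Q) == m)%:R)) /=.
rewrite /rpp_poly raddf_sum /= [RHS]big_mkcond /=; apply: eq_bigr => T _.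
case: asboolP => [Trpp|Trpp]; last first.
  by rewrite big1 // => Q /asboolP[].
rewrite -(@hooks_sum _ la_sorted _ Trpp _ _ _ _ n); last first.
  by move=> c; rewrite ffunE.
rewrite raddf_sum /=; apply: eq_bigr => Q /asboolP QT.
have -> : \prod_(i < n) mvar n i ^+ #|hooks_at (nat_filling T, Q) i| =
    'X_[monom_of n (rbt_monom (nat_filling T, Q))] :> {mpoly K[n]}.
  rewrite mpolyXE_id; apply: eq_bigr => i _.
  by rewrite mvarE mnmE rbt_monomE.
have -> : weight a%:MP b%:MP (nat_filling T, Q) =
   (weight a b (nat_filling T, Q))%:MP :> {mpoly K[n]}.
  by rewrite /weight !rmorphM !rmorphXn rmorphD.
rewrite mcoeffCM mcoeffX; congr (_ * (nat_of_bool _)%:R); apply/eqP/eqP => [->//|e].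
apply/fsfunP => i; have [lti|gei] := ltnP i n.
  by have /mnmP/(_ (Ordinal lti)) := e; rewrite !mnmE.
rewrite (nvars_out (leq_trans len gei)) fsfunE ifF //.
apply/negbTE/imfsetP => -[c _ ei]; move: gei.
by rewrite ei ffunE leqNgt ltn_ord.
Qed.
End RbtSum.

(** * Power series *)

Section FpsTheory.
Context {n : nat} {K : comNzRingType}.
Implicit Types (f g h : fps n K) (p q : {mpoly K[n]}) (m : 'X_{1..n}).

Lemma fps_of_zmod : zmod_morphism (@fps_of n K).
Proof. by move=> p q; apply: fpsP => m; rewrite /= mcoeffB. Qed.

Lemma fps_of_monoid : monoid_morphism (@fps_of n K).
Proof.
split=> // p q; apply: fpsP => m; rewrite [RHS](fps_mulE _ _ (ltnSn _)) /=.
by apply: (@eq_mcoeffM _ _ (mdeg m).+1) => // k kd; rewrite fps_truncE.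
Qed.

HB.instance Definition _ := GRing.isZmodMorphism.Build _ _ (@fps_of n K) fps_of_zmod.
HB.instance Definition _ := GRing.isMonoidMorphism.Build _ _ (@fps_of n K) fps_of_monoid.

Lemma fps_coef0 m : (0 : fps n K) m = 0.
Proof. exact: mcoeff0. Qed.

Lemma fps_coef_sum (I : Type) (r : seq I) (P : pred I) (F : I -> fps n K) m :
  (\sum_(i <- r | P i) F i) m = \sum_(i <- r | P i) F i m.
Proof. by apply: (big_morph (fun f : fps n K => f m)) => //; apply: fps_coef0. Qed.

Lemma fps_coef_sign (b : bool) f m : ((-1) ^+ b * f) m = (-1) ^+ b * f m.
Proof. by case: b; rewrite ?expr1 ?expr0 ?mulN1r ?mul1r. Qed.

Lemma fps_coefC c f m : (fps_of c%:MP * f) m = c * f m.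
Proof.
rewrite [LHS](fps_mulE _ _ (ltnSn _)).
rewrite (@eq_mcoeffM _ _ (mdeg m).+1 _ c%:MP _ (fps_trunc (mdeg m).+1 f)) //.
  by rewrite mcoeffCM fps_truncE.
by move=> k kd; rewrite fps_truncE.
Qed.

Lemma fps_mulXS i f m : (fps_of 'X_i * f) (m + U_(i))%MM = f m.
Proof.
rewrite [LHS](fps_mulE _ _ (ltnSn _)).
rewrite (@eq_mcoeffM _ _ (mdeg (m + U_(i))%MM).+1 _ 'X_i _
  (fps_trunc (mdeg (m + U_(i))%MM).+1 f)) //.
  by rewrite mulrC addmC mcoeffMX fps_truncE // mdegD ltnS leq_addl.
by move=> k kd; rewrite fps_truncE.
Qed.

Lemma fps_mulX0 i f m : m i = 0%N -> (fps_of 'X_i * f) m = 0.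
Proof.
move=> mi; rewrite /GRing.mul /= big1 // => -[k1 k2] /= /eqP e.
rewrite mcoeffX; case: eqP => [k1E|_]; last by rewrite mul0r.
have := congr1 (fun k : 'X_{1..n} => k i) e.
by rewrite mi mnmDE -k1E mnm1E eqxx.
Qed.

Definition regular g := forall f, f * g = 0 -> f = 0.

Lemma regularM g h : regular g -> regular h -> regular (g * h).
Proof. by move=> rg rh f; rewrite mulrA => /rh/rg. Qed.

Lemma regular1 : regular 1.
Proof. by move=> f; rewrite mulr1. Qed.

Lemma regular_prod (I : Type) (r : seq I) (P : pred I) (F : I -> fps n K) :
  (forall i, P i -> regular (F i)) -> regular (\prod_(i <- r | P i) F i).
Proof. by move=> h; apply: big_ind => //; [exact: regular1 | exact: regularM]. Qed.

(** If x_i f = x_j f, the coefficient of f is unchanged when one unit of exponent moves from j to i.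
    Once the exponent of x_j is 0, the right-hand side has coefficient 0. *)
Lemma regular_subX i j : i != j -> regular (fps_of ('X_i - 'X_j)).
Proof.
move=> nij f e; apply: fpsP => m; rewrite [RHS]fps_coef0.
have eX k : (fps_of 'X_i * f) k = (fps_of 'X_j * f) k.
  apply/eqP; rewrite -subr_eq0; apply/eqP.
  have : (fps_of ('X_i - 'X_j) * f) k = 0 by rewrite mulrC e fps_coef0.
  by rewrite rmorphB mulrBl.
have [l] := ubnP (m j); elim: l m => // l IH m lt.
rewrite -(fps_mulXS i) eX; have [mj0|mj] := posnP (m j).
  by rewrite fps_mulX0 // mnmDE mnm1E (negPf nij) mj0.
have -> : (m + U_(i) = (m + U_(i) - U_(j)) + U_(j))%MM.
  rewrite submK //; apply/mnm_lepP => k; rewrite mnmDE !mnm1E.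
  by case: eqP => // <-; rewrite ltn_addr.
rewrite fps_mulXS IH // mnmBE mnmDE !mnm1E (negPf nij) eqxx addn0.
by rewrite subn1 -ltnS prednK.
Qed.

Lemma regular_vandermonde : regular (@vandermonde n K).
Proof.
rewrite /vandermonde rmorph_prod; apply: regular_prod => i _.
rewrite rmorph_prod; apply: regular_prod => j ltij; apply: regular_subX.
by rewrite -val_eqE /= ltn_eqF.
Qed.

Lemma regular_inj g f h : regular g -> f * g = h * g -> f = h.
Proof.
move=> rg e; apply/eqP; rewrite -subr_eq0; apply/eqP/rg.
by rewrite mulrBl e subrr.
Qed.

Lemma fps_divE f g h : regular g -> h * g = f -> fps_div f g = h.
Proof.
move=> rg e; apply: xget_unique => //= h' e'.
by apply: (regular_inj rg); rewrite e e'.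
Qed.

(** The series in the single variable x_i with coefficient sequence [u]. *)
Definition univ (i : 'I_n) (u : nat -> K) : fps n K :=
  Fps (fun m => if m == (U_(i) *+ m i)%MM then u (m i) else 0).

Lemma univ_shift i u : fps_of 'X_i * univ i u = univ i (shift u).
Proof.
apply: fpsP => m; have [mi|mi] := posnP (m i).
  by rewrite fps_mulX0 //= mi; case: ifP.
have e : (m = (m - U_(i)) + U_(i))%MM.
  by rewrite submK //; apply/mnm_lepP => k; rewrite mnm1E; case: eqP => // <-.
rewrite e fps_mulXS /= mnmDE mnm1E eqxx addn1 /=.
set m' := (m - U_(i))%MM; rewrite (_ : ((m' + U_(i))%MM == _) = (m' == (U_(i) *+ m' i)%MM)) //.
by rewrite mulmSr eqm_add2r.
Qed.

Lemma univ_linfac i b u : fps_of (1 + b *: 'X_i) * univ i u = univ i (linfac b u).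
Proof.
rewrite rmorphD rmorph1 -mul_mpolyC rmorphM mulrDl mul1r -mulrA univ_shift.
apply: fpsP => m.
transitivity (univ i u m + (fps_of b%:MP * univ i (shift u)) m) => //.
by rewrite fps_coefC /=; case: ifP => //; rewrite mulr0 addr0.
Qed.

Lemma univ_unit i : univ i (fun k => (k == 0%N)%:R) = 1.
Proof.
apply: fpsP => m; rewrite /= mcoeff1; case: eqP => [->|/eqP ne].
  rewrite mulmnE mnm1E eqxx mul1n.
  case: (posnP (m i)) => [->|h]; first by rewrite mulm0n !eqxx.
  case: eqP => // /mnmP/(_ i).
  by rewrite mulmnE mnm1E eqxx mul1n mnm0E => e; rewrite e in h.
case: eqP => // m0; case/eqP: ne; rewrite m0 mnm0E mulm0n //.
Qed.

Lemma univ_iter_shift i l u : fps_of 'X_i ^+ l * univ i u = univ i (iter l shift u).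
Proof. by elim: l => [|l IH]; rewrite ?mul1r // exprS -mulrA IH univ_shift. Qed.

Lemma univ_iter_linfac i b l u :
  fps_of (1 + b *: 'X_i) ^+ l * univ i u = univ i (iter l (linfac b) u).
Proof. by elim: l => [|l IH]; rewrite ?mul1r // exprS -mulrA IH univ_linfac. Qed.

Lemma linfac_geom_inv a (u : nat -> K) : linfac (- a) (geom a u) = u.
Proof. by apply/funext => m; rewrite /linfac [in LHS]geomE mulNr addrK. Qed.

(** The iterated geometric series is an inverse. *)
Lemma regular_geom i a l : regular (fps_of ((1 - a *: 'X_i) ^+ l)).
Proof.
move=> f e; rewrite -[f]mulr1 -(univ_unit i).
have -> : univ i (fun k => (k == 0%N)%:R) =
   fps_of ((1 - a *: 'X_i) ^+ l) * univ i (iter l (geom a) (fun k => (k == 0%N)%:R)).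
  rewrite rmorphXn -scaleNr univ_iter_linfac; congr univ.
  elim: l {e} => // l IH; rewrite iterSr /= linfac_geom_inv.
  exact: IH.
by rewrite mulrA e mul0r.
Qed.

(** Each variable occurs in one factor only, so a single choice of terms contributes. Truncation at
    [d] makes the distribution finite. *)
Lemma univ_prod (v : 'I_n -> nat -> K) m :
  (\prod_(i < n) univ i (v i)) m = \prod_(i < n) v i (m i).
Proof.
pose d := (mdeg m).+1.
pose p i : {mpoly K[n]} := \sum_(l < d) v i l *: 'X_i ^+ l.
have pE i k : (mdeg k < d)%N -> univ i (v i) k = (p i)@_k.
  move=> kd; have lt : (k i < d)%N.
    by apply: leq_ltn_trans kd; rewrite mdegE (bigD1 i) //= leq_addr.
  rewrite /p raddf_sum (bigD1 (Ordinal lt)) //= mcoeffZ mcoeffXn big1 ?addr0.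
    by rewrite eq_sym; case: eqP; rewrite ?mulr1 ?mulr0.
  move=> l nl; rewrite mcoeffZ mcoeffXn; case: eqP => [e|]; last by rewrite mulr0.
  case/eqP: nl; apply/val_inj; rewrite /= -e mulmnE mnm1E eqxx mul1n.
  by [].
have prodE k : (mdeg k < d)%N ->
    (\prod_(i < n) univ i (v i)) k = (\prod_(i < n) p i)@_k.
  elim/big_rec2: _ k => [//|i P F _ IH] k kd.
  rewrite [LHS](fps_mulE _ _ kd); apply: (@eq_mcoeffM _ _ d) => // k' kd'.
    by rewrite fps_truncE // pE.
  by rewrite fps_truncE // IH.
rewrite prodE // bigA_distr_bigA /= raddf_sum /=.
have lt i : (m i < d)%N by rewrite ltnS mdegE (bigD1 i) //= leq_addr.
have termE (f : {ffun 'I_n -> 'I_d}) :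
    (\prod_(i < n) (v i (f i) *: 'X_i ^+ f i : {mpoly K[n]}))@_m =
    (\prod_(i < n) v i (f i)) * ([multinom (f i : nat) | i < n] == m)%:R.
  rewrite scaler_prod mcoeffZ -mcoeffX mpolyXE_id; congr (_ * _@__).
  by apply: eq_bigr => i _; rewrite mnmE.
pose f0 := [ffun i => Ordinal (lt i)].
transitivity (\sum_(f : {ffun 'I_n -> 'I_d}) (\prod_(i < n) v i (f i)) *
   ([multinom (f i : nat) | i < n] == m)%:R : K).
  by apply: eq_bigr => f _; rewrite termE.
rewrite (bigD1 f0) //= [X in _ + X]big1 ?addr0 => [|f nf].
  rewrite (_ : [multinom _ | _ < n] = m); last by apply/mnmP => i; rewrite mnmE ffunE.
  by rewrite eqxx mulr1; apply: eq_bigr => i _; rewrite ffunE.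
case: eqP => [e|]; last by rewrite mulr0.
case/eqP: nf; apply/ffunP => i; apply/val_inj; rewrite ffunE /= -e mnmE.
by [].
Qed.

Lemma det_univ (u : 'I_n -> nat -> K) m :
  (\det (\matrix_(i < n, j < n) univ i (u j))) m =
  \det (\matrix_(i < n, j < n) u j (m i)).
Proof.
rewrite /determinant fps_coef_sum; apply: eq_bigr => s _.
rewrite fps_coef_sign; congr (_ * _).
rewrite (eq_bigr (fun i => univ i (u (s i)))) => [|i _]; last by rewrite mxE.
by rewrite univ_prod; apply: eq_bigr => i _; rewrite mxE.
Qed.

End FpsTheory.

(** * Alternating series and Schur expansions in finitely many variables *)

Section SchurSeries.
Context {n : nat} {K : comNzRingType}.
Implicit Types (f g h : fps n K) (m : 'X_{1..n}) (kap nu mu : intpart).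

Definition stair (kap : nat -> nat) : 'X_{1..n} :=
  [multinom (kap i + (n - i.+1))%N | i < n].

Definition mperm m (s : 'S_n) : 'X_{1..n} := [multinom m (s i) | i < n].

(** Over a general ring the sign rule only gives x = -x at repeated exponents, so vanishing there is
    a separate condition. *)
Definition alternating (A : fps n K) : Prop :=
  (forall (s : 'S_n) m, A (mperm m s) = (-1) ^+ s * A m) /\
  (forall (i j : 'I_n) m, i != j -> m i = m j -> A m = 0).

(** The coefficient at [m] of the alternant of [kap]; see [fps_of_alternant]. *)
Definition alt_coef kap m : K :=
  \det (\matrix_(i < n, j < n) (m i == stair (part_fun kap) j)%:R).

Lemma stair_inj (s : 'S_n) kap nu : (size kap <= n)%N -> (size nu <= n)%N ->
  (forall i, stair (part_fun kap) i = stair (part_fun nu) (s i)) ->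
  s = 1%g /\ kap = nu.
Proof.
move=> szk szn h.
have s1 : s = 1%g.
  apply: (perm_decreasing (staircase_lt (@part_dec kap)) (staircase_lt (@part_dec nu))).
  by move=> i; have := h i; rewrite !mnmE; exact.
split=> //; apply: part_fun_inj => i; have [lti|gei] := ltnP i n.
  by have := h (Ordinal lti); rewrite !mnmE s1 perm1 /= => /addIn.
by rewrite !part_out ?(leq_trans _ gei).
Qed.

Lemma stair_injective kap : injective (stair (part_fun kap)).
Proof.
have lt (i j : 'I_n) : (i < j)%N -> (stair (part_fun kap) j < stair (part_fun kap) i)%N.
  move=> ij; rewrite !mnmE; apply: (staircase_lt (N := n) (@part_dec kap)).
  by rewrite ij ltn_ord.
move=> i j e; apply/val_inj => /=; case: (ltngtP i j) => // /lt; rewrite e ltnn //.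
Qed.

Lemma alt_coef_stair kap nu : (size kap <= n)%N -> (size nu <= n)%N ->
  alt_coef kap (stair (part_fun nu)) = (kap == nu)%:R.
Proof.
move=> szk szn; have [<-|ne] := eqVneq kap nu.
  rewrite /alt_coef (_ : \matrix_(i, j) _ = 1%:M) ?det1 //.
  by apply/matrixP => i j; rewrite !mxE (inj_eq (@stair_injective kap)).
rewrite /alt_coef /determinant big1 // => s _.
have [/forallP h|/forallPn[i ni]] :=
    boolP [forall i, stair (part_fun nu) i == stair (part_fun kap) (s i)].
  have [|_ e] := @stair_inj s nu kap szn szk; first by move=> i; apply/eqP.
  by rewrite e eqxx in ne.
by rewrite (bigD1 i) //= mxE (negPf ni) mul0r mulr0.
Qed.

Lemma alt_coef_perm kap m (s : 'S_n) :
  alt_coef kap (mperm m s) = (-1) ^+ s * alt_coef kap m.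
Proof.
rewrite /alt_coef -det_perm -det_mulmx; congr (\det _).
by rewrite -row_permE; apply/matrixP => i j; rewrite !mxE mnmE.
Qed.

Lemma alt_coef0 kap m (i j : 'I_n) : i != j -> m i = m j -> alt_coef kap m = 0.
Proof.
by move=> ne e; apply: (determinant_alternate ne) => k; rewrite !mxE e.
Qed.

Lemma det_alternating (u : 'I_n -> nat -> K) (A : fps n K) :
  (forall m, A m = \det (\matrix_(i < n, j < n) u j (m i))) -> alternating A.
Proof.
move=> AE; split=> [s m|i j m ne e]; rewrite !AE; last first.
  by apply: (determinant_alternate ne) => k; rewrite !mxE e.
rewrite -det_perm -det_mulmx; congr (\det _).
by rewrite -row_permE; apply/matrixP => i j; rewrite !mxE mnmE.
Qed.

(** Distinct exponents sorted decreasingly dominate the staircase n-1, ..., 0, and the differences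
    are the parts of [kap]. *)
Lemma sort_exponent m : injective m -> exists (kap : intpart) (s : 'S_n),
  [/\ (size kap <= n)%N, (part_fun kap 0 <= mdeg m)%N & mperm (stair (part_fun kap)) s = m].
Proof.
move=> m_inj; pose t := sort_tuple geq [tuple m i | i < n].
have tr : transitive geq by move=> x y z /= xy zx; apply: leq_trans xy.
have tot : total geq by move=> x y; apply: leq_total.
have t_srt : sorted geq t by apply: sort_sorted.
have pt : perm_eq t [tuple m i | i < n] by rewrite /= perm_sort.
have [p tE] := tuple_permP pt.
have t_uniq : uniq t.
  rewrite (perm_uniq pt) /= map_inj_uniq ?enum_uniq //.
have tp i : tnth t i = m (p i).
  have := congr1 (fun s => nth 0%N s i) tE.
  rewrite -tnth_nth => ->; rewrite (nth_map i) ?size_enum_ord //.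
  by rewrite nth_ord_enum tnth_mktuple.
have t_lt i j : (i < j < n)%N -> (nth 0%N t j < nth 0%N t i)%N.
  move=> /andP[ij jn]; rewrite ltn_neqAle.
  rewrite nth_uniq ?size_tuple ?gtn_eqF //=; last exact: ltn_trans ij jn.
  have rf : reflexive geq by move=> x; apply: leqnn.
  apply: (sorted_leq_nth tr rf 0%N t_srt); rewrite ?inE ?size_tuple //; last exact: ltnW.
  exact: ltn_trans ij jn.
have t_ge i : (i < n)%N -> (n - i.+1 <= nth 0%N t i)%N.
  have [k] := ubnP (n - i)%N; elim: k i => // k IH i ltk lti.
  have [lti1|ge] := ltnP i.+1 n; last by lia.
  have := IH i.+1; have := t_lt i i.+1; rewrite ltnSn lti1 => /(_ isT).
  lia.
pose f i := if (i < n)%N then (nth 0%N t i - (n - i.+1))%N else 0%N.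
have f_dec i : (f i.+1 <= f i)%N.
  rewrite /f; case: (ltnP i.+1 n) => // lti; rewrite (ltnW lti).
  by have := t_lt i i.+1; rewrite ltnSn lti => /(_ isT); lia.
have f_le i : (f i <= mdeg m)%N.
  rewrite /f; case: ltnP => // lti; apply: leq_trans (leq_subr _ _) _.
  have -> : nth 0%N t i = m (p (Ordinal lti)) by rewrite -tp (tnth_nth 0%N).
  by rewrite mdegE (bigD1 (p (Ordinal lti))) //= leq_addr.
have [||g gE] := @ffun_of_fun n (mdeg m).+1 f.
- by move=> i; rewrite ltnS.
- by move=> i le; rewrite /f ltnNge le.
have gdec : nonincr g by apply/forallP => i; rewrite gE.
have kE : part_fun (part_of g) = f by rewrite part_ofE.
exists (part_of g), (p^-1)%g; split.
- by rewrite -part_eq0 kE /f ltnn.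
- by rewrite kE.
apply/mnmP => i; rewrite !mnmE kE /f ltn_ord subnK ?t_ge //.
by rewrite -tnth_nth tp permKV.
Qed.

(** Both sides vanish at repeated exponents. Any other exponent is a permuted [stair], where a
    single alternant has a nonzero coefficient. *)
Lemma alternating_expand (A : fps n K) m d : alternating A -> (mdeg m < d)%N ->
  A m = \sum_(kap <- parts_in n d) A (stair (part_fun kap)) * alt_coef kap m.
Proof.
move=> [A_perm A0] ltd.
have d_gt0 : (0 < d)%N by apply: leq_ltn_trans ltd.
have [/injectiveP m_inj|/injectivePn[i [j ne e]]] := boolP (injectiveb m); last first.
  by rewrite (A0 i j) // big1 // => kap _; rewrite (alt_coef0 kap ne e) mulr0.
have [kap [s [szk lek <-]]] := sort_exponent m_inj.
rewrite A_perm (bigD1_seq kap) ?parts_in_uniq ?mem_parts_in ?szk //=; last first.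
  exact: leq_ltn_trans ltd.
rewrite alt_coef_perm alt_coef_stair // eqxx mulr1 mulrC big_seq_cond big1 ?addr0 //.
move=> nu; rewrite mem_parts_in // => /andP[/andP[szn _] /negPf ne].
by rewrite alt_coef_perm alt_coef_stair // ne !mulr0.
Qed.

Definition schur_poly kap : {mpoly K[n]} := rpp_poly 0 0 (@mvar K n) n kap.

Lemma fps_of_alternant kap :
  fps_of (alternant (@mvar K n) n (part_fun kap)) =
  Fps (alt_coef kap).
Proof.
apply: fpsP => m; rewrite /alternant.
transitivity ((\det (\matrix_(i < n, j < n)
   univ i (fun k => (k == stair (part_fun kap) j)%:R : K))) m); last by rewrite det_univ.
congr (fps_coef _ m); rewrite -det_map_mx; congr (\det _).
apply/matrixP => i j; rewrite !mxE mvarE; apply: fpsP => k.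
rewrite /= mcoeffXn; case: eqP => [e|ne].
  by rewrite -e mulmnE mnm1E eqxx mul1n mnmE eqxx eqxx.
case: eqP => // e; case: eqP => // e2; case: ne.
by rewrite e e2 mnmE.
Qed.

Lemma vdm_vandermonde : fps_of (vdm (@mvar K n) n) = @vandermonde n K.
Proof.
rewrite /vandermonde /vdm; congr fps_of; apply: eq_bigr => i _.
by apply: eq_bigr => j _; rewrite !mvarE.
Qed.

Lemma schur_poly_vandermonde kap : (size kap <= n)%N ->
  fps_of (schur_poly kap) * vandermonde = Fps (alt_coef kap).
Proof.
move=> sz; rewrite -vdm_vandermonde -rmorphM /= schur_alternant //.
exact: fps_of_alternant.
Qed.

Lemma schur_poly_homog kap m : (schur_poly kap)@_m != 0 -> mdeg m = sumn kap.
Proof.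
move=> nz; apply/eqP; apply: contraNT nz => ne; apply/eqP.
rewrite /schur_poly /rpp_poly raddf_sum big1 // => T _.
have h : \prod_c box_weight 0 0 (@mvar K n) (nat_filling T) c \is (sumn kap).-homog.
  have -> : sumn kap = (\sum_(c : box kap) 1)%N.
    transitivity (\sum_(i < size kap) \sum_(j < nth 0 kap i) 1)%N.
      rewrite sumnE (big_nth 0%N) big_mkord; apply: eq_bigr => i _.
      by rewrite sum1_card card_ord.
    by rewrite sig_big_dep.
  apply: (big_ind2 (fun (p : {mpoly K[n]}) d => p \is d.-homog)).
  - exact: dhomog1.
  - by move=> p d q e hp hq; apply: dhomogM.
  move=> c _; rewrite /box_weight ffunE mvarE.
  case: ifP => _; first by rewrite addr0 dhomog0.
  case: ifP => _; first exact: dhomog0.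
  by case: ifP => _; rewrite ?add0r dhomogX /= mdeg1.
exact: (dhomog_nemf_coeff h ne).
Qed.

(** The possibly infinite sum of c_kap s_kap: by homogeneity, parts up to [mdeg m] suffice for the
    coefficient at [m]. *)
Definition schur_comb (c : intpart -> K) : fps n K :=
  Fps (fun m => \sum_(kap <- parts_in n (mdeg m).+1) c kap * (schur_poly kap)@_m).

Lemma part0_le_sumn kap : (part_fun kap 0 <= sumn kap)%N.
Proof. by rewrite /part_fun; case: (kap : seq nat) => //= k s; rewrite leq_addr. Qed.

Lemma schur_combE (c : intpart -> K) m d : (mdeg m < d)%N ->
  schur_comb c m = \sum_(kap <- parts_in n d) c kap * (schur_poly kap)@_m.
Proof.
move=> ltd; have d_gt0 : (0 < d)%N by apply: leq_ltn_trans ltd.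
rewrite [RHS](bigID (fun kap : intpart => part_fun kap 0 <= mdeg m)%N) /=.
rewrite [X in _ = _ + X]big1 ?addr0 => [|kap nle]; last first.
  have [e|] := eqVneq ((schur_poly kap)@_m) 0; first by rewrite e mulr0.
  by move=> /schur_poly_homog e; rewrite e part0_le_sumn in nle.
rewrite -[RHS]big_filter; apply/perm_big/uniq_perm; rewrite ?filter_uniq ?parts_in_uniq //.
move=> kap; rewrite mem_filter !mem_parts_in // ltnS andbC; apply/andP/and3P => -[] //.
  by move=> le sz; split => //; apply: leq_ltn_trans ltd.
Qed.

Lemma schur_comb_vandermonde (c : intpart -> K) m d : (mdeg m < d)%N ->
  (schur_comb c * vandermonde) m = \sum_(kap <- parts_in n d) c kap * alt_coef kap m.
Proof.
move=> ltd; have d_gt0 : (0 < d)%N by apply: leq_ltn_trans ltd.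
pose p := \sum_(kap <- parts_in n d) c kap *: schur_poly kap.
transitivity ((fps_of p * vandermonde) m).
  rewrite !(fps_mulE _ _ ltd); apply: (@eq_mcoeffM _ _ d) => // k kd.
  rewrite !fps_truncE // (schur_combE c kd) /= raddf_sum /=.
  by apply: eq_bigr => kap _; rewrite mcoeffZ.
rewrite rmorph_sum mulr_suml fps_coef_sum !big_seq; apply: eq_bigr => kap.
rewrite mem_parts_in // => /andP[sz _].
by rewrite -mul_mpolyC rmorphM -mulrA schur_poly_vandermonde // fps_coefC.
Qed.

(** Multiplying by the Vandermonde product turns Schur polynomials into alternants, and the
    coefficient at [stair kap] isolates [c kap]. *)
Lemma schur_comb_uniq (c c' : intpart -> K) kap : (size kap <= n)%N ->
  schur_comb c = schur_comb c' -> c kap = c' kap.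
Proof.
move=> sz e; pose m := stair (part_fun kap).
pose d := (maxn (mdeg m) (part_fun kap 0)).+1.
have ltd : (mdeg m < d)%N by rewrite ltnS leq_maxl.
have ex c1 : (schur_comb c1 * vandermonde) m = c1 kap.
  rewrite (schur_comb_vandermonde c1 ltd).
  rewrite (bigD1_seq kap) ?parts_in_uniq ?mem_parts_in ?sz ?ltnS ?leq_maxr //=.
  rewrite alt_coef_stair // eqxx mulr1 big_seq_cond big1 ?addr0 //.
  move=> nu; rewrite mem_parts_in // => /andP[/andP[szn _] /negPf ne].
  by rewrite alt_coef_stair // ne mulr0.
by rewrite -ex e ex.
Qed.

Lemma schur_comb_expand (f A : fps n K) : alternating A -> f * vandermonde = A ->
  f = schur_comb (fun kap => A (stair (part_fun kap))).
Proof.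
move=> alt e; apply: (regular_inj regular_vandermonde); rewrite e; apply: fpsP => m.
by rewrite (schur_comb_vandermonde _ (ltnSn _)) -alternating_expand.
Qed.

Lemma bialternant_comb (u : 'I_n -> nat -> K) (E : 'I_n -> 'I_n -> fps n K) :
  (forall i j, E i j = univ i (u j)) ->
  bialternant E = schur_comb (fun kap =>
     \det (\matrix_(i < n, j < n) u j (stair (part_fun kap) i))).
Proof.
move=> EE; set c := fun kap => _; apply: fps_divE; first exact: regular_vandermonde.
set A := \det _.
have AE m : A m = \det (\matrix_(i < n, j < n) u j (m i)).
  by rewrite -det_univ /A; congr (fps_coef (\det _) m); apply/matrixP => i j; rewrite !mxE EE.
apply: fpsP => m; rewrite (schur_comb_vandermonde c (ltnSn _)).
rewrite [RHS](alternating_expand (det_alternating AE) (ltnSn _)).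
by apply: eq_bigr => kap _; rewrite AE.
Qed.

End SchurSeries.

(** * Expansions in Schur functions and duality *)

Section Expansions.
Context {K : comNzRingType}.
Implicit Types (m : monom) (kap mu nu : intpart) (c : intpart -> K) (f : series K).

Lemma schur_finE n kap : (size kap <= n)%N ->
  schur_fin kap n = fps_of (schur_poly kap) :> fps n K.
Proof.
move=> sz; apply: fps_divE; first exact: regular_vandermonde.
rewrite schur_poly_vandermonde // -fps_of_alternant /alternant -det_map_mx.
by congr (\det _); apply/matrixP => i j; rewrite !mxE mvarE.
Qed.

Lemma schur_poly_rbt kap m n : (nvars m <= n)%N ->
  (schur_poly kap : {mpoly K[n]})@_(monom_of n m) = rbt_sum 0 0 kap m.
Proof.
by move=> le; rewrite (rbt_sumE (part_sorted kap) _ _ le) mpolyC0.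
Qed.

Lemma schurE kap m : schur kap m = rbt_sum 0 0 kap m :> K.
Proof.
rewrite /schur /stable_limit /= schur_finE ?leq_maxl //=.
exact/schur_poly_rbt/leq_maxr.
Qed.

Lemma sum_schur c m n : (nvars m <= n)%N ->
  \sum_(mu \in [set: intpart]) c mu * schur mu m = schur_comb c (monom_of n m).
Proof.
move=> le; pose d := (mdeg (monom_of n m)).+1.
have out_zero mu : mu \notin parts_in n d -> c mu * schur mu m = 0.
  rewrite mem_parts_in // schurE -(schur_poly_rbt _ le) negb_and => out.
  have [sz|sz] := leqP (size mu) n; last first.
    by rewrite /schur_poly (schur_vanish _ sz) mcoeff0 mulr0.
  rewrite sz /= ltnS -ltnNge in out.
  have [->|] := eqVneq ((schur_poly mu)@_(monom_of n m)) (0 : K); first by rewrite mulr0.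
  by move=> /schur_poly_homog e; rewrite e ltnNge part0_le_sumn in out.
rewrite (fsbigE (parts_in n d)) ?parts_in_uniq //; last by move=> mu _; apply: out_zero.
apply: eq_big => [mu|mu _]; first by rewrite in_setT.
by rewrite schurE -(schur_poly_rbt _ le).
Qed.

Definition monom_ext n (k : 'X_{1..n}) : monom :=
  [fsfun i in [fset val j | j : 'I_n]%fset =>
     if insub i is Some j then k j else 0%N].

Lemma monom_extE n (k : 'X_{1..n}) i :
  monom_ext k i = if insub i is Some j then k j else 0%N.
Proof.
rewrite fsfunE; case: ifP => // /negbT ni; case: insubP => // j _ ij.
by case/negP: ni; apply/imfsetP; exists j.
Qed.

Lemma nvars_le m n : (forall i, (n <= i)%N -> m i = 0%N) -> (nvars m <= n)%N.
Proof.
move=> h; apply/bigmax_leqP_seq => i im _; rewrite ltnNge; apply/negP => /h e.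
by move: im; rewrite mem_finsupp e.
Qed.

Lemma nvars_ext n (k : 'X_{1..n}) : (nvars (monom_ext k) <= n)%N.
Proof. by apply: nvars_le => i le; rewrite monom_extE insubF // ltnNge le. Qed.

Lemma monom_extK n (k : 'X_{1..n}) : monom_of n (monom_ext k) = k.
Proof. by apply/mnmP => i; rewrite mnmE monom_extE valK. Qed.

(** The coefficient of s_kap can be read off in [size kap] variables. *)
Lemma schur_expansion_uniq f c c' :
  schur_expansion f c -> schur_expansion f c' -> c = c'.
Proof.
move=> fc fc'; apply/funext => kap.
apply: (@schur_comb_uniq (size kap) K _ _ kap) => //; apply: fpsP => k.
rewrite -[k in LHS]monom_extK -[k in RHS]monom_extK.
by rewrite -!sum_schur ?nvars_ext // -fc -fc'.
Qed.

Lemma schur_coefE f c : schur_expansion f c -> schur_coef f = c.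
Proof.
by move=> fc; apply: xget_unique => //= c' /schur_expansion_uniq; apply.
Qed.

(** The least number of rows that accommodates both partitions; by [transitionS] any larger number
    gives the same value. *)
Definition groth_coef (a b : K) mu kap : K :=
  transition a b (maxn (size mu) (size kap)) (part_fun mu) (part_fun kap).

Lemma groth_coefE a b mu kap N : (size mu <= N)%N -> (size kap <= N)%N ->
  transition a b N (part_fun mu) (part_fun kap) = groth_coef a b mu kap.
Proof.
move=> smu skap; rewrite /groth_coef; set n := maxn _ _.
have -> : N = (n + (N - n))%N by rewrite subnKC // geq_max smu.
elim: (N - n)%N => [|k IH]; first by rewrite addn0.
rewrite addnS transitionS // part_out //; apply: leq_trans (leq_addr _ _).
  exact: leq_maxl.
exact: leq_maxr.
Qed.

Lemma sum_part_fun kap N : (size kap <= N)%N -> (\sum_(j < N) part_fun kap j)%N = sumn kap.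
Proof.
move=> sz; rewrite -(big_mkord xpredT (part_fun kap)) (big_cat_nat (n := size kap)) //=.
rewrite [X in (_ + X)%N]big_nat_cond [X in (_ + X)%N]big1 ?addn0; last first.
  by move=> i /andP[/andP[le _] _]; rewrite part_out.
by rewrite sumnE [RHS](big_nth 0%N).
Qed.

Lemma groth_coef_triangular a b mu kap : (sumn kap <= sumn mu)%N ->
  groth_coef a b mu kap = (mu == kap)%:R.
Proof.
move=> le; have smu := leq_maxl (size mu) (size kap).
have skap := leq_maxr (size mu) (size kap).
rewrite /groth_coef transition_triangular ?sum_part_fun //; try exact: part_dec.
congr (nat_of_bool _)%:R; apply/forallP/eqP => [h|-> //].
apply: part_fun_inj => i; have [lt|ge] := ltnP i (maxn (size mu) (size kap)).
  by apply/eqP; apply: (h (Ordinal lt)).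
by rewrite !part_out // (leq_trans _ ge).
Qed.

Lemma groth_entry n (a b : K) (i : 'I_n) (j l : nat) :
  fps_div (fps_of ('X_i ^+ (l + (n - j.+1)) * (1 + b *: 'X_i) ^+ j))
          (fps_of ((1 - a *: 'X_i) ^+ l)) = univ i (column a b n j l).
Proof.
apply: fps_divE; first exact: regular_geom.
rewrite mulrC rmorphXn -scaleNr univ_iter_linfac rmorphM !rmorphXn.
rewrite -[RHS]mulr1 -(univ_unit i) -mulrA univ_iter_linfac univ_iter_shift.
congr univ; elim: l => [|l IH]; first by [].
rewrite iterSr columnS linfac_shift linfac_geom_inv.
rewrite -[LHS](iter_comm (f := shift)) ?IH // => u.
by rewrite linfac_shift.
Qed.

Lemma groth_expansion a b mu : schur_expansion (groth a b mu) (groth_coef a b mu).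
Proof.
move=> m; rewrite (sum_schur _ (leq_maxr (size mu) (nvars m))).
rewrite /groth /stable_limit /=; set n := maxn _ _.
rewrite -[groth_fin a b mu n]/(bialternant _).
rewrite (bialternant_comb (u := fun j => column a b n j (part_fun mu j))); last first.
  by move=> i j; rewrite groth_entry.
rewrite /= !big_seq; apply: eq_bigr => kap; rewrite mem_parts_in // => /andP[sz _].
congr (_ * _); rewrite -(@groth_coefE _ _ _ _ n) ?leq_maxl // /transition -det_tr.
by congr (\det _); apply/matrixP => i j; rewrite !mxE mnmE.
Qed.

End Expansions.

(** * Duality with respect to the Hall inner product *)

Section Duality.
Context {K : comNzRingType}.
Implicit Types (m : monom) (kap la mu nu : intpart) (c d : intpart -> K) (f h : series K).

Lemma size_le_sumn kap : (size kap <= sumn kap)%N.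
Proof.
rewrite -(sum_part_fun (leqnn (size kap))) -{1}[size kap]card_ord -sum1_card.
by apply: leq_sum => i _; rewrite lt0n part_eq0 -ltnNge.
Qed.

Lemma mem_parts_sumn kap D : (sumn kap <= D)%N -> kap \in parts_in D D.+1.
Proof.
move=> le; rewrite mem_parts_in // ltnS (leq_trans (size_le_sumn kap)) //=.
exact: leq_trans (part0_le_sumn kap) le.
Qed.

Lemma hallE f h c d D : schur_expansion f c -> schur_expansion h d ->
  (forall nu, (D < sumn nu)%N -> c nu = 0) ->
  hall f h = \sum_(nu <- parts_in D D.+1) c nu * d nu.
Proof.
move=> fc hd cD; rewrite /hall (schur_coefE fc) (schur_coefE hd).
have out nu : nu \notin parts_in D D.+1 -> c nu * d nu = 0.
  by move=> no; rewrite cD ?mul0r // ltnNge; apply: contra no; apply: mem_parts_sumn.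
rewrite (fsbigE (parts_in D D.+1)) ?parts_in_uniq //; last by move=> nu _; apply: out.
by apply: eq_bigl => nu; rewrite in_setT.
Qed.

(** With [N = D.+1] rows, which is positive and at least [size kap], the bound [M = D + D.+1]
    satisfies the requirement [kap 0 + N <= M] of [cauchy]. *)
Lemma cauchy_series (a b : K) kap m (D := sumn kap) :
  \sum_(la <- parts_in D.+1 (D + D.+1)) groth_coef (- a) (- b) la kap * rbt_sum a b la m =
  schur kap m.
Proof.
rewrite schurE -(schur_poly_rbt _ (leqnn (nvars m))) /schur_poly; set n := nvars m.
have szk : (size kap <= D.+1)%N by apply/leqW/size_le_sumn.
rewrite -(@cauchy _ a%:MP b%:MP _ D.+1 (D + D.+1)) ?leq_add2r ?part0_le_sumn //.
rewrite raddf_sum /= !big_seq; apply: eq_bigr => la.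
rewrite mem_parts_in ?addnS // => /andP[sz _].
rewrite (rbt_sumE (part_sorted la) a b (leqnn n)) -(groth_coefE _ _ sz szk) -mcoeffCM.
by rewrite (rmorph_transition (@mpolyC n K)) !rmorphN mulrC.
Qed.

(** [cauchy_series] says that the Schur coefficients of the tableau sums are inverse to [groth_coef]
    on one side, while duality needs the other side. The induction yields that side directly: by
    triangularity F_kap is s_kap minus a combination of the F_la with la of smaller size, whose
    pairings are known. *)
Lemma rbt_expansion (a b : K) kap : exists e : intpart -> K,
  [/\ forall nu, (sumn kap < sumn nu)%N -> e nu = 0,
      schur_expansion (rbt_sum a b kap) e &
      forall mu D, (sumn kap <= D)%N ->
        \sum_(nu <- parts_in D D.+1) e nu * groth_coef (- a) (- b) mu nu =
        (kap == mu)%:R].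
Proof.
have [N] := ubnP (sumn kap); elim: N kap => // N IH kap ltN.
have /choice[e he] (la : intpart) : exists e : intpart -> K, (sumn la < sumn kap)%N ->
  [/\ forall nu, (sumn la < sumn nu)%N -> e nu = 0,
      schur_expansion (rbt_sum a b la) e &
      forall mu D, (sumn la <= D)%N ->
        \sum_(nu <- parts_in D D.+1) e nu * groth_coef (- a) (- b) mu nu =
        (la == mu)%:R].
  have [lt|ge] := ltnP (sumn la) (sumn kap); last by exists (fun=> 0).
  by have [|e he] := IH la; [apply: leq_trans lt _ | exists e].
pose L := [seq la : intpart <- parts_in (sumn kap).+1 (sumn kap + (sumn kap).+1) |
             (sumn la < sumn kap)%N].
pose C := groth_coef (- a) (- b).
pose ek nu := (nu == kap)%:R - \sum_(la <- L) C la kap * e la nu.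
have memL la : (la \in L) -> (sumn la < sumn kap)%N.
  by rewrite mem_filter => /andP[].
have rbtE m : rbt_sum a b kap m =
    schur kap m - \sum_(la <- L) C la kap * rbt_sum a b la m.
  rewrite -(cauchy_series a b kap m) (bigID (fun la : intpart => sumn la < sumn kap)%N) /=.
  rewrite /L big_filter addrC addrK.
  rewrite big_mkcond (bigD1_seq kap) ?parts_in_uniq //=; last first.
    rewrite mem_parts_in ?addnS // (leqW (size_le_sumn kap)) ltnS.
    exact: leq_trans (part0_le_sumn kap) (leq_addr _ _).
  rewrite ltnn groth_coef_triangular // eqxx mul1r big1 ?addr0 // => la /negPf ne.
  by case: leqP => // le; rewrite groth_coef_triangular ?ne ?mul0r.
exists ek; split.
- move=> nu lt; rewrite /ek (_ : nu == kap = false); last first.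
    by apply/negP => /eqP e0; rewrite e0 ltnn in lt.
  rewrite big_seq big1 ?subr0 // => la /memL lt'.
  by have [-> //] := he la lt'; rewrite ?mulr0 //; apply: ltn_trans lt.
- move=> m; rewrite rbtE (sum_schur _ (leqnn (nvars m))).
  set k := monom_of _ m; have lt := ltnSn (mdeg k); set d := (mdeg k).+1 in lt.
  rewrite (schur_combE _ lt).
  transitivity (\sum_(nu <- parts_in (nvars m) d) ((nu == kap)%:R * (schur_poly nu)@_k) -
     \sum_(la <- L) C la kap * \sum_(nu <- parts_in (nvars m) d) e la nu * (schur_poly nu)@_k).
    congr (_ - _).
      have := sum_schur (fun nu => (nu == kap)%:R : K) (leqnn (nvars m)).
      rewrite (schur_combE _ lt) => <-.
      rewrite (fsbigE [:: kap]) ?big_mkcond ?big_seq1 ?in_setT ?eqxx ?mul1r //.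
      by move=> nu _; rewrite mem_seq1 => /negPf ->; rewrite mul0r.
    rewrite !big_seq; apply: eq_bigr => la /memL lt'; congr (_ * _).
    by have [_ -> _] := he la lt'; rewrite (sum_schur _ (leqnn _)) (schur_combE _ lt).
  under [X in _ - X]eq_bigr do rewrite mulr_sumr.
  rewrite exchange_big -sumrB; apply: eq_bigr => nu _.
  by rewrite /ek mulrBl mulr_suml; congr (_ - _); apply: eq_bigr => la _; rewrite mulrA.
move=> mu D leD.
transitivity (\sum_(nu <- parts_in D D.+1) ((nu == kap)%:R * C mu nu) -
   \sum_(la <- L) C la kap * \sum_(nu <- parts_in D D.+1) e la nu * C mu nu).
  under [X in _ - X]eq_bigr do rewrite mulr_sumr.
  rewrite exchange_big -sumrB; apply: eq_bigr => nu _.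
  by rewrite /ek mulrBl mulr_suml; congr (_ - _); apply: eq_bigr => la _; rewrite mulrA.
rewrite (bigD1_seq kap) ?parts_in_uniq ?mem_parts_sumn //= eqxx mul1r big1 ?addr0; last first.
  by move=> nu /negPf ->; rewrite mul0r.
rewrite big_seq (eq_bigr (fun la => C la kap * (la == mu)%:R)) => [|la /memL lt']; last first.
  have [_ _ ->//] := he la lt'; apply: leq_trans leD; exact: ltnW.
(* The pairing is now [C mu kap] minus the sum of [C la kap] over those [la] in [L] equal to [mu].
   If [mu] is smaller than [kap], the two cancel; otherwise the sum is 0 and triangularity
   applies. *)
rewrite -big_seq; have [lt|ge] := ltnP (sumn mu) (sumn kap).
  rewrite (bigD1_seq mu) ?filter_uniq ?parts_in_uniq //=; last first.
    rewrite mem_filter lt mem_parts_in ?addnS //.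
    have le := ltnW lt.
    rewrite (leqW (leq_trans (size_le_sumn mu) le)) ltnS /=.
    by apply: leq_trans (part0_le_sumn mu) (leq_trans le (leq_addr _ _)).
  rewrite eqxx mulr1 big1 ?addr0 ?subrr => [|la /negPf ->]; last by rewrite mulr0.
  by case: eqP => // e0; rewrite e0 ltnn in lt.
rewrite big_seq big1 ?subr0 => [|la /memL lt']; last first.
  by case: eqP => [e0|]; rewrite ?mulr0 //; rewrite e0 ltnNge ge in lt'.
by rewrite /C groth_coef_triangular // eq_sym.
Qed.

Lemma monom_degE m n : (nvars m <= n)%N -> mdeg (monom_of n m) = monom_deg m.
Proof.
move=> le; rewrite mdegE (eq_bigr (fun i : 'I_n => m i)) => [|i _]; last by rewrite mnmE.
rewrite -(big_mkord xpredT (fun i => m i)) /monom_deg.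
rewrite (bigID (fun i => i \in finsupp m)) /= [X in (_ + X)%N]big1 ?addn0; last first.
  by move=> i; rewrite memNfinsupp => /eqP.
rewrite -big_filter; apply/perm_big/uniq_perm; rewrite ?filter_uniq ?iota_uniq ?fset_uniq //.
move=> i; rewrite mem_filter mem_index_iota /= andb_idr // mem_finsupp => ne.
apply: leq_trans le; rewrite ltnNge; apply: contra ne => /nvars_out ->.
by [].
Qed.

Lemma monom_ofK m n : (nvars m <= n)%N -> monom_ext (monom_of n m) = m.
Proof.
move=> le; apply/fsfunP => i; rewrite monom_extE; case: insubP => [j _ <-|].
  by rewrite mnmE.
by rewrite -leqNgt => ge; rewrite nvars_out // (leq_trans le).
Qed.

Lemma schur_poly_empty n : schur_poly empty_part = 1 :> {mpoly K[n]}.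
Proof. exact: rpp_poly_empty. Qed.

Lemma vandermonde_alt n : @vandermonde n K = Fps (alt_coef empty_part).
Proof. by rewrite -schur_poly_vandermonde // schur_poly_empty rmorph1 mul1r. Qed.

Lemma vandermonde_perm n (s : 'S_n) (k : 'X_{1..n}) :
  @vandermonde n K (mperm k s) = (-1) ^+ s * vandermonde k.
Proof. by rewrite vandermonde_alt /= alt_coef_perm. Qed.

Lemma mul_vandermonde_perm n (f : fps n K) (s : 'S_n) (k : 'X_{1..n}) :
  (f * vandermonde) (mperm k s) =
  (-1) ^+ s * (Fps (fun l => f (mperm l s)) * vandermonde) k.
Proof.
set g := Fps _; set d := (mdeg k).+1.
have dk : (mdeg (mperm k s) < d)%N by rewrite /mperm mdeg_mperm.
rewrite [LHS](fps_mulE _ _ dk) [X in _ = _ * X](fps_mulE _ _ (ltnSn _)) -/d.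
have -> : (fps_trunc d f * fps_trunc d vandermonde)@_(mperm k s) =
   (msym s (fps_trunc d f) * msym s (fps_trunc d (@vandermonde n K)))@_k.
  by rewrite -msymM mcoeff_sym.
rewrite -[RHS]mcoeffZ scalerAr; apply: (@eq_mcoeffM _ _ d) => // l ld.
  by rewrite mcoeff_sym !fps_truncE ?mdeg_mperm.
rewrite mcoeff_sym mcoeffZ !fps_truncE ?mdeg_mperm //.
exact: vandermonde_perm.
Qed.

(** The alternant and the Vandermonde product change by the same sign, and the latter can be
    cancelled. *)
Lemma schur_poly_perm n kap (s : 'S_n) (k : 'X_{1..n}) :
  (schur_poly kap : {mpoly K[n]})@_(mperm k s) = (schur_poly kap)@_k.
Proof.
have [sz|sz] := leqP (size kap) n; last by rewrite /schur_poly schur_vanish ?mcoeff0.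
pose f : fps n K := fps_of (schur_poly kap); pose g := Fps (fun l => f (mperm l s)).
suff e : g = f by rewrite -[LHS]/(g k) e.
apply: (regular_inj regular_vandermonde); apply: fpsP => l.
apply: (can_inj (signrMK (s : bool))); rewrite -mul_vandermonde_perm.
by rewrite /f schur_poly_vandermonde // /= alt_coef_perm.
Qed.

(** The bijection [s] need not preserve the first [n] indices, so [p] comes from comparing multisets
    of exponents: the nonzero ones match through [s], and then the numbers of zeros agree because
    both lists have [n] entries. *)
Lemma monom_perm m m' (s : nat -> nat) n : bijective s -> (forall i, m' i = m (s i)) ->
  (nvars m <= n)%N -> (nvars m' <= n)%N ->
  exists p : 'S_n, monom_of n m' = mperm (monom_of n m) p.
Proof.
move=> [s' sK s'K] ms le le'.
pose p i := m i != 0%N; pose B := iota 0 n; pose A := map s B.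
have uA : uniq A by rewrite map_inj_uniq ?iota_uniq //; apply: can_inj sK.
have pAB : perm_eq [seq i <- A | p i] [seq i <- B | p i].
  apply: uniq_perm; rewrite ?filter_uniq ?iota_uniq // => i.
  rewrite !mem_filter; apply: andb_id2l => ne; rewrite mem_iota /= add0n.
  have -> : (i < n)%N.
    by apply: leq_trans le; rewrite ltnNge; apply: contra ne => /nvars_out ->.
  apply/mapP; exists (s' i); last by rewrite s'K.
  rewrite mem_iota /= add0n; apply: leq_trans le'; rewrite ltnNge.
  by apply: contra ne => /nvars_out; rewrite ms s'K => ->.
have zero C : [seq m i | i <- [seq i <- C | predC p i]] =
    nseq (size [seq i <- C | predC p i]) 0%N.
  by elim: C => //= i C IH; rewrite /p /=; case: eqP => //= ->; rewrite IH.
have pm : perm_eq [seq m i | i <- A] [seq m i | i <- B].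
  have split C : perm_eq [seq m i | i <- C]
     ([seq m i | i <- [seq i <- C | p i]] ++ [seq m i | i <- [seq i <- C | predC p i]]).
    by rewrite -map_cat perm_map // perm_sym perm_filterC.
  apply: perm_trans (split A) _; rewrite perm_sym; apply: perm_trans (split B) _.
  rewrite perm_sym !zero perm_cat ?perm_map // !size_filter.
  have h := perm_size pAB; rewrite !size_filter in h.
  have := count_predC p A; have := count_predC p B.
  by rewrite h size_map => <- /addnI ->.
have /tuple_permP[q qE] : perm_eq [tuple m' i | i < n] [tuple m i | i < n].
  have mk (h : nat -> nat) : tval [tuple h i | i < n] = [seq h i | i <- B].
    by rewrite /= /B -val_enum_ord -map_comp.
  rewrite !mk (eq_map (g := fun i => m (s i))) //.
  by rewrite (map_comp m s).
exists q; apply/mnmP => i; rewrite !mnmE.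
have := congr1 (fun t => nth 0%N t i) qE.
rewrite -tnth_nth tnth_mktuple => ->; rewrite (nth_map i) ?size_enum_ord //.
by rewrite nth_ord_enum tnth_mktuple.
Qed.

Lemma schur_symmetric kap : is_symmetric (schur kap : series K).
Proof.
move=> s m m' bs ms; pose n := maxn (nvars m) (nvars m').
rewrite !schurE -(@schur_poly_rbt _ kap m n) ?leq_maxl //.
rewrite -(@schur_poly_rbt _ kap m' n) ?leq_maxr //.
have [||p ->] := @monom_perm m m' s n bs ms; rewrite ?leq_maxl ?leq_maxr //.
exact: schur_poly_perm.
Qed.

Definition restriction n f : fps n K := Fps (fun k => f (monom_ext k)).

Lemma restriction_perm n f (s : 'S_n) k : is_symmetric f ->
  restriction n f (mperm k s) = restriction n f k.
Proof.
move=> fsym; pose ext (p : 'S_n) i := if insub i is Some j then val (p j) else i.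
have extK (p : 'S_n) : cancel (ext p) (ext (p^-1)%g).
  move=> i; rewrite /ext; case: (insubP _ i) => [j _ <-|ni]; first by rewrite valK permK.
  by rewrite insubN.
rewrite /=; apply: (fsym (ext s)).
  exists (ext (s^-1)%g); first exact: extK.
  by rewrite -{2}[s]invgK; apply: extK.
move=> i; rewrite !monom_extE /ext; case: (insubP _ i) => [j _ ij|ni]; last by rewrite insubN.
by rewrite valK mnmE.
Qed.

(** In [n] variables the product with the Vandermonde product is alternating, which gives
    coefficients [c n]. By uniqueness they do not depend on [n] once [n >= size kap], and the degree
    bound allows cutting them off at size [D]. *)
Lemma expansion_exists f D (char2 : forall x : K, x = - x -> x = 0) :
  is_symmetric f -> (forall m, f m != 0 -> (monom_deg m <= D)%N) ->
  exists c, schur_expansion f c /\ forall nu, (D < sumn nu)%N -> c nu = 0.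
Proof.
move=> fsym fD.
pose c n kap := (restriction n f * vandermonde) (stair (part_fun kap)).
have alt n : alternating (restriction n f * vandermonde).
  have perm s k : (restriction n f * vandermonde) (mperm k s) =
      (-1) ^+ s * (restriction n f * vandermonde) k.
    rewrite mul_vandermonde_perm; congr (_ * ((_ * _) : fps n K) _).
    by apply: fpsP => l; apply: restriction_perm.
  (* Swapping two equal exponents fixes the monomial but changes the sign. *)
  split=> // i j k ne e; apply: char2; have := perm (tperm i j) k.
  rewrite odd_tperm ne expr1 mulN1r => <-; congr (fps_coef _ _).
  apply/mnmP => l; rewrite mnmE.
  by case: tpermP => // ->.
have fE n : restriction n f = schur_comb (c n) by apply: schur_comb_expand.
have fm n m : (nvars m <= n)%N -> f m = schur_comb (c n) (monom_of n m).
  by move=> le; rewrite -fE /= monom_ofK.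
have cS n kap : (size kap <= n)%N -> c n.+1 kap = c n kap.
  move=> sz; apply: (schur_comb_uniq sz); apply: fpsP => k.
  have le := nvars_ext k; rewrite -[k in LHS]monom_extK -[k in RHS]monom_extK.
  by rewrite -fm // -sum_schur // (sum_schur _ (leqW le)) -fm // leqW.
have cE n kap : (size kap <= n)%N -> c n kap = c (size kap) kap.
  move=> /subnKC <-; elim: (n - _)%N => [|k IH]; first by rewrite addn0.
  by rewrite addnS cS // leq_addr.
exists (fun kap => if (sumn kap <= D)%N then c (size kap) kap else 0); split.
  move=> m; have le := leqnn (nvars m); rewrite (sum_schur _ le) (fm _ _ le) /=.
  set n := nvars m; set k := monom_of n m.
  have [leD|ltD] := leqP (mdeg k) D.
    rewrite !big_seq; apply: eq_bigr => kap; rewrite mem_parts_in // => /andP[sz _].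
    have [->|] := eqVneq ((schur_poly kap)@_k) (0 : K); first by rewrite !mulr0.
    by move=> /schur_poly_homog <-; rewrite leD cE.
  rewrite [RHS]big1 => [|kap _]; last first.
    case: ifP => leD; last by rewrite mul0r.
    have [->|] := eqVneq ((schur_poly kap)@_k) (0 : K); first by rewrite mulr0.
    by move=> /schur_poly_homog e; rewrite e ltnNge leD in ltD.
  rewrite -[LHS]/(schur_comb (c n) k) -fm //; apply/eqP; apply: contraTT ltD => /fD.
  by rewrite -leqNgt monom_degE.
by move=> nu lt; rewrite leqNgt lt.
Qed.

Lemma rbt_symfun (a b : K) kap : is_symfun (rbt_sum a b kap).
Proof.
have [e [e0 fe _]] := rbt_expansion a b kap; split.
  move=> s m m' bs ms; rewrite !fe; apply: eq_fsbigr => nu _.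
  by rewrite (@schur_symmetric nu s m m' bs ms).
exists (sumn kap) => m; apply: contraNT; rewrite -ltnNge => lt.
suff out nu : e nu * schur nu m = 0 by rewrite fe fsbig1.
have [lt'|ge] := ltnP (sumn kap) (sumn nu); first by rewrite e0 ?mul0r.
have [->|] := eqVneq (schur nu m) (0 : K); first by rewrite mulr0.
rewrite schurE -(schur_poly_rbt _ (leqnn _)) => /schur_poly_homog.
by rewrite monom_degE // => e1; rewrite e1 ltnNge ge in lt.
Qed.

(** For uniqueness, another solution has a Schur expansion [c] supported in bounded size, and
    [c - e] pairs to 0 with every G_mu. Pairing with G_nu involves [nu], with coefficient 1, and
    otherwise only larger sizes, so [c - e] vanishes by induction from the top size down. *)
Lemma dual_groth_rbt (a b : K) kap (char2 : forall x : K, x = - x -> x = 0) :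
  dual_groth a b kap = rbt_sum a b kap.
Proof.
have [e [e0 fe ed]] := rbt_expansion a b kap.
apply: xget_unique => /= [|f [[fsym [D fD]] fhall]].
  split=> [|mu]; first exact: rbt_symfun.
  rewrite (hallE fe (groth_expansion (- a) (- b) mu) e0).
  exact: ed.
have [c [fc c0]] := expansion_exists char2 fsym fD.
suff ce : c = e by apply/funext => m; rewrite fc fe ce.
pose D' := maxn D (sumn kap).
have c0' nu : (D' < sumn nu)%N -> c nu = 0.
  by move=> lt; apply: c0; apply: leq_ltn_trans lt; apply: leq_maxl.
have e0' nu : (D' < sumn nu)%N -> e nu = 0.
  by move=> lt; apply: e0; apply: leq_ltn_trans lt; apply: leq_maxr.
have pair mu : \sum_(nu <- parts_in D' D'.+1) (c nu - e nu) * groth_coef (- a) (- b) mu nu = 0.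
  under eq_bigr do rewrite mulrBl.
  rewrite sumrB ed ?leq_maxr // -(fhall mu).
  by rewrite (hallE fc (groth_expansion (- a) (- b) mu) c0') subrr.
apply/funext => nu; have [k] := ubnP (D' - sumn nu)%N.
elim: k nu => // k IH nu ltk; have [lt|le] := ltnP D' (sumn nu).
  by rewrite c0' ?e0'.
apply/eqP; rewrite -subr_eq0; apply/eqP; rewrite -(pair nu).
rewrite (bigD1_seq nu) ?parts_in_uniq ?mem_parts_sumn //=.
rewrite groth_coef_triangular // eqxx mulr1 big1 ?addr0 // => rho /negPf ne.
have [le2|lt] := leqP (sumn rho) (sumn nu).
  by rewrite groth_coef_triangular // eq_sym ne mulr0.
have [lt3|le3] := ltnP D' (sumn rho); first by rewrite c0' ?e0' ?subrr ?mul0r.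
by rewrite IH ?subrr ?mul0r //; lia.
Qed.

End Duality.

Theorem theorem7p2 (la : intpart) :
  dual_groth alpha beta la = rbt_sum alpha beta la.
Proof.
apply: dual_groth_rbt => p e; apply/mpolyP => m; rewrite mcoeff0.
by have := congr1 (mcoeff m) e; rewrite mcoeffN; lia.
Qed.
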